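(* Let $G$ be a $2$-connected loopless plane multigraph, let $R$ be a face of $G$, and let $d$ be the maximum distance in $G$ between $V(G[R])$ and a vertex of $G$ (that is, $d=\max_{v\in V(G)}\min_{u\in V(G[R])} d_G(u,v)$). Let $k$ be the maximum number of vertices in a face of $G$, i.e. the maximum of $|V(G[F])|$ over all faces $F$ of $G$. Then $G$ admits a tree-decomposition of width at most $\max\{3d+k+5,\ 2d+2k+1\}$ such that for every face $F$ of $G$, the vertex set $V(G[F])$ is contained in some bag.
   Context: Multigraphs are finite and undirected; parallel edges are allowed (and loops are allowed unless the multigraph is said to be loopless). A (multi)graph $G$ is $2$-connected if it is connected, has at least three vertices, and $G-v$ is connected for every vertex $v$. A plane multigraph is a planar multigraph together with a fixed crossing-free embedding in the plane; its faces (including the unbounded outer face) are the connected regions of the plane minus the drawing. For a face $F$ of $G$, $G[F]$ denotes the subgraph of $G$ forming the boundary of $F$. $d_G(u,v)$ is the number of edges of a shortest $u$–$v$ path in $G$. A tree-decomposition of $G$ is a tree $T$ together with bags $\beta_x\subseteq V(G)$ ($x\in V(T)$) such that for every $v\in V(G)$ the set $\{x\in V(T) : v\in\beta_x\}$ induces a (nonempty) connected subgraph of $T$, and every edge of $G$ has both endpoints in some bag. Its width is $\max_x|\beta_x|-1$. *)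

(* Defs.v *)
From mathcomp Require Import all_boot all_order all_algebra.

Set Implicit Arguments.
Unset Strict Implicit.
Unset Printing Implicit Defensive.

(* Finite undirected multigraphs. The order of the two ends of an edge only
   serves to name them: no definition below depends on it up to reversal. *)
Record multigraph := Multigraph {
  vertex : finType;
  edge : finType;
  tail_end : edge -> vertex;
  head_end : edge -> vertex }.

Definition loopless (G : multigraph) : Prop :=
  forall e : edge G, tail_end e != head_end e.

Definition adj (G : multigraph) : rel (vertex G) := fun u v =>
  [exists e : edge G, ((tail_end e == u) && (head_end e == v))
                   || ((tail_end e == v) && (head_end e == u))].
Arguments adj : clear implicits.

Definition induces_connected (T : finType) (e : rel T) (S : {set T}) : Prop :=
  S != set0 /\
  {in S &, forall x y, connect [rel u v | [&& u \in S, v \in S & e u v]] x y}.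

Definition two_connected (G : multigraph) : Prop :=
  [/\ induces_connected (adj G) [set: vertex G],
      2 < #|vertex G|
    & forall v : vertex G, induces_connected (adj G) [set~ v]].

(* Since a path visits at most #|vertex G| vertices, its length is less than
   #|vertex G|; dist u v takes the value #|vertex G| when there is no u-v path. *)
Definition path_of_length (G : multigraph) (u v : vertex G) (n : nat) : bool :=
  [exists p : n.-tuple (vertex G),
     [&& path (adj G) u p, last u p == v & uniq (u :: p)]].

Definition dist (G : multigraph) (u v : vertex G) : nat :=
  find (path_of_length u v) (iota 0 #|vertex G|).

(* The initial value #|vertex G| of the minimum is an upper bound of dist, hence is
   harmless as soon as S is nonempty. *)
Definition dist_to (G : multigraph) (S : {set vertex G}) (v : vertex G) : nat :=
  \big[minn/#|vertex G|]_(u in S) dist u v.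

Definition max_dist_to (G : multigraph) (S : {set vertex G}) : nat :=
  \max_(v : vertex G) dist_to S v.

(* Trees are nonempty by induces_connected. *)
Definition is_tree (T : finType) (e : rel T) : Prop :=
  [/\ symmetric e, irreflexive e, induces_connected e [set: T]
    & forall c : seq T, 2 < size c -> ~ ucycle e c].

Record tree_decomposition (G : multigraph) := TreeDecomposition {
  node : finType;
  tree_adj : rel node;
  bag : node -> {set vertex G};
  tree_adjP : is_tree tree_adj;
  bag_vertexP : forall v : vertex G,
    induces_connected tree_adj [set x | v \in bag x];
  bag_edgeP : forall e : edge G,
    exists x : node, (tail_end e \in bag x) && (head_end e \in bag x) }.

(* No truncation occurs when G has a vertex: some bag is then nonempty. *)
Definition width (G : multigraph) (D : tree_decomposition G) : nat :=
  (\max_(x : node D) #|bag x|) - 1.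

(* Imported only here: classical sets shadow the notations for finite sets. *)
From mathcomp Require Import boolp classical_sets functions reals topology normedtype.
Import Order.TTheory GRing.Theory Num.Theory numFieldNormedType.Exports.

Local Open Scope classical_set_scope.
Local Open Scope ring_scope.

Notation plane R := (R * R)%type.

(* Crossing-free drawings with arbitrary continuous arcs. A loop is allowed:
   its arc is only required to be injective on the open unit interval. *)
Record plane_multigraph (R : realType) := PlaneMultigraph {
  graph_of :> multigraph;
  vpoint : vertex graph_of -> plane R;
  edge_arc : edge graph_of -> R -> plane R;
  point_inj : injective vpoint;
  arc_continuous : forall e, {within `[0, 1], continuous (edge_arc e)};
  arc_tail : forall e, edge_arc e 0 = vpoint (tail_end e);
  arc_head : forall e, edge_arc e 1 = vpoint (head_end e);
  arc_inj : forall e, {in `]0, 1[ &, injective (edge_arc e)};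
  arc_avoids_point : forall e v, {in `]0, 1[, forall t, edge_arc e t <> vpoint v};
  arc_disjoint : forall e f, e <> f ->
    {in `]0, 1[ &, forall s t, edge_arc e s <> edge_arc f t} }.

Section PlaneMultigraphs.
Context {R : realType} (G : plane_multigraph R).

Definition drawing : set (plane R) :=
  range (@vpoint R G) `|` \bigcup_(e : edge G) (edge_arc e @` `[0, 1]).

Definition face (F : set (plane R)) : Prop :=
  exists2 x, (~` drawing) x & F = connected_component (~` drawing) x.

Definition frontier (A : set (plane R)) : set (plane R) :=
  closure A `\` interior A.

(* V(G[F]), where G[F] consists of the vertices and edges lying on the frontier
   of F. *)
Definition face_vertices (F : set (plane R)) : {set vertex G} :=
  [set v : vertex G | `[< frontier F (vpoint v) >]]%SET.

(* The maximum of #|V(G[F])| over all faces F, taken over the finite set of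
   vertex sets of the form V(G[F]). *)
Definition max_face_size : nat :=
  \max_(S : {set vertex G} | `[< exists2 F, face F & S = face_vertices F >]) #|S|.

End PlaneMultigraphs.

(* Main.v *)
(* A forest of shortest paths to the boundary of R, together with that boundary minus an edge,
   is a spanning tree of G; by plane duality the remaining edges form a tree, the cotree, on the
   faces other than R. An edge e = uv of the cotree separates: a vertex whose descendants in the
   forest meet faces on both sides of e lies on one of the two forest paths P(u), P(v) from the
   ends of e, of at most d + 1 vertices each. Similarly, a chord of a face F with ends b, c
   separates the two parts of the boundary of F up to P(b) and P(c).

   The bags are built along the cotree. At a face F with boundary cycle x_0 ... x_(n-1), one
   sweeps an arc of the cycle by a fan of bags P(b) + P(x_i) + P(x_(i+1)) + L, where b is an end
   of the arc and the load L is constant: it consists of the vertices of the arc and of the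
   vertices of R beyond its edges. The hub bag of F consists of two paths, the whole boundary of
   F and the load. Starting at a centroid F of the cotree for the outer edges, each branch has a
   load of at most k/2 + 2, and halving each boundary gives fan bags of at most 3(d + 1) + k + 3
   vertices. At the centroid, a counting argument on a circle yields a chord with arcs balanced
   for the sum of lengths and loads, and the hub has 2(d + 1) + k + k vertices.

   Plane duality (the ends of e are joined by S iff the two sides of e are not joined across the
   edges outside S + e) is proved with Eilenberg's criterion: p and q lie in the same component
   of the complement of a compact set X iff (z - p) / (z - q) has a continuous argument on X. *)

Require Import Defs.
From mathcomp Require Import all_boot.
From mathcomp Require Import zify.

Set Implicit Arguments.
Unset Strict Implicit.
Unset Printing Implicit Defensive.

Definition joins (G : multigraph) (e : edge G) (u v : vertex G) : bool :=
  ((tail_end e == u) && (head_end e == v)) || ((tail_end e == v) && (head_end e == u)).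

Definition linked (G : multigraph) (S : pred (edge G)) : rel (vertex G) :=
  fun u v => [exists e, S e && joins e u v].

Lemma joinsC (G : multigraph) (e : edge G) u v : joins e u v = joins e v u.
Proof. by rewrite /joins orbC. Qed.

Lemma linked_sym (G : multigraph) (S : pred (edge G)) : symmetric (linked S).
Proof. by move=> u v; apply: eq_existsb => e; rewrite joinsC. Qed.

Lemma linked_connect_sym (G : multigraph) (S : pred (edge G)) : connect_sym (linked S).
Proof. exact/sym_connect_sym/linked_sym. Qed.

Lemma linked_edge (G : multigraph) (S : pred (edge G)) e :
  S e -> linked S (tail_end e) (head_end e).
Proof. by move=> Se; apply/existsP; exists e; rewrite Se /joins !eqxx. Qed.

Lemma linked_sub (G : multigraph) (S S' : pred (edge G)) u v :
  (forall e, S e -> S' e) -> connect (linked S) u v -> connect (linked S') u v.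
Proof.
move=> SS; apply: connect_sub => x y /existsP[e /andP[Se j]].
by apply: connect1; apply/existsP; exists e; rewrite SS.
Qed.

Definition at_vertex (G : multigraph) (v : vertex G) (e : edge G) : bool :=
  (tail_end e == v) || (head_end e == v).

Lemma joins_ends (G : multigraph) (e : edge G) : joins e (tail_end e) (head_end e).
Proof. by rewrite /joins !eqxx. Qed.

Lemma joins_at (G : multigraph) (e : edge G) u v :
  joins e u v -> at_vertex u e /\ at_vertex v e.
Proof.
by rewrite /at_vertex => /orP[] /andP[-> ->]; rewrite ?orbT.
Qed.

Lemma at_joins (G : multigraph) (e : edge G) u : at_vertex u e -> exists v, joins e u v.
Proof.
case/orP => /eqP <-; first by exists (head_end e); exact: joins_ends.
by exists (tail_end e); rewrite joinsC joins_ends.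
Qed.

Lemma joins_cases (G : multigraph) (e : edge G) u v x :
  joins e u v -> at_vertex x e -> x = u \/ x = v.
Proof. by case/orP => /andP[/eqP <- /eqP <-] /orP[] /eqP <-; [left|right|right|left]. Qed.

Lemma joins_eq (G : multigraph) (e : edge G) u v w : joins e u v -> joins e u w -> v = w.
Proof.
rewrite /joins => /orP[] /andP[/eqP <- /eqP <-] /orP[] /andP[/eqP e1 /eqP e2] //.
  by rewrite e2 -e1.
by rewrite e1 -e2.
Qed.

Lemma linkedP (G : multigraph) (S : pred (edge G)) u v :
  reflect (exists2 e, S e & joins e u v) (linked S u v).
Proof.
apply: (iffP existsP) => [[e /andP[Se j]]|[e Se j]]; first by exists e.
by exists e; rewrite Se.
Qed.

Lemma linked_joins (G : multigraph) (S : pred (edge G)) e u v :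
  S e -> joins e u v -> connect (linked S) u v.
Proof. by move=> Se j; apply/connect1/linkedP; exists e. Qed.

Lemma linked_ind (G : multigraph) (S : pred (edge G)) (P : vertex G -> Prop) u v :
  (forall e x y, S e -> joins e x y -> P x -> P y) ->
  connect (linked S) u v -> P u -> P v.
Proof.
move=> st /connectP[p pp ->]; elim: p u pp => //= y p IH u /andP[/linkedP[e Se j] /IH h] Pu.
exact/h/(st e u y).
Qed.

(* A path may be assumed not to come back to its first vertex. *)
Lemma first_edge (G : multigraph) (S : pred (edge G)) u v :
  connect (linked S) u v -> u != v -> exists c w, [/\ S c, joins c u w, w != u &
    connect (linked (fun x => S x && ~~ at_vertex u x)) w v].
Proof.
move=> /connectP[p0 /shortenP[p pp up _] ->]; case: p pp up => [|w p] /=; first by rewrite eqxx.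
move=> /andP[/linkedP[c Sc j] pp] /andP[up _] _; exists c, w; split => //.
  by apply: contraNneq up => ->; rewrite mem_head.
elim: p w pp up {c Sc j} => [|y p IH] w /=; first by move=> _ _; exact: connect0.
move=> /andP[/linkedP[c Sc j] pp]; rewrite in_cons negb_or => /andP[uw up].
apply: connect_trans (IH y pp up); apply: (@linked_joins _ _ c) => //.
rewrite Sc; apply: contra up => /(joins_cases j)[uE|->]; last by rewrite mem_head.
by rewrite uE eqxx in uw.
Qed.

(* [lf e] and [rf e] stand for the faces on the two sides of e. *)
Definition dual (G : multigraph) (Phi : finType) (lf rf : edge G -> Phi) : multigraph :=
  @Multigraph Phi (edge G) lf rf.

Lemma modnSml m N : (m %% N).+1 %% N = m.+1 %% N.
Proof. by rewrite -addn1 modnDml addn1. Qed.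

Definition grow N (U : {set 'I_N}) : {set 'I_N} := U :|: @ordS N @: U.

Lemma grow_full N (U : {set 'I_N}) x0 : x0 \in U -> @ordS N @: U \subset U -> U = setT.
Proof.
move=> x0U US; have N0 : 0 < N := leq_ltn_trans (leq0n x0) (ltn_ord x0).
have key i : Ordinal (ltn_pmod (x0 + i) N0) \in U.
  elim: i => [|i IH]; first by congr (_ \in U): x0U; apply: val_inj; rewrite /= addn0 modn_small.
  have -> : Ordinal (ltn_pmod (x0 + i.+1) N0) = ordS (Ordinal (ltn_pmod (x0 + i) N0)).
    by apply: val_inj; rewrite /= modnSml addnS.
  by apply: (subsetP US); exact: imset_f.
apply/setP => z; rewrite in_setT; have := key (z + N - x0); congr (_ \in U).
by apply: val_inj; rewrite /= subnKC ?modnDr ?modn_small // (leq_trans (ltnW (ltn_ord x0))) ?leq_addl.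
Qed.

Lemma iter_grow_card N (U T : {set 'I_N}) x0 i : x0 \in U -> T != set0 ->
  [disjoint iter i (@grow N) U & T] -> #|U| + i <= #|iter i (@grow N) U|.
Proof.
move=> x0U /set0Pn[y yT]; elim: i => [|i IH]; first by rewrite addn0.
have mono j : x0 \in iter j (@grow N) U by elim: j => //= j x0j; rewrite in_setU x0j.
rewrite /= => dj; have dj' : [disjoint iter i (@grow N) U & T].
  by apply: disjointWl dj; exact: subsetUl.
rewrite addnS; apply: leq_ltn_trans (IH dj') _; apply: proper_card.
rewrite /grow properE subsetUl /= subUset subxx /=; apply/negP => /(grow_full (mono i)) E.
by have := disjointFl dj' yT; rewrite E in_setT.
Qed.

Lemma iter_growP N (U : {set 'I_N}) i z : z \in iter i (@grow N) U ->
  exists y s, [/\ y \in U, s <= i & val z = (y + s) %% N].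
Proof.
elim: i z => [|i IH] z /=; first by exists z, 0; rewrite addn0 modn_small.
rewrite in_setU => /orP[/IH[y [s [yU si zE]]]|/imsetP[z' /IH[y [s [yU si zE]]] ->]].
  by exists y, s; rewrite yU leqW.
by exists y, s.+1; split=> //=; rewrite zE modnSml addnS.
Qed.

Lemma iter_shiftP N (U : {set 'I_N}) i z : z \in iter i (fun V : {set 'I_N} => @ordS N @: V) U ->
  exists2 y, y \in U & val z = (y + i) %% N.
Proof.
elim: i z => [|i IH] z /=; first by exists z; rewrite ?addn0 ?modn_small.
move=> /imsetP[z' /IH[y yU zE] ->]; exists y => //=.
by rewrite zE modnSml addnS.
Qed.

(* Among the N points of a circle, the n ends of the arcs of lengths 1 + w t and the points at
   distance between N - k - 1 and k + 1 after one of them cannot be disjoint: the second set has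
   at least n + (2k + 2 - N) elements. *)
Lemma balanced_arcs n (w : nat -> nat) k : 0 < n -> n <= k -> \sum_(0 <= t < n) w t <= k ->
  exists r s, [/\ r < n, r <= s <= n, \sum_(r <= t < s) (w t).+1 <= k.+1 &
    \sum_(0 <= t < n) (w t).+1 <= \sum_(r <= t < s) (w t).+1 + k.+1].
Proof.
move=> n0 nk wk; pose P t := \sum_(0 <= u < t) (w u).+1.
have PE r s : r <= s -> \sum_(r <= t < s) (w t).+1 = P s - P r.
  move=> rs; suff -> : P s = P r + \sum_(r <= t < s) (w t).+1 by rewrite addKn.
  exact: big_cat_nat.
have PS t : P t.+1 = P t + (w t).+1 by rewrite /P big_nat_recr.
have Plt r s : r < s -> P r < P s.
  elim: s => // s IH; rewrite ltnS leq_eqVlt => /orP[/eqP ->|/IH rs]; rewrite PS; lia.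
have Ple r s : r <= s -> P r <= P s.
  by rewrite leq_eqVlt => /orP[/eqP ->//|/Plt/ltnW].
set N := P n.
have NE : N = n + \sum_(0 <= t < n) w t.
  rewrite /N /P; under eq_bigr do rewrite -add1n.
  by rewrite big_split /= sum_nat_const_nat subn0 muln1.
have [Nk|Nk] := leqP N k.+1.
  exists 0, n; rewrite PE // -/N /P big_geq // subn0 leqnn /=; split=> //.
  by rewrite -[X in X <= _]/N leq_addr.
have [|no] := boolP [exists r : 'I_n, [exists s : 'I_n, [&& r <= s, P s - P r <= k.+1 &
    N <= P s - P r + k.+1]]].
  move=> /existsP[r /existsP[s /and3P[rs a b]]]; exists r, s.
  by rewrite PE // rs (ltnW (ltn_ord s)); split.
exfalso; have {}no r s : r < n -> s < n -> P r <= P s -> P s - P r <= k.+1 ->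
    N <= P s - P r + k.+1 -> False.
  move=> rn sn rs a b; case/negP: no; apply/existsP; exists (Ordinal rn).
  apply/existsP; exists (Ordinal sn); rewrite /= a b !andbT.
  by rewrite leqNgt; apply/negP => /Plt; rewrite ltnNge rs.
pose pt (t : 'I_n) : 'I_N := Ordinal (Plt _ _ (ltn_ord t) : P t < N).
pose T : {set 'I_N} := [set pt t | t : 'I_n].
have Tn : #|T| = n.
  rewrite card_imset ?card_ord // => s t /(congr1 val) /= E; apply: val_inj => /=.
  by case: (ltngtP s t) => // /Plt; rewrite E ltnn.
have TP y : y \in T -> exists2 t, t < n & val y = P t.
  by move=> /imsetP[t _ ->]; exists t.
pose U : {set 'I_N} := iter (N - k.+1) (fun V : {set 'I_N} => @ordS N @: V) T.
have Un : #|U| = n.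
  rewrite -Tn /U; elim: (N - k.+1) => //= i <-; apply: card_imset; exact: ordS_inj.
have [x0 x0U] : exists x0, x0 \in U by apply/card_gt0P; rewrite Un.
have T0 : T != set0 by rewrite -card_gt0 Tn.
have N2 : N <= k + k by rewrite NE leq_add.
pose M := k.+1 + k.+1 - N.
have dj : [disjoint iter M (@grow N) U & T].
  apply/pred0P => z /=; apply/negP => /andP[/iter_growP[y [s [yU sM zE]]] /TP[t tn zt]].
  have [y' /TP[r rn y'E] yE] := iter_shiftP yU.
  rewrite zE yE modnDml y'E -addnA in zt.
  have Pr : P r < N := Plt _ _ rn; have Pt : P t < N := Plt _ _ tn.
  set dl := N - k.+1 + s in zt.
  have dl1 : dl <= k.+1 by rewrite /dl; move: sM Nk N2; rewrite /M; clear; lia.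
  have dl2 : N <= dl + k.+1 by rewrite /dl; clear; lia.
  have [small|big] := ltnP (P r + dl) N.
    rewrite modn_small // in zt.
    by apply: (no r t rn tn); clear - zt dl1 dl2; lia.
  have E : P r + dl = P t + N.
    rewrite -(subnK big) modnDr modn_small in zt; first by rewrite -zt subnK.
    by clear - Pr dl1 Nk big; lia.
  by apply: (no t r tn rn); clear - E dl1 dl2 Nk; lia.
have := iter_grow_card x0U T0 dj; rewrite Un => ge.
have le_N : #|iter M (@grow N) U| + n <= N.
  rewrite -[X in _ <= X]card_ord -[X in _ + X]Tn.
  have /eqP <- : #|iter M (@grow N) U :|: T| == #|iter M (@grow N) U| + #|T|.
    by rewrite (leq_card_setU _ _).2.
  exact: max_card.
have : n + M + n <= N by apply: leq_trans le_N; rewrite leq_add2r.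
by rewrite /M; move: wk nk Nk NE; clear; lia.
Qed.

Lemma sum_rot n (a : nat -> nat) r : r <= n ->
  \sum_(0 <= t < n) a ((t + r) %% n) = \sum_(0 <= t < n) a t.
Proof.
move=> rn; have -> : \sum_(0 <= t < n) a ((t + r) %% n) = \sum_(r <= u < n + r) a (u %% n).
  by rewrite (big_addn 0 (n + r) r) addnK.
rewrite (big_cat_nat (n := n)) //= ?leq_addr // addnC (big_cat_nat (n := r) (m := 0)) //=.
congr (_ + _); last first.
  by rewrite big_nat_cond [RHS]big_nat_cond; apply: eq_bigr => t /andP[/andP[_ tn] _]; rewrite modn_small.
rewrite -{1}[n]add0n big_addn addKn big_nat_cond [RHS]big_nat_cond.
apply: eq_bigr => t /andP[/andP[_ tr] _]; rewrite modnDr modn_small //; exact: leq_trans tr rn.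
Qed.

Lemma balanced_rotation n (w : nat -> nat) k : 0 < n -> n <= k -> \sum_(0 <= t < n) w t <= k ->
  exists r j, [/\ r < n, j <= n, \sum_(0 <= t < j) (w ((t + r) %% n)).+1 <= k.+1 &
    \sum_(j <= t < n) (w ((t + r) %% n)).+1 <= k.+1].
Proof.
move=> n0 nk wk; have [r [s [rn /andP[rs sn] le1 le2]]] := balanced_arcs n0 nk wk.
have jn : s - r <= n := leq_trans (leq_subr _ _) sn.
exists r, (s - r).
have E : \sum_(0 <= t < s - r) (w ((t + r) %% n)).+1 = \sum_(r <= t < s) (w t).+1.
  rewrite [RHS](big_addn 0 s r) big_nat_cond [RHS]big_nat_cond; apply: eq_bigr => t /andP[/andP[_ ts] _].
  by rewrite modn_small //; apply: leq_trans sn; rewrite addnC -ltn_subRL.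
split=> //; first by rewrite E.
rewrite -(leq_add2l (\sum_(0 <= t < s - r) (w ((t + r) %% n)).+1)).
rewrite -big_cat_nat //= (sum_rot (fun t => (w t).+1) (ltnW rn)) E.
exact: le2.
Qed.

(** * Tree-decompositions built leaf by leaf *)

Section BagLists.
Variable V : finType.
Implicit Types (B : {set V}) (D : seq {set V}).

Definition covered D : {set V} := \bigcup_(B <- D) B.

Lemma coveredP D v : reflect (exists2 B, B \in D & v \in B) (v \in covered D).
Proof.
rewrite /covered; elim: D => [|B D IH]; first by rewrite big_nil inE; constructor => -[].
rewrite big_cons in_setU; apply: (iffP orP) => [[vB|/IH[B' BD vB]]|[B']].
- by exists B => //; rewrite mem_head.
- by exists B' => //; rewrite in_cons BD orbT.
- by rewrite in_cons => /orP[/eqP ->|BD] vB; [left|right; apply/IH; exists B'].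
Qed.

Lemma covered_cons B D : covered (B :: D) = B :|: covered D.
Proof. by rewrite /covered big_cons. Qed.

(* The bags of a tree-decomposition, listed so that each one is a leaf attached to one of
   the following ones. *)
Inductive leaf_list (m : nat) : seq {set V} -> Prop :=
| leaf_one B : #|B| <= m -> leaf_list m [:: B]
| leaf_cons B B' D : leaf_list m D -> B' \in D -> B :&: covered D \subset B' ->
    #|B| <= m -> leaf_list m (B :: D).

Lemma leaf_list_card m D B : leaf_list m D -> B \in D -> #|B| <= m.
Proof.
move=> ok; elim: ok B => [B0 c B|B0 B' D0 _ IH _ _ c B]; first by rewrite inE => /eqP ->.
by rewrite in_cons => /orP[/eqP ->|/IH].
Qed.

Definition leaf_adj (T : finType) (e : rel T) (x0 : T) : rel (option T) := fun a b =>
  match a, b with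
  | None, None => false
  | None, Some x | Some x, None => x == x0
  | Some x, Some y => e x y
  end.

Lemma connect_some (T : finType) (e : rel T) (S : {set T}) (S' : {set option T})
    (e' : rel (option T)) x y : (forall x, x \in S -> Some x \in S') ->
  (forall x y, e x y -> e' (Some x) (Some y)) ->
  connect [rel u v | [&& u \in S, v \in S & e u v]] x y ->
  connect [rel u v | [&& u \in S', v \in S' & e' u v]] (Some x) (Some y).
Proof.
move=> SS ee /connectP[p pp ->]; elim: p x pp => [|z p IH] x /=; first by rewrite connect0.
move=> /andP[/and3P[xS zS xz] pp]; apply: connect_trans (IH z pp); apply: connect1.
by rewrite /= !SS // ee.
Qed.

Lemma is_tree_unit : @is_tree unit (fun _ _ => false).
Proof.
split=> //.
- split; first by apply/set0Pn; exists tt; rewrite inE.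
  by move=> [] [] _ _; exact: connect0.
- by case=> [|x [|y c]] //= _ /andP[]; rewrite andbF.
Qed.

Lemma is_tree_leaf (T : finType) (e : rel T) (x0 : T) : is_tree e -> is_tree (leaf_adj e x0).
Proof.
case=> se ie [_ ce] ac; split.
- by move=> [x|] [y|] //=; exact: se.
- by move=> [x|] //=; exact: ie.
- split; first by apply/set0Pn; exists None; rewrite inE.
  have up x : connect [rel u v | [&& u \in [set: option T], v \in [set: option T] & leaf_adj e x0 u v]] None (Some x).
    apply: (@connect_trans _ _ (Some x0)); first by apply: connect1; rewrite /= !inE eqxx.
    by apply: (connect_some (e := e) _ _ (ce x0 x (in_setT _) (in_setT _))) => // z; rewrite !inE.
  have dn x : connect [rel u v | [&& u \in [set: option T], v \in [set: option T] & leaf_adj e x0 u v]] (Some x) None.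
    apply: (@connect_trans _ _ (Some x0)); last by apply: connect1; rewrite /= !inE eqxx.
    by apply: (connect_some (e := e) _ _ (ce x x0 (in_setT _) (in_setT _))) => // z; rewrite !inE.
  move=> [x|] [y|] _ _ //; try exact: connect0.
  exact: connect_trans (dn x) (up y).
- move=> c c2 uc; have [nc|nc] := boolP (None \in c).
    have [i c' rc] := rot_to nc.
    have : ucycle (leaf_adj e x0) (None :: c') by rewrite -rc rot_ucycle.
    have : 2 < size (None :: c') by rewrite -rc size_rot.
    case: c' {rc} => [|a [|b c']] //= _; rewrite /ucycle /=.
    case: a => // a /andP[/and3P[/eqP -> _ pp] /and4P[_ ac' _ _]].
    move: pp ac'; rewrite rcons_path => /andP[_].
    case: (lastP c') => [|c'' l]; first by case: b => //= b /eqP ->; rewrite inE eqxx.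
    rewrite last_rcons; case: l => //= l /eqP ->.
    by rewrite in_cons mem_rcons mem_head orbT.
  have cE : c = map Some (pmap id c).
    elim: (c) nc => //= -[x|] c' IH; rewrite in_cons ?negb_or //= => /IH {1}->.
    by [].
  apply: (ac (pmap id c)); first by rewrite -(size_map Some) -cE.
  move: uc; rewrite cE /ucycle (map_inj_uniq Some_inj).
  rewrite -cE => /andP[cy ->]; rewrite andbT.
  move: cy; rewrite {1}cE; case: (pmap id c) => //= x s.
  rewrite -map_rcons path_map; exact: sub_path.
Qed.

Lemma leaf_list_tree m D : leaf_list m D ->
  exists (T : finType) (e : rel T) (bag : T -> {set V}), [/\ is_tree e,
    forall v, v \in covered D -> induces_connected e [set x | v \in bag x],
    forall x, bag x \in D & forall B, B \in D -> exists x, bag x = B].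
Proof.
elim=> [B cB|B B' D0 _ [T [e [bag [te ve bD Db]]]] BD BI cB].
  exists unit, (fun _ _ => false), (fun _ => B); split.
  - exact: is_tree_unit.
  - move=> v /coveredP[B']; rewrite inE => /eqP -> vB; split.
      by apply/set0Pn; exists tt; rewrite inE.
    by move=> [] [] _ _; exact: connect0.
  - by move=> _; rewrite mem_head.
  - by move=> B'; rewrite inE => /eqP ->; exists tt.
have [x0 x0B] := Db _ BD.
exists (option T), (leaf_adj e x0), (fun o => if o is Some x then bag x else B); split.
- exact: is_tree_leaf.
- move=> v; rewrite covered_cons in_setU => vc.
  set S' := [set x | _].
  have [vD|vD] := boolP (v \in covered D0); last first.
    have vB : v \in B by rewrite (negbTE vD) orbF in vc.
    have SE x : Some x \in S' = false.
      by rewrite inE; apply: contraNF vD => vx; apply/coveredP; exists (bag x).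
    split; first by apply/set0Pn; exists None; rewrite inE.
    by move=> [x|] [y|]; rewrite ?SE // => _ _; exact: connect0.
  have [ne cn] := ve v vD.
  have cs x y : Some x \in S' -> Some y \in S' ->
      connect [rel u v | [&& u \in S', v \in S' & leaf_adj e x0 u v]] (Some x) (Some y).
    rewrite !inE => vx vy; apply: (connect_some (e := e) (S := [set x | v \in bag x])) => //.
      by move=> z; rewrite !inE.
    by apply: cn; rewrite inE.
  split.
    by have /set0Pn[x xS] := ne; apply/set0Pn; exists (Some x); rewrite inE; move: xS; rewrite inE.
  have nB : None \in S' -> Some x0 \in S'.
    rewrite !inE x0B => vB; apply: (subsetP BI); by rewrite in_setI vB.
  have nl : None \in S' -> connect [rel u v | [&& u \in S', v \in S' & leaf_adj e x0 u v]] None (Some x0).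
    by move=> nS; apply: connect1; rewrite /= nS (nB nS) eqxx.
  have nr : None \in S' -> connect [rel u v | [&& u \in S', v \in S' & leaf_adj e x0 u v]] (Some x0) None.
    by move=> nS; apply: connect1; rewrite /= nS (nB nS) eqxx.
  move=> [x|] [y|] xS yS; [exact: cs| | |exact: connect0].
    by apply: connect_trans (nr yS); apply: cs => //; exact: nB.
  by apply: connect_trans (nl xS) _; apply: cs => //; exact: nB.
- by move=> [x|]; rewrite in_cons ?eqxx // bD orbT.
- move=> B0; rewrite in_cons => /orP[/eqP ->|/Db[x xB]]; first by exists None.
  by exists (Some x).
Qed.

End BagLists.

Lemma leaf_list_decomposition (G : multigraph) m (D : seq {set vertex G}) :
  leaf_list m D -> (forall v, v \in covered D) ->
  (forall e : edge G, exists2 B, B \in D & (tail_end e \in B) && (head_end e \in B)) ->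
  exists TD : tree_decomposition G, width TD <= m - 1 /\
    forall B, B \in D -> exists x : node TD, bag x = B.
Proof.
move=> ok cv ce; have [T [e [bg [te ve bD Db]]]] := leaf_list_tree ok.
have be x : exists y : T, (tail_end x \in bg y) && (head_end x \in bg y).
  by have [B /Db[y <-] h] := ce x; exists y.
exists (TreeDecomposition te (fun v => ve v (cv v)) be); split=> //.
rewrite /width leq_sub2r //; apply/bigmax_leqP => x _ /=.
exact: leaf_list_card ok (bD x).
Qed.

Lemma lt_pred i n : i < n -> i != n.-1 -> i < n.-1.
Proof. by lia. Qed.

(** * Boundary cycles of the faces *)

Section CombinatorialDual.
Variables (G : multigraph) (Phi : finType) (lf rf : edge G -> Phi).
Hypothesis G_loopless : loopless G.
Hypothesis G_2connected : two_connected G.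
Local Notation Gd := (dual lf rf).
Local Notation dlinked := (@linked Gd).
Local Notation dat := (@at_vertex Gd).
Local Notation djoins := (@joins Gd).
Hypothesis dual_conn : forall f g : Phi, connect (dlinked predT) f g.
Hypothesis duality : forall (S : pred (edge G)) e, ~~ S e ->
  connect (linked S) (tail_end e) (head_end e) =
  ~~ connect (dlinked (fun x => ~~ S x && (x != e))) (lf e) (rf e).
Implicit Types (S : pred (edge G)) (e x : edge G) (u v w : vertex G) (f g h : Phi).

Lemma joins_neq e u v : joins e u v -> u != v.
Proof.
move=> /orP[] /andP[/eqP <- /eqP <-]; first exact: G_loopless.
by rewrite eq_sym; exact: G_loopless.
Qed.

Lemma dualityE S e u v f g : ~~ S e -> joins e u v -> djoins e f g ->
  connect (linked S) u v = ~~ connect (dlinked (fun x => ~~ S x && (x != e))) f g.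
Proof.
move=> Se; rewrite {1}/joins {1}/joins /= => ju jf.
have := duality Se.
case/orP: ju => /andP[/eqP <- /eqP <-]; case/orP: jf => /andP[/eqP <- /eqP <-] //.
- by rewrite [in RHS](@linked_connect_sym Gd).
- by rewrite [in LHS]linked_connect_sym => ->.
- by rewrite [in LHS]linked_connect_sym [in RHS](@linked_connect_sym Gd) => ->.
Qed.

Lemma connect_off v u w : u != v -> w != v ->
  connect (linked (fun x => ~~ at_vertex v x)) u w.
Proof.
case: G_2connected => _ _ /(_ v)[_ cv] uv wv.
have {cv} := cv u w; rewrite !inE => /(_ uv wv).
apply: connect_sub => x y /=; rewrite !inE => /and3P[xv yv /existsP[e j]].
apply: (@linked_joins _ _ e) => //.
apply/negP => /(joins_cases (j : joins e x y))[]vE; first by rewrite vE eqxx in xv.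
by rewrite vE eqxx in yv.
Qed.

Lemma incident_exists v : exists e, at_vertex v e.
Proof.
case: G_2connected => [[_ cG] /card_gt2P[a [b [c [_ [ab bc ca]]]]] _].
have [w wv] : exists w, v != w.
  by have [va|va] := eqVneq v a; [exists b; rewrite va|exists a].
have := cG v w; rewrite !inE => /(_ isT isT) /connectP[[|y p] /= pp wE].
  by rewrite wE eqxx in wv.
move: pp => /andP[]; rewrite !inE /= => /existsP[e j] _.
by exists e; have [] := joins_at (j : joins e v y).
Qed.

Lemma bridgeless_joins e u v : joins e u v -> connect (linked (predC1 e)) u v.
Proof.
move=> j; have uv := joins_neq j.
case: G_2connected => _ /card_gt2P[a [b [c [_ [ab bc ca]]]]] _.
have [w [wu wv]] : exists w, w != u /\ w != v.
  have [->|ua] := eqVneq u a.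
    have [->|vb] := eqVneq v b; first by exists c; rewrite ca eq_sym bc.
    by exists b; rewrite eq_sym ab eq_sym vb.
  have [->|va] := eqVneq v a.
    have [->|vb] := eqVneq u b; first by exists c; rewrite ca eq_sym bc.
    by exists b; rewrite [b == u]eq_sym vb eq_sym ab.
  by exists a; rewrite eq_sym ua eq_sym va.
have [au av] := joins_at j.
apply: (@connect_trans _ _ w).
  apply: linked_sub (connect_off uv wv) => x /=.
  by apply: contraNneq => ->.
apply: linked_sub (connect_off wu _); last by rewrite eq_sym.
by move=> x /=; apply: contraNneq => ->.
Qed.

Lemma dneq e : lf e != rf e.
Proof.
apply/negP => /eqP lr; have := @duality (predC1 e) e.
rewrite /= eqxx /= => /(_ isT); rewrite lr connect0.
by rewrite (bridgeless_joins (joins_ends e)).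
Qed.

Lemma djoins_neq e f g : djoins e f g -> f != g.
Proof.
move=> /orP[] /andP[/eqP <- /eqP <-]; first exact: dneq.
by rewrite eq_sym; exact: dneq.
Qed.

Lemma isolated_off v u S : (forall x, S x -> ~~ at_vertex v x) -> u != v ->
  ~~ connect (linked S) v u.
Proof.
move=> Sv uv; apply/negP => /first_edge; rewrite eq_sym => /(_ uv)[c [w [Sc j _ _]]].
by have [a _] := joins_at j; have := Sv c Sc; rewrite a.
Qed.

Lemma disolated_off f g S : (forall x, S x -> ~~ dat f x) -> g != f ->
  ~~ connect (dlinked S) f g.
Proof.
move=> Sv uv; apply/negP => /first_edge; rewrite eq_sym => /(_ uv)[c [w [Sc j _ _]]].
by have [a _] := joins_at j; have := Sv c Sc; rewrite a.
Qed.

(* The faces around a vertex form a cycle whose edges are the edges at the vertex. *)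
Lemma link_bridgeless v e f g : at_vertex v e -> djoins e f g ->
  connect (dlinked (fun x => at_vertex v x && (x != e))) f g.
Proof.
move=> ve jf; have [u ju] := at_joins ve.
have Se : ~~ (fun x => ~~ at_vertex v x) e by rewrite negbK.
have := dualityE (S := fun x => ~~ at_vertex v x) Se ju jf.
rewrite (negbTE (isolated_off _ _)) //; last by rewrite eq_sym; exact: joins_neq ju.
move=> /esym/negbFE; apply: linked_sub => x.
by rewrite negbK.
Qed.

Lemma link_cut v e1 e2 f g : at_vertex v e1 -> at_vertex v e2 -> e1 != e2 -> djoins e1 f g ->
  ~~ connect (dlinked (fun x => [&& at_vertex v x, x != e1 & x != e2])) f g.
Proof.
move=> v1 v2 e12 jf; have [u1 j1] := at_joins v1; have [u2 j2] := at_joins v2.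
have Se : ~~ (fun x => ~~ at_vertex v x || (x == e2)) e1.
  by rewrite negb_or negbK v1.
have := dualityE (S := fun x => ~~ at_vertex v x || (x == e2)) Se j1 jf.
have -> : connect (linked (fun x => ~~ at_vertex v x || (x == e2))) v u1.
  apply: (@connect_trans _ _ u2).
    by apply: (@linked_joins _ _ e2); rewrite ?eqxx ?orbT.
  have n1 := joins_neq j1; have n2 := joins_neq j2.
  apply: linked_sub (connect_off (v := v) _ _); rewrite 1?eq_sym // => x.
  by move=> ->.
move=> /esym; apply: contra; apply: linked_sub => x /and3P[vx x1 x2].
by rewrite negb_or negbK vx x1 x2.
Qed.

Lemma link_connected v e e' f f' : at_vertex v e -> at_vertex v e' -> dat f e -> dat f' e' ->
  connect (dlinked (at_vertex v)) f f'.
Proof.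
move=> ve ve' fe fe'.
have [h jh] := at_joins fe; have [u ju] := at_joins ve; have [u' ju'] := at_joins ve'.
pose D1 x := at_vertex v x && [exists g, dat g x && connect (dlinked (at_vertex v)) f g].
have [D1e'|D1e'] := boolP (D1 e').
  case/andP: D1e' => _ /existsP[g /andP[ge' cg]].
  apply: (connect_trans cg); have [g' jg] := at_joins ge'.
  by case: (joins_cases jg fe') => ->; [exact: connect0|exact: linked_joins jg].
exfalso.
have cD1 : connect (dlinked (fun x => ~~ ~~ D1 x && (x != e))) f h.
  pose P (g : Phi) := connect (dlinked (at_vertex v)) f g /\
    connect (dlinked (fun x => ~~ ~~ D1 x && (x != e))) f g.
  suff [] : P h by [].
  apply: (@linked_ind Gd _ P f h _ (link_bridgeless ve jh)); last by split; exact: connect0.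
  move=> x a b /andP[vx xe] j [ca cDa]; split.
    by apply: connect_trans ca _; exact: linked_joins j.
  apply: connect_trans cDa _; apply: (linked_joins _ j).
  rewrite negbK xe /D1 vx andbT; apply/existsP; exists a.
  by have [-> _] := joins_at j.
have nD1e : ~~ (fun x => ~~ D1 x) e.
  by rewrite negbK /D1 ve; apply/existsP; exists f; rewrite fe connect0.
have := dualityE (S := fun x => ~~ D1 x) nD1e ju jh; rewrite cD1 /= => /negP; apply.
apply: (@connect_trans _ _ u'); first by apply: (@linked_joins _ _ e').
have n1 := joins_neq ju; have n2 := joins_neq ju'.
apply: linked_sub (connect_off (v := v) _ _); rewrite 1?eq_sym // => x.
by apply: contra => /andP[].
Qed.

Lemma face_degree_ge2 v e f : at_vertex v e -> dat f e ->
  exists2 e', e' != e & at_vertex v e' && dat f e'.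
Proof.
move=> ve fe; have [h jh] := at_joins fe.
have [c [w [/andP[vc ce] j _ _]]] := first_edge (link_bridgeless ve jh) (djoins_neq jh).
by exists c => //; rewrite vc; have [-> _] := joins_at j.
Qed.

Lemma face_degree_le2 v f e1 e2 e3 : at_vertex v e1 -> at_vertex v e2 -> at_vertex v e3 ->
  dat f e1 -> dat f e2 -> dat f e3 -> e1 != e2 -> e1 != e3 -> e2 == e3.
Proof.
move=> v1 v2 v3 f1 f2 f3 e12 e13; apply/negPn/negP => e23.
have [h jh] := at_joins f1.
have [c [w [/andP[vc ce] j _ cw]]] := first_edge (link_bridgeless v1 jh) (djoins_neq jh).
have cut e : at_vertex v e -> dat f e -> e1 != e -> c != e -> False.
  move=> vE fE e1e ce'; have /negP := link_cut v1 vE e1e jh; apply.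
  apply: (@connect_trans _ _ w); first by apply: (linked_joins _ j); rewrite vc ce ce'.
  apply: linked_sub cw => x /andP[/andP[-> ->]] /=.
  by apply: contraNneq => ->.
have [c2|c2] := eqVneq c e2; last exact: (cut e2).
by apply: (cut e3) => //; rewrite c2.
Qed.

Lemma boundary_bridgeless f e u v : dat f e -> joins e u v ->
  connect (linked (fun x => dat f x && (x != e))) u v.
Proof.
move=> fe ju; have [h jh] := at_joins fe.
have Se : ~~ (fun x => dat f x && (x != e)) e by rewrite eqxx andbF.
rewrite (dualityE (S := fun x => dat f x && (x != e)) Se ju jh); apply: disolated_off; last first.
  by rewrite eq_sym; exact: djoins_neq jh.
by move=> x /andP[/nandP[//|]]; rewrite negbK => /eqP ->; rewrite eqxx.
Qed.

Lemma link_minus_face v f e1 e2 h1 h2 : at_vertex v e1 -> at_vertex v e2 ->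
  dat h1 e1 -> dat h2 e2 -> h1 != f -> h2 != f ->
  connect (dlinked (fun x => at_vertex v x && ~~ dat f x)) h1 h2.
Proof.
move=> v1 v2 d1 d2 n1 n2.
have [/existsP[e /andP[ve fe]]|/existsPn nf] := boolP [exists x, at_vertex v x && dat f x]; last first.
  apply: linked_sub (link_connected v1 v2 d1 d2) => x vx; rewrite vx /=.
  by have := nf x; rewrite vx.
pose S x := at_vertex v x && ~~ dat f x.
have key h e' : at_vertex v e' -> dat h e' -> h != f -> exists c (w : Phi), [/\ at_vertex v c, dat f c,
    djoins c f w & connect (dlinked S) w h].
  move=> ve' he' hf; have [|c [w [vc j _ cw]]] := first_edge (link_connected ve ve' fe he').
    by rewrite eq_sym.
  by exists c, w; split => //; have [] := joins_at j.
have [c1 [w1 [vc1 fc1 j1 cw1]]] := key h1 e1 v1 d1 n1.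
have [c2 [w2 [vc2 fc2 j2 cw2]]] := key h2 e2 v2 d2 n2.
suff w12 : connect (dlinked S) w1 w2.
  apply: connect_trans cw2; apply: connect_trans w12.
  by rewrite (@linked_connect_sym Gd).
have [c12|c12] := eqVneq c1 c2; first by rewrite -c12 in j2; rewrite (joins_eq j1 j2).
have [c [w [/andP[vc cc1] j _ cw]]] := first_edge (link_bridgeless vc1 j1) (djoins_neq j1).
have fc : dat f c by have [] := joins_at j.
rewrite eq_sym in cc1.
have c2E := eqP (face_degree_le2 vc1 vc2 vc fc1 fc2 fc c12 cc1).
rewrite -c2E in j; rewrite (joins_eq j2 j) (@linked_connect_sym Gd).
by apply: linked_sub cw => x /andP[/andP[vx _] fx]; rewrite /S vx.
Qed.

Definition face_verts f : {set vertex G} :=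
  [set v : vertex G | [exists e : edge G, @at_vertex G v e && dat f e]].

Lemma face_vertsP f v : reflect (exists2 e, at_vertex v e & dat f e) (v \in face_verts f).
Proof.
rewrite inE; apply: (iffP existsP) => [[e /andP[]]|[e ve fe]]; first by exists e.
by exists e; rewrite ve.
Qed.

(* A component D of the boundary of f other than that of v would separate f from the faces
   outside D, and these could not touch v. *)
Lemma boundary_connected f u v : u \in face_verts f -> v \in face_verts f ->
  connect (@linked G (dat f)) u v.
Proof.
move=> /face_vertsP[eu ueu feu] /face_vertsP[ev vev fev]; apply/negPn/negP => nuv.
pose C w := connect (@linked G (dat f)) u w.
pose D x := dat f x && C (tail_end x).
have DP x w : dat f x -> at_vertex w x -> D x = C w.
  move=> fx wx; rewrite /D fx /=; case/orP: wx => /eqP <- //.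
  apply/idP/idP => h; apply: connect_trans h _; apply: (linked_joins fx (u := _)).
    exact: joins_ends.
  by rewrite joinsC joins_ends.
pose K h := connect (dlinked (fun x => ~~ D x)) f h.
have Kother x h : D x -> djoins x f h -> ~~ K h.
  move=> Dx jx; have /andP[fx Cx] := Dx.
  have Sx : ~~ (fun y => D y && (y != x)) x by rewrite eqxx andbF.
  have := dualityE (S := fun y => D y && (y != x)) Sx (joins_ends x) jx.
  have -> : connect (linked (fun y => D y && (y != x))) (tail_end x) (head_end x).
    pose P w := C w /\ connect (linked (fun y => D y && (y != x))) (tail_end x) w.
    suff [] : P (head_end x) by [].
    apply: (linked_ind _ (boundary_bridgeless fx (joins_ends x))); last by split.
    move=> y a b /andP[fy yx] j [Ca ca]; split; first exact: connect_trans Ca (linked_joins fy j).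
    apply: connect_trans ca _; apply: (linked_joins _ j); rewrite yx andbT.
    by have [ya _] := joins_at j; rewrite (DP y a).
  move=> /esym; apply: contra; apply: linked_sub => y Dy; rewrite negb_and Dy /=.
  by apply: contraNneq Dy => ->.
have K_at w x h : C w -> at_vertex w x -> ~~ D x -> dat h x -> ~~ K h.
  move=> Cw wx Dx hx.
  have nfx : ~~ dat f x by apply: contra Dx => fx; rewrite (DP x w).
  have [y fy wy] : exists2 y, dat f y & at_vertex w y.
    have [uw|uw] := eqVneq u w; first by exists eu; rewrite -?uw.
    have : connect (@linked G (dat f)) w u by rewrite linked_connect_sym.
    rewrite eq_sym in uw; move=> /first_edge/(_ uw)[c [z [fc j _ _]]].
    by exists c => //; have [] := joins_at j.
  have [h' jh'] := at_joins fy.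
  have Dy : D y by rewrite (DP y w).
  have hf : h != f by apply: contraNneq nfx => <-.
  have h'f : h' != f by rewrite eq_sym; exact: djoins_neq jh'.
  apply: contra (Kother y h' Dy jh') => Kh; apply: connect_trans Kh _.
  have [_ h'y] := joins_at jh'.
  apply: linked_sub (link_minus_face wx wy hx h'y hf h'f) => z /andP[_].
  by apply: contra => /andP[].
have Cv : ~~ C v by [].
have Q : forall w, connect (linked predT) v w -> ~~ C w /\ forall x h, at_vertex w x -> dat h x -> K h.
  have nC w x y h h' : ~~ C w -> at_vertex w x -> at_vertex w y -> dat h x -> dat h' y ->
      K h -> K h'.
    move=> nCw wx wy hx h'y Kh; apply: connect_trans Kh _.
    apply: linked_sub (link_connected wx wy hx h'y) => z wz.
    by apply/negP => Dz; have /andP[fz _] := Dz; rewrite -(DP z w) ?Dz in nCw.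
  move=> w cw.
  pose P w := ~~ C w /\ forall x h, at_vertex w x -> dat h x -> K h.
  apply: (@linked_ind G _ P v w _ cw).
    move=> y a b _ j [nCa Ka]; have [ya yb] := joins_at j.
    have [l fl] : exists l, dat l y by exists (lf y); rewrite /at_vertex eqxx.
    have Dy : ~~ D y.
      by apply/negP => Dy; have /andP[fy _] := Dy; rewrite -(DP y a) ?Dy in nCa.
    have nCb : ~~ C b.
      by apply/negP => Cb; have := K_at b y l Cb yb Dy fl; rewrite (Ka y l).
    by split=> // x h bx hx; apply: (nC b y x l h) => //; exact: Ka ya fl.
  split=> // x h vx hx; apply: (nC v ev x f h) => //; exact: connect0.
have [|+ _] := Q u; last by rewrite /C connect0.
case: G_2connected => [[_ cG] _ _].
have := cG v u; rewrite !inE => /(_ isT isT); apply: connect_sub => x y /=.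
rewrite !inE /= => /existsP[e j]; apply: (@linked_joins _ _ e) => //.
Qed.

(* A closed enumeration of the boundary cycle of f. *)
Record frame f (n : nat) (x : nat -> vertex G) (g : nat -> edge G) : Prop := Frame {
  frame_gt1 : 1 < n;
  frame_joins : forall i, i < n -> joins (g i) (x i) (x i.+1);
  frame_close : x n = x 0;
  frame_injx : forall i j, i < n -> j < n -> x i = x j -> i = j;
  frame_injg : forall i j, i < n -> j < n -> g i = g j -> i = j;
  frame_side : forall i, i < n -> dat f (g i);
  frame_vert : forall v, v \in face_verts f -> exists2 i, i < n & x i = v;
  frame_edge : forall e, dat f e -> exists2 i, i < n & g i = e }.

Lemma closing_frame f n (x : nat -> vertex G) (g : nat -> edge G) :
  1 < n -> (forall i, i < n -> joins (g i) (x i) (x i.+1)) -> x n = x 0 ->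
  (forall i j, i < n -> j < n -> x i = x j -> i = j) ->
  (forall i j, i < n -> j < n -> g i = g j -> i = j) ->
  (forall i, i < n -> dat f (g i)) -> frame f n x g.
Proof.
move=> n1 jn cl ix ig sd.
have at_x i c : i < n -> at_vertex (x i) c -> dat f c -> exists2 j, j < n & g j = c.
  move=> ni xc fc.
  pose k := if i is i'.+1 then i' else n.-1.
  have kn : k < n by rewrite /k; case: (i) ni => //; lia.
  have ki : k != i by rewrite /k; case: (i); lia.
  have xk : at_vertex (x i) (g k).
    have [_ +] := joins_at (jn k kn); congr at_vertex.
    by rewrite /k; case: (i) => //; rewrite prednK ?cl //; lia.
  have [xi _] := joins_at (jn i ni).
  have [<-|ci] := eqVneq (g i) c; first by exists i.
  exists k => //; apply/eqP.
  apply: (face_degree_le2 xi xk xc (sd i ni) (sd k kn) fc) => //.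
  by apply: contra ki => /eqP/(ig _ _ ni kn) ->.
have x0v : x 0 \in face_verts f.
  have n0 : 0 < n by lia.
  by apply/face_vertsP; exists (g 0); [have [] := joins_at (jn 0 n0)|exact: sd].
have vert v : v \in face_verts f -> exists2 i, i < n & x i = v.
  move=> fv; pose P v := exists2 i, i < n & x i = v.
  apply: (@linked_ind G (dat f) P (x 0) v _ (boundary_connected x0v fv)); last by exists 0 => //; lia.
  move=> c a b fc j [i ni xi]; have [ac _] := joins_at j.
  rewrite -xi in ac; have [k kn gk] := at_x i c ni ac fc.
  have xn m : m <= n -> P (x m).
    rewrite leq_eqVlt => /orP[/eqP ->|mn]; last by exists m.
    by exists 0; [lia|rewrite cl].
  have [_ bc] := joins_at j; rewrite -gk in bc.
  by case: (joins_cases (jn k kn) bc) => ->; apply: xn => //; exact: ltnW.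
apply: Frame => // c fc.
have cv : tail_end c \in face_verts f.
  by apply/face_vertsP; exists c => //; rewrite /at_vertex eqxx.
have [i ni xi] := vert _ cv.
by apply: (at_x i c ni) => //; rewrite xi /at_vertex eqxx.
Qed.

Lemma frame_exists f e : dat f e -> exists n (x : nat -> vertex G) (g : nat -> edge G), frame f n x g /\ g n.-1 = e.
Proof.
move=> fe; set a := tail_end e; set b := head_end e.
have je : joins e a b := joins_ends e.
have := boundary_bridgeless fe je; rewrite linked_connect_sym.
case/connectP=> p0 /shortenP[p pp up _] aE.
pose s := b :: p; pose n := size s; pose x i := nth b s i.
have xa : x n.-1 = a by rewrite /x /n nth_last /= aE.
have n1 : 1 < n.
  rewrite /n /=; case: (p) aE => //= aE.
  by have := joins_neq je; rewrite aE eqxx.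
pose Q i (c : edge G) := [&& dat f c, c != e & joins c (x i) (x i.+1)].
pose g i := if i == n.-1 then e else odflt e [pick c | Q i c].
have gQ i : i < n.-1 -> Q i (g i).
  move=> ni; rewrite /g; have -> : (i == n.-1) = false by lia.
  case: pickP => //= nQ.
  have /(pathP b) := pp => /(_ i ni)/linkedP[c /andP[fc ce] j].
  by have := nQ c; rewrite /Q fc ce j.
have glast : g n.-1 = e by rewrite /g eqxx.
have jn i : i < n -> joins (g i) (x i) (x i.+1).
  move=> ni; have [i1|i1] := ltnP i n.-1; first by have /and3P[] := gQ i i1.
  have iE : i = n.-1 by lia.
  by rewrite iE glast xa prednK ?(ltnW n1) // /x nth_default.
have ix i j : i < n -> j < n -> x i = x j -> i = j.
  by move=> ni nj /eqP; rewrite /x nth_uniq // => /eqP.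
have fg i : i < n -> dat f (g i).
  move=> ni; have [i1|i1] := ltnP i n.-1; first by have /and3P[] := gQ i i1.
  by have -> : i = n.-1 by [lia]; rewrite glast.
exists n, x, g; split=> //; apply: closing_frame => //; first by rewrite /x nth_default.
suff lt i j : i < j -> j < n -> g i != g j.
  move=> i j ni nj gE; case: (ltngtP i j) => // ij.
    by have := lt i j ij nj; rewrite gE eqxx.
  by have := lt j i ij ni; rewrite gE eqxx.
move=> ij nj; apply/eqP => gE.
have [j1|j1] := ltnP j n.-1; last first.
  have jE : j = n.-1 by lia.
  have i1 : i < n.-1 by lia.
  by have /and3P[_ + _] := gQ i i1; rewrite gE jE glast eqxx.
have i1 : i < n.-1 by lia.
have [xi _] := joins_at (jn i (ltn_trans ij nj)).
rewrite gE in xi; case: (joins_cases (jn j nj) xi) => /ix.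
  by move=> /(_ (ltn_trans ij nj) nj); lia.
have j2 : j.+1 < n by lia.
by move=> /(_ (ltn_trans ij nj) j2); lia.
Qed.

Lemma frame_card f n (x : nat -> vertex G) (g : nat -> edge G) : frame f n x g -> n = #|face_verts f|.
Proof.
move=> F; have -> : face_verts f = [set x (i : 'I_n) | i : 'I_n].
  apply/setP => v; apply/idP/imsetP => [/(frame_vert F)[i ni <-]|[i _ ->]].
    by exists (Ordinal ni).
  apply/face_vertsP; exists (g i); last exact: frame_side F _ _.
  by have [] := joins_at (frame_joins F (ltn_ord i)).
rewrite card_imset ?card_ord // => i j /(frame_injx F (ltn_ord i) (ltn_ord j)).
exact: val_inj.
Qed.

Lemma frame_rot f n (x : nat -> vertex G) (g : nat -> edge G) r : frame f n x g -> r < n ->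
  frame f n (fun i => x ((i + r) %% n)) (fun i => g ((i + r) %% n)).
Proof.
move=> F rn; have n0 : 0 < n by lia.
have inj i j : i < n -> j < n -> (i + r) %% n = (j + r) %% n -> i = j.
  move=> ni nj /eqP; rewrite eqn_modDr => /eqP; by rewrite !modn_small.
apply: closing_frame.
- exact: frame_gt1 F.
- move=> i ni; have m := ltn_pmod (i + r) n0.
  have := frame_joins F m; congr joins.
  have [l|l] := ltnP ((i + r) %% n).+1 n.
    by congr x; rewrite addSn -[in RHS]addn1 -[in RHS]modnDml addn1 (modn_small l).
  have e : ((i + r) %% n).+1 = n by lia.
  rewrite e (frame_close F); congr x.
  by rewrite addSn -[in RHS]addn1 -[in RHS]modnDml addn1 e modnn.
- by rewrite /= modnDl.
- move=> i j ni nj /(frame_injx F (ltn_pmod _ n0) (ltn_pmod _ n0)); exact: inj.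
- move=> i j ni nj /(frame_injg F (ltn_pmod _ n0) (ltn_pmod _ n0)); exact: inj.
- by move=> i ni; apply: (frame_side F); exact: ltn_pmod.
Qed.

Implicit Types (c : edge G) (y z : vertex G).

(** * The forest rooted at the outer boundary and its cotree *)

Variables (R0 : Phi) (par : vertex G -> vertex G) (pe : vertex G -> edge G)
  (rk : vertex G -> nat).
Local Notation VR := (face_verts R0).
Hypothesis par_root : forall v, v \in VR -> par v = v.
Hypothesis pe_joins : forall v, v \notin VR -> joins (pe v) v (par v).
Hypothesis rk_par : forall v, v \notin VR -> rk (par v) < rk v.

(* The path from v to its root in the forest formed by the edges [pe v]. *)
Definition up v : {set vertex G} := [set y | fconnect par v y].

Lemma forest_ind (Q : vertex G -> Prop) :
  (forall v, (v \notin VR -> Q (par v)) -> Q v) -> forall v, Q v.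
Proof.
move=> st v; elim: {v}(rk v) {-2}v (leqnn (rk v)) => [|n IH] v vn; apply: st => vR.
  by have := rk_par vR; rewrite (leqn0 _) in vn *; lia.
by apply: IH; have := rk_par vR; lia.
Qed.

Lemma up_refl v : v \in up v.
Proof. by rewrite inE connect0. Qed.

Lemma up_trans y v z : y \in up v -> z \in up y -> z \in up v.
Proof. by rewrite !inE; exact: connect_trans. Qed.

Lemma up_par v : par v \in up v.
Proof. by rewrite inE fconnect1. Qed.

Lemma up_root v : v \in VR -> up v = [set v].
Proof.
move=> vR; apply/setP => y; rewrite !inE; apply/idP/eqP => [|->]; last exact: connect0.
move=> /connectP[p pp ->]; elim: p pp => //= z p IH /andP[/eqP].
by rewrite par_root // => <- /IH.
Qed.

Lemma up_step v : v \notin VR -> up v = v |: up (par v).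
Proof.
move=> vR; apply/setP => y; rewrite !inE; apply/idP/orP => [|[/eqP ->|]]; last first.
- by apply: connect_trans; exact: fconnect1.
- exact: connect0.
move=> /connectP[[|z p] /= pp yE]; first by left; rewrite yE.
right; move: pp => /andP[/eqP zE pp]; rewrite zE.
by apply/connectP; exists p => //; rewrite zE.
Qed.

Lemma up_rk y v : y \in up v -> rk y <= rk v.
Proof.
elim/forest_ind: v => v IH; have [vR|vR] := boolP (v \in VR).
  by rewrite up_root // inE => /eqP ->.
rewrite up_step // in_setU1 => /orP[/eqP ->//|/(IH vR)].
by have := rk_par vR; lia.
Qed.

Lemma up_par_notin z : z \notin VR -> z \notin up (par z).
Proof. by move=> zR; apply/negP => /up_rk; have := rk_par zR; lia. Qed.

Definition base v := odflt v [pick r | (r \in VR) && (r \in up v)].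

Lemma base_uniq v r r' : r \in VR -> r' \in VR -> r \in up v -> r' \in up v -> r = r'.
Proof.
move=> rR rR'; elim/forest_ind: v => v IH; have [vR|vR] := boolP (v \in VR).
  by rewrite up_root // !inE => /eqP -> /eqP ->.
rewrite up_step // !in_setU1 => /orP[/eqP rv|r1]; first by rewrite -rv rR in vR.
move=> /orP[/eqP rv|r2]; first by rewrite -rv rR' in vR.
exact: IH.
Qed.

Lemma baseP v : (base v \in VR) /\ (base v \in up v).
Proof.
rewrite /base; case: pickP => [r /andP[]//|nr]; exfalso.
elim/forest_ind: v nr => v IH nr; have [vR|vR] := boolP (v \in VR).
  by have := nr v; rewrite vR up_refl.
by apply: (IH vR) => r; have := nr r; rewrite (up_step vR) in_setU1; case: (r \in VR); case: eqP.
Qed.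

Lemma baseE v r : r \in VR -> r \in up v -> r = base v.
Proof. by move=> rR rv; have [a b] := baseP v; exact: base_uniq rv b. Qed.

Lemma base_id v : v \in VR -> base v = v.
Proof. by move=> vR; apply/esym/baseE => //; exact: up_refl. Qed.

Lemma base_par v : base (par v) = base v.
Proof.
have [a b] := baseP (par v); apply: baseE => //.
exact: up_trans (up_par v) b.
Qed.

Lemma up_VR v : up v :&: VR = [set base v].
Proof.
apply/setP => r; rewrite in_setI in_set1; apply/andP/eqP => [[rv rR]|->].
  exact: baseE.
by have [a b] := baseP v.
Qed.

Definition tree e := [exists v, (v \notin VR) && (pe v == e)].

Lemma treeP e : reflect (exists2 v, v \notin VR & pe v = e) (tree e).
Proof.
apply: (iffP existsP) => [[v /andP[vR /eqP <-]]|[v vR <-]]; first by exists v.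
by exists v; rewrite vR eqxx.
Qed.

Lemma dat_VR e v : dat R0 e -> at_vertex v e -> v \in VR.
Proof. by move=> Re ve; apply/face_vertsP; exists e. Qed.

Lemma pe_off v : v \notin VR -> ~~ dat R0 (pe v).
Proof.
move=> vR; have [vp _] := joins_at (pe_joins vR).
by apply: contra vR => /dat_VR; apply.
Qed.

Lemma pe_inj v w : v \notin VR -> w \notin VR -> pe v = pe w -> v = w.
Proof.
move=> vR wR e; have jv := pe_joins vR; have jw := pe_joins wR.
rewrite -e in jw; have [vw _] := joins_at jv; have [wv _] := joins_at jw.
case: (joins_cases jw vw) => // vE; case: (joins_cases jv wv) => // wE.
by have := rk_par vR; have := rk_par wR; rewrite -vE -wE; lia.
Qed.

Lemma up_edge y e u v : tree e -> (y \in VR) || (e != pe y) -> joins e u v ->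
  (y \in up u) = (y \in up v).
Proof.
move=> /treeP[w wR <-] ye j.
have yw : y != w by apply: contraTneq ye => ->; rewrite negb_or wR eqxx.
have key : (y \in up w) = (y \in up (par w)) by rewrite up_step // in_setU1 (negbTE yw).
have [uw vw] := joins_at j; have jw := pe_joins wR.
case: (joins_cases jw uw) => uE; rewrite uE in j *; first by rewrite (joins_eq j jw).
by rewrite joinsC in jw; rewrite (joins_eq j jw).
Qed.

Lemma up_outer y e u : dat R0 e -> at_vertex u e -> y \notin VR -> y \notin up u.
Proof.
move=> Re ue; apply: contra; have uR := dat_VR Re ue.
by rewrite up_root // inE => /eqP ->.
Qed.

Lemma to_ancestor y v : y \in up v ->
  connect (linked (fun e => tree e && ((y \in VR) || (e != pe y)))) v y.
Proof.
elim/forest_ind: v => v IH; have [->|yv] := eqVneq y v; first by move=> _; exact: connect0.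
have [vR|vR] := boolP (v \in VR).
  by rewrite up_root // inE (negbTE yv).
rewrite up_step // in_setU1 (negbTE yv) /= => yp.
apply: connect_trans (IH vR yp); apply: (linked_joins _ (pe_joins vR)).
apply/andP; split; first by apply/treeP; exists v.
have [//|yR] := boolP (y \in VR); apply/eqP => /(pe_inj vR yR) vy.
by rewrite vy eqxx in yv.
Qed.

Lemma to_root v : connect (linked tree) v (base v).
Proof.
have [_ b] := baseP v; apply: linked_sub (to_ancestor b) => e.
by case/andP.
Qed.

Lemma to_root_avoiding z v : z \notin VR -> z \notin up v ->
  connect (linked (fun e => tree e && (e != pe z))) v (base v).
Proof.
move=> zR; elim/forest_ind: v => v IH zv; have [vR|vR] := boolP (v \in VR).
  by rewrite base_id.
move: zv; rewrite up_step // in_setU1 negb_or => /andP[zv /(IH vR)].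
rewrite base_par; apply: connect_trans; apply: (linked_joins _ (pe_joins vR)).
apply/andP; split; first by apply/treeP; exists v.
by apply/eqP => /(pe_inj vR zR) vz; rewrite vz eqxx in zv.
Qed.

(* These edges form a spanning tree of the dual without R0: see [ntree_connected] and
   [ntree_bridge]. *)
Definition ntree e := ~~ tree e && ~~ dat R0 e.

Lemma frame_segment f n (x : nat -> vertex G) (g : nat -> edge G) S i j :
  frame f n x g -> i <= j <= n ->
  (forall k, i <= k < j -> S (g k)) -> connect (linked S) (x i) (x j).
Proof.
move=> F /andP[]; elim: j => [|j IH] ij jn Sg.
  by have -> : i = 0 by [lia]; exact: connect0.
move: ij; rewrite leq_eqVlt => /orP[/eqP ->|ij]; first exact: connect0.
apply: (@connect_trans _ _ (x j)).
  by apply: IH; [lia|lia|move=> k kj; apply: Sg; lia].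
by apply: (linked_joins (Sg j _) (frame_joins F _)); lia.
Qed.

Lemma outer_minus1 e u v : dat R0 e -> u \in VR -> v \in VR ->
  connect (linked (fun c => dat R0 c && (c != e))) u v.
Proof.
move=> Re.
have [n [x [g [F ge]]]] := frame_exists Re.
have n1 := frame_gt1 F.
have key i : i < n -> connect (linked (fun c => dat R0 c && (c != e))) (x 0) (x i).
  move=> ni; apply: (frame_segment F) => [|k ki]; first by lia.
  rewrite (frame_side F) /=; last by lia.
  by apply/eqP; rewrite -ge => /(frame_injg F _ _) h; have : k = n.-1 by [apply: h; lia]; lia.
move=> /(frame_vert F)[i ni <-] /(frame_vert F)[j nj <-].
by apply: connect_trans (key j nj); rewrite linked_connect_sym; exact: key.
Qed.

Lemma outer_minus2 y e1 e2 u v : dat R0 e1 -> dat R0 e2 -> e1 != e2 ->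
  at_vertex y e1 -> at_vertex y e2 -> u \in VR -> v \in VR -> u != y -> v != y ->
  connect (linked (fun c => [&& dat R0 c, c != e1 & c != e2])) u v.
Proof.
move=> R1 R2 e12 y1 y2.
have [n [x [g [F ge]]]] := frame_exists R1.
have n1 := frame_gt1 F.
have [k kn gk] := frame_edge F R2.
have kl : k < n.-1.
  by apply: lt_pred => //; apply: contra e12 => /eqP kE; rewrite -ge -gk kE.
have jk := frame_joins F kn; rewrite gk in jk.
have jl : joins e1 (x n.-1) (x 0).
  rewrite -ge -(frame_close F); have := frame_joins F (_ : n.-1 < n).
  by rewrite prednK; [apply; lia|lia].
(* y is the first or the last vertex of the path obtained by deleting e1 *)
have yk : (y = x 0 /\ k = 0) \/ (y = x n.-1 /\ k.+1 = n.-1).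
  case: (joins_cases jl y1) => yE; case: (joins_cases jk y2) => yE'; rewrite yE in yE'.
  - by have := frame_injx F _ _ yE' => h; have : n.-1 = k by [apply: h; lia]; lia.
  - by right; split=> //; apply/esym; apply: (frame_injx F) yE'; lia.
  - by left; split=> //; apply/esym; apply: (frame_injx F) yE'; lia.
  - by have := frame_injx F _ _ yE' => h; have : 0 = k.+1 by [apply: h; lia]; lia.
set S := fun c => _.
have Sg i : i < n -> i != n.-1 -> i != k -> S (g i).
  move=> ni i1 i2; rewrite /S (frame_side F) //=; apply/andP; split.
    by apply: contra i1 => /eqP; rewrite -ge => /(frame_injg F ni _) -> //; lia.
  by apply: contra i2 => /eqP; rewrite -gk => /(frame_injg F ni kn) ->.
suff key i j : i <= j < n -> x i != y -> x j != y -> connect (linked S) (x i) (x j).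
  move=> /(frame_vert F)[i ni <-] /(frame_vert F)[j nj <-] iy jy.
  have [ij|ij] := leqP i j; first by apply: key => //; lia.
  by rewrite linked_connect_sym; apply: key => //; lia.
move=> ij iy jy; apply: (frame_segment F); first by lia.
move=> m mij; apply: Sg; first by lia.
  by lia.
apply/eqP => mk; case: yk => -[yE kE].
  by move: iy; rewrite yE (_ : i = 0) ?eqxx //; lia.
by move: jy; rewrite yE (_ : j = n.-1) ?eqxx //; lia.
Qed.

(* A spanning tree: the forest and the outer boundary without one edge. *)
Definition span (eR : edge G) e := tree e || (dat R0 e && (e != eR)).

Lemma span_bridge eR e f g : dat R0 eR -> span eR e -> djoins e f g ->
  connect (dlinked (fun c => ~~ span eR c)) f g.
Proof.
move=> ReR Te je; set S := fun c => span eR c && (c != e).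
have Se : ~~ S e by rewrite /S eqxx andbF.
suff nc : ~~ connect (linked S) (tail_end e) (head_end e).
  have := dualityE Se (joins_ends e) je; rewrite (negbTE nc) => /esym/negbFE.
  apply: linked_sub => c; rewrite /S negb_and negbK => /andP[/orP[//|/eqP ->]].
  by rewrite eqxx.
have inv (B : vertex G -> bool) : (forall c u v, S c -> joins c u v -> B u -> B v) ->
    B (tail_end e) != B (head_end e) -> ~~ connect (linked S) (tail_end e) (head_end e).
  move=> Bst nB; apply: contra nB => cn.
  have cn' : connect (linked S) (head_end e) (tail_end e) by rewrite linked_connect_sym.
  apply/eqP; apply/idP/idP => h.
    exact: (linked_ind (P := B) Bst cn h).
  exact: (linked_ind (P := B) Bst cn' h).
case: (boolP (tree e)) => [/treeP[z zR zE]|nte].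
  apply: (inv (fun v => z \in up v)).
    move=> c u v /andP[/orP[tc|/andP[Rc _]] ce] j zu.
      by rewrite -(up_edge (e := c) tc _ j) // zE ce orbT.
    have [cu _] := joins_at j.
    by have := up_outer Rc cu zR; rewrite zu.
  have jz := pe_joins zR; rewrite zE in jz.
  case/orP: jz => /andP[/eqP -> /eqP ->]; rewrite up_refl (negbTE (up_par_notin zR)) //.
have Re : dat R0 e by move: Te; rewrite /span (negbTE nte) /= => /andP[].
have eeR : e != eR by move: Te; rewrite /span (negbTE nte) /= => /andP[].
have [n [x [g' [F ge]]]] := frame_exists ReR.
have n1 := frame_gt1 F.
have [k kn gk] := frame_edge F Re.
have kl : k < n.-1.
  by apply: lt_pred => //; apply: contra eeR => /eqP kE; rewrite -ge -gk kE.
pose B v := [exists i : 'I_n, (i <= k) && (x i == base v)].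
have Bx i : i < n -> B (x i) = (i <= k).
  move=> ni; have xR : x i \in VR.
    by apply: (dat_VR (frame_side F ni)); have [] := joins_at (frame_joins F ni).
  rewrite /B base_id //; apply/existsP/idP => [[j /andP[jk /eqP/(frame_injx F (ltn_ord j) ni) <-//]]|ik].
  by exists (Ordinal ni); rewrite /= ik eqxx.
apply: (inv B).
  move=> c u v /andP[/orP[/treeP[w wR <-]|/andP[Rc ceR]] ce] j.
    suff -> : B u = B v by [].
    have jw := pe_joins wR; have [uw vw] := joins_at j.
    have rE : base u = base v.
      case: (joins_cases jw uw) => uE; rewrite uE in j *; first by rewrite (joins_eq j jw) base_par.
      by rewrite joinsC in jw; rewrite (joins_eq j jw) base_par.
    by rewrite /B rE.
  have [i ni gi] := frame_edge F Rc.
  have il : i < n.-1.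
    by apply: lt_pred => //; apply: contra ceR => /eqP iE; rewrite -ge -gi iE.
  have ik : i != k by apply: contra ce => /eqP iE; rewrite -gk -gi iE.
  have i1 : i.+1 < n by rewrite -ltn_predRL.
  have BE : B (x i) = B (x i.+1) by rewrite !Bx // [RHS]ltn_neqAle ik.
  have := frame_joins F ni; rewrite gi => ji; have [uc vc] := joins_at j.
  case: (joins_cases ji uc) => uE; rewrite uE in j *; first by rewrite (joins_eq j ji) BE.
  by rewrite joinsC in ji; rewrite (joins_eq j ji) BE.
have k1 : k.+1 < n by rewrite -ltn_predRL.
by have := frame_joins F kn; rewrite gk => /orP[] /andP[/eqP -> /eqP ->]; rewrite !Bx // leqnn ltnn.
Qed.

Lemma cospan_connected eR f g : dat R0 eR -> connect (dlinked (fun c => ~~ span eR c)) f g.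
Proof.
move=> ReR; have := dual_conn f g; apply: connect_sub => a b /linkedP[c _ j].
have [Tc|Tc] := boolP (span eR c); first exact: span_bridge Tc j.
exact: linked_joins j.
Qed.

Lemma remove_outer (B : pred (edge G)) eR f g : dat R0 eR -> (forall c, B c -> ~~ dat R0 c) ->
  f != R0 -> g != R0 -> connect (dlinked (fun c => B c || (c == eR))) f g ->
  connect (dlinked B) f g.
Proof.
move=> ReR BR fR gR cn; have [o jo] := at_joins ReR.
pose P h := connect (dlinked B) f (if h == R0 then o else h).
suff : P g by rewrite /P (negbTE gR).
apply: (@linked_ind Gd _ P f g _ cn); last by rewrite /P (negbTE fR) connect0.
move=> c a b /orP[Bc|/eqP ->] j; rewrite /P.
  have [ac bc] := joins_at j; have nR := BR c Bc.
  have aR : a != R0 by apply: contraNneq nR => <-.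
  have bR : b != R0 by apply: contraNneq nR => <-.
  rewrite (negbTE aR) (negbTE bR) => h; exact: connect_trans h (linked_joins Bc j).
have oR : o != R0 by rewrite eq_sym; exact: (djoins_neq jo).
have [ac bc] := joins_at j.
case: (joins_cases jo ac) => aE; rewrite aE in j *.
  by rewrite (joins_eq j jo) eqxx (negbTE oR).
by rewrite joinsC in jo; rewrite (joins_eq j jo) eqxx (negbTE oR).
Qed.

Lemma cospan_sub eR c : ~~ span eR c -> ntree c || (c == eR).
Proof.
rewrite /span /ntree negb_or => /andP[->] /=; rewrite negb_and negbK.
by case/orP => ->; rewrite ?orbT.
Qed.

Variable eR : edge G.
Hypothesis ReR : dat R0 eR.

Lemma ntree_outer c : ntree c -> ~~ dat R0 c.
Proof. by case/andP. Qed.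

Lemma ntree_connected f g : f != R0 -> g != R0 -> connect (dlinked ntree) f g.
Proof.
move=> fR gR; apply: (remove_outer ReR ntree_outer fR gR).
by apply: linked_sub (cospan_connected f g ReR) => c; exact: cospan_sub.
Qed.

Lemma ntree_bridge e f g : ntree e -> djoins e f g ->
  ~~ connect (dlinked (fun c => ntree c && (c != e))) f g.
Proof.
move=> /andP[te Re] je.
have Te : ~~ span eR e by rewrite /span (negbTE te) (negbTE Re).
have := dualityE Te (joins_ends e) je.
have -> : connect (linked (span eR)) (tail_end e) (head_end e).
  have tr v : connect (linked (span eR)) v (base v).
    by apply: linked_sub (to_root v) => c tc; rewrite /span tc.
  apply: connect_trans (tr _) _; rewrite linked_connect_sym.
  apply: connect_trans (tr _) _; have [r1 _] := baseP (head_end e).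
  have [r2 _] := baseP (tail_end e).
  by apply: linked_sub (outer_minus1 ReR r1 r2) => c h; rewrite /span h orbT.
move=> /esym; apply: contra; apply: linked_sub => c /andP[/andP[tc Rc] ->].
by rewrite /span (negbTE tc) (negbTE Rc).
Qed.

Lemma tree_side_same e u v z f g : ntree e -> joins e u v -> z \notin VR ->
  z \notin up u -> z \notin up v -> djoins (pe z) f g ->
  connect (dlinked (fun c => ntree c && (c != e))) f g.
Proof.
move=> ne je zR zu zv jz; have /andP[te Re] := ne.
set S := fun c => (span eR c && (c != pe z)) || (c == e).
have ez : pe z != e by apply: contraNneq te => <-; apply/treeP; exists z.
have Sz : ~~ S (pe z) by rewrite /S eqxx andbF (negbTE ez).
have nc : ~~ connect (linked S) z (par z).
  apply/negP => cn; have := up_par_notin zR; rewrite -[_ \notin _]/(~~ (fun v => z \in up v) (par z)) => /negP; apply.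
  apply: (@linked_ind G S (fun v => z \in up v) z (par z) _ cn (up_refl z)).
  move=> c a b /orP[/andP[/orP[tc|/andP[Rc _]] cz]|/eqP ->] j za.
  - by rewrite -(up_edge (e := c) tc _ j) // cz orbT.
  - by have [ac _] := joins_at j; have := up_outer Rc ac zR; rewrite za.
  - have [ac _] := joins_at j.
    by case: (joins_cases je ac) => aE; move: za; rewrite aE ?(negbTE zu) ?(negbTE zv).
have := dualityE Sz (pe_joins zR) jz; rewrite (negbTE nc) => /esym/negbFE cn.
have [fz gz] := joins_at jz; have nz := pe_off zR.
have fR : f != R0 by apply: contraNneq nz => <-.
have gR : g != R0 by apply: contraNneq nz => <-.
apply: (remove_outer ReR _ fR gR) => [c /andP[/ntree_outer]//|].
apply: linked_sub cn => c /andP[]; rewrite /S negb_or negb_and negbK => /andP[/orP[|/eqP ->]].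
  by move=> /cospan_sub/orP[->|->] ce _; rewrite ?ce ?orbT.
by rewrite eqxx.
Qed.

Lemma tree_side_cut e u v z f g : ntree e -> joins e u v -> z \notin VR ->
  z \in up u -> z \notin up v -> djoins (pe z) f g ->
  ~~ connect (dlinked (fun c => ntree c && (c != e))) f g.
Proof.
move=> ne je zR zu zv jz; have /andP[te Re] := ne.
set S := fun c => (span eR c && (c != pe z)) || (c == e).
have ez : pe z != e by apply: contraNneq te => <-; apply/treeP; exists z.
have Sz : ~~ S (pe z) by rewrite /S eqxx andbF (negbTE ez).
have trS a b : connect (linked (fun c => tree c && (c != pe z))) a b -> connect (linked S) a b.
  by apply: linked_sub => c /andP[tc cz]; rewrite /S /span tc cz.
have cn : connect (linked S) z (par z).
  apply: (@connect_trans _ _ u).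
    rewrite linked_connect_sym; apply: trS; apply: linked_sub (to_ancestor zu) => c.
    by rewrite (negbTE zR).
  apply: (@connect_trans _ _ v); first by apply: (linked_joins _ je); rewrite /S eqxx orbT.
  apply: connect_trans (trS _ _ (to_root_avoiding zR zv)) _.
  have pz := up_par_notin zR.
  rewrite linked_connect_sym; apply: connect_trans (trS _ _ (to_root_avoiding zR pz)) _.
  have [r1 _] := baseP (par z); have [r2 _] := baseP v.
  apply: linked_sub (outer_minus1 ReR r1 r2) => c /andP[Rc cR].
  rewrite /S /span Rc cR orbT /=; apply/orP; left.
  by apply: contraTneq Rc => ->; exact: pe_off.
have := dualityE Sz (pe_joins zR) jz; rewrite cn => /esym; apply: contra.
apply: linked_sub => c /andP[/andP[tc Rc] ce].
rewrite /S /span (negbTE tc) (negbTE Rc) (negbTE ce) /=.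
by apply: contraNneq tc => ->; apply/treeP; exists z.
Qed.

Lemma outer_side_cut e u v y (g1 g2 : edge G) (o1 o2 : Phi) : ntree e -> joins e u v -> g1 != g2 ->
  at_vertex y g1 -> at_vertex y g2 -> djoins g1 R0 o1 -> djoins g2 R0 o2 ->
  y \in VR -> y \in up u -> y \notin up v ->
  ~~ connect (dlinked (fun c => ntree c && (c != e))) o1 o2.
Proof.
move=> ne je g12 y1 y2 j1 j2 yR yu yv; have /andP[te Re] := ne.
set S := fun c => [|| tree c, [&& dat R0 c, c != g1 & c != g2] | c == e].
have R1 : dat R0 g1 by have [] := joins_at j1.
have R2 : dat R0 g2 by have [] := joins_at j2.
have tR c : tree c -> ~~ dat R0 c by move=> /treeP[z zR <-]; exact: pe_off.
have eR2 : g2 != e by apply: contraNneq Re => <-.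
have eR1 : g1 != e by apply: contraNneq Re => <-.
have t1 : ~~ tree g1 by apply/negP => /tR; rewrite R1.
have t2 : ~~ tree g2 by apply/negP => /tR; rewrite R2.
have S2 : ~~ S g2 by rewrite /S (negbTE t2) eqxx !andbF (negbTE eR2).
have [w jw] := at_joins y2; have [_ w2] := joins_at jw.
have wR : w \in VR := dat_VR R2 w2.
have trS a b : connect (linked tree) a b -> connect (linked S) a b.
  by apply: linked_sub => c tc; rewrite /S tc.
have cn : connect (linked S) y w.
  apply: (@connect_trans _ _ u).
    by rewrite linked_connect_sym; apply: trS; apply: linked_sub (to_ancestor yu) => c /andP[].
  apply: (@connect_trans _ _ v); first by apply: (linked_joins _ je); rewrite /S eqxx !orbT.
  apply: connect_trans (trS _ _ (to_root v)) _.
  have [r1 r2] := baseP v.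
  have ry : base v != y by apply: contraNneq yv => <-.
  have wy : w != y by rewrite eq_sym; exact: joins_neq jw.
  apply: linked_sub (outer_minus2 R1 R2 g12 y1 y2 r1 wR ry wy) => c h.
  by rewrite /S h orbT.
have := dualityE S2 jw j2; rewrite cn => /esym; apply: contra => co.
apply: (@connect_trans _ _ o1).
  apply: (linked_joins _ j1); rewrite g12 andbT.
  by rewrite /S (negbTE t1) eqxx !andbF (negbTE eR1).
apply: linked_sub co => c /andP[/andP[tc Rc] ce].
rewrite /S (negbTE tc) (negbTE Rc) (negbTE ce) /=.
by apply: contraNneq Rc => ->.
Qed.

Lemma outer_at v : v \in VR -> exists g1 g2 : edge G, [/\ g1 != g2, at_vertex v g1,
  at_vertex v g2, dat R0 g1 & dat R0 g2].
Proof.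
move=> /face_vertsP[e ve Re].
have [e' e'e /andP[ve' Re']] := face_degree_ge2 ve Re.
by exists e', e.
Qed.

Lemma faces_same_side e u v y v1 v2 f1 f2 : ntree e -> joins e u v ->
  y \notin up u -> y \notin up v -> y \in up v1 -> y \in up v2 ->
  v1 \in face_verts f1 -> v2 \in face_verts f2 -> f1 != R0 -> f2 != R0 ->
  connect (dlinked (fun c => ntree c && (c != e))) f1 f2.
Proof.
move=> ne je yu yv y1 y2 F1 F2 R1 R2.
set B := fun c => ntree c && (c != e).
have local w h h' : y \in up w -> w \in face_verts h -> w \in face_verts h' ->
    h != R0 -> h' != R0 -> connect (dlinked B) h h'.
  move=> yw /face_vertsP[c wc hc] /face_vertsP[c' wc' hc'] hR hR'.
  have cn := link_minus_face wc wc' hc hc' hR hR'.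
  apply: (@linked_ind Gd _ (fun g => connect (dlinked B) h g) h h' _ cn (connect0 _ _)).
  move=> a g g' /andP[wa Ra] j hg; apply: connect_trans hg _.
  have [ta|ta] := boolP (tree a).
    have /treeP[z zR zE] := ta; rewrite -zE in j wa.
    have yz : y \in up z.
      by case: (joins_cases (pe_joins zR) wa) => wE; rewrite wE in yw => //; exact: up_trans (up_par z) yw.
    apply: (tree_side_same ne je zR _ _ j); first by apply: contra yu => /up_trans; apply.
    by apply: contra yv => /up_trans; apply.
  apply: (linked_joins _ j); rewrite /B /ntree ta Ra /=.
  apply: contraNneq yu => aE; rewrite aE in wa.
  by case: (joins_cases je wa) => wE; rewrite wE in yw => //; rewrite yw in yv.
have [c yc [f fc fR]] : exists2 c, at_vertex y c & exists2 f, dat f c & f != R0.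
  have [c yc] := incident_exists y; exists c => //.
  have := dneq c.
  have [lR lr|lR _] := eqVneq (lf c) R0; last by exists (lf c); rewrite // /at_vertex eqxx.
  by exists (rf c); rewrite ?/at_vertex ?eqxx ?orbT // -lR eq_sym.
have yf : y \in face_verts f by apply/face_vertsP; exists c.
have down w : y \in up w -> forall h, w \in face_verts h -> h != R0 -> connect (dlinked B) h f.
  elim/forest_ind: w => w IH yw h wh hR.
  have [yE|yE] := eqVneq y w; first by apply: (local y) => //; rewrite ?up_refl // yE.
  have [wR|wR] := boolP (w \in VR); first by move: yw; rewrite up_root // inE (negbTE yE).
  have yp : y \in up (par w) by move: yw; rewrite up_step // in_setU1 (negbTE yE).
  have [wp pp] := joins_at (pe_joins wR); have nR := pe_off wR.
  have lp : dat (lf (pe w)) (pe w) by rewrite /at_vertex eqxx.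
  have lR : lf (pe w) != R0 by apply: contraNneq nR => <-.
  apply: (@connect_trans _ _ (lf (pe w))).
    by apply: (local w) => //; apply/face_vertsP; exists (pe w).
  by apply: (IH wR yp) => //; apply/face_vertsP; exists (pe w).
apply: connect_trans (down v1 y1 f1 F1 R1) _.
by have := down v2 y2 f2 F2 R2; rewrite (@linked_connect_sym Gd).
Qed.

Definition turning y e := exists u v, [/\ joins e u v, y \in up u & y \notin up v].

Lemma detour (F a : Phi) : F != R0 -> a != R0 -> exists c : edge G, forall h : edge G,
  F != a -> dat F h -> h != c -> connect (dlinked (fun c => ntree c && (c != h))) F a.
Proof.
move=> FR aR; have [<-|Fa] := eqVneq F a.
  by exists eR => h.
have [c [w [nc j _ cw]]] := first_edge (ntree_connected FR aR) Fa.
exists c => h _ Fh hc; apply: (@connect_trans _ _ w).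
  by apply: (linked_joins _ j); rewrite nc eq_sym hc.
apply: linked_sub cw => x /andP[-> Fx] /=.
by apply: contraNneq Fx => ->.
Qed.

Lemma three_separating (F a b : Phi) (ga gb h1 h2 h3 : edge G) : F != R0 -> a != R0 -> b != R0 ->
  h1 != h2 -> h1 != h3 -> h2 != h3 ->
  ~ (forall h : edge G, h \in [:: h1; h2; h3] -> dat F h /\
    [\/ ~~ connect (dlinked (fun c => ntree c && (c != h))) a b,
        h = ga /\ a = F | h = gb /\ b = F]).
Proof.
move=> FR aR bR h12 h13 h23 H.
have [ca caP] := detour FR aR; have [cb cbP] := detour FR bR.
pose da := if a == F then ga else ca; pose db := if b == F then gb else cb.
have key (h : edge G) : h \in [:: h1; h2; h3] -> h = da \/ h = db.
  move=> hin; have [Fh [nc|[-> aF]|[-> bF]]] := H h hin; last first.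
  - by right; rewrite /db bF eqxx.
  - by left; rewrite /da aF eqxx.
  have [->|hda] := eqVneq h da; first by left.
  have [->|hdb] := eqVneq h db; first by right.
  case/negP: nc; apply: (@connect_trans _ _ F).
    rewrite (@linked_connect_sym Gd).
    have [<-|aF] := eqVneq a F; first exact: connect0.
    by apply: caP => //; [rewrite eq_sym|move: hda; rewrite /da (negbTE aF)].
  have [<-|bF] := eqVneq b F; first exact: connect0.
  by apply: cbP => //; [rewrite eq_sym|move: hdb; rewrite /db (negbTE bF)].
have k1 := key h1; have k2 := key h2; have k3 := key h3.
rewrite !inE !eqxx ?orbT /= in k1 k2 k3.
by case: (k1 isT) h12 h13 h23 => ->; case: (k2 isT) => ->; case: (k3 isT) => ->; rewrite ?eqxx.
Qed.

Lemma three_turning y (F : Phi) (h1 h2 h3 : edge G) : F != R0 -> h1 != h2 -> h1 != h3 -> h2 != h3 ->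
  ~ (forall h : edge G, h \in [:: h1; h2; h3] -> dat F h /\ turning y h).
Proof.
move=> FR h12 h13 h23 H.
have [yR|yR] := boolP (y \in VR).
  have [g1 [g2 [g12 y1 y2 R1 R2]]] := outer_at yR.
  have [o1 j1] := at_joins R1; have [o2 j2] := at_joins R2.
  have dn (g : edge G) (o : Phi) : djoins g R0 o -> o != R0.
    by move=> j; rewrite eq_sym; exact: (djoins_neq j).
  apply: (three_separating (ga := g1) (gb := g2) FR (dn _ _ j1) (dn _ _ j2) h12 h13 h23) => h hin.
  have [Fh [u [v [juv yu yv]]]] := H h hin; split=> //.
  have [uh vh] := joins_at juv.
  have [Rh|Rh] := boolP (dat R0 h).
    have uR := dat_VR Rh uh; move: yu; rewrite up_root // inE => /eqP yE.
    rewrite -yE in uh.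
    have o_eq (g : edge G) (o : Phi) : h = g -> djoins g R0 o -> o = F.
      move=> hE j; rewrite hE in Fh; case: (joins_cases j Fh) => // FE.
      by rewrite FE eqxx in FR.
    have [hg|hg] := eqVneq h g1; first by constructor 2; split=> //; exact: o_eq hg j1.
    constructor 3; rewrite eq_sym in hg.
    have hE := eqP (face_degree_le2 y1 y2 uh R1 R2 Rh g12 hg).
    by split=> //; exact: (o_eq g2).
  have [th|th] := boolP (tree h); first by rewrite (up_edge th _ juv) ?yR // (negbTE yv) in yu.
  by constructor 1; apply: (outer_side_cut _ juv g12 y1 y2 j1 j2) => //; rewrite /ntree th.
have nR := pe_off yR.
have lR : lf (pe y) != R0 by apply: contraNneq nR => <-; rewrite /at_vertex eqxx.
have rR : rf (pe y) != R0 by apply: contraNneq nR => <-; rewrite /at_vertex eqxx orbT.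
apply: (three_separating (ga := pe y) (gb := pe y) FR lR rR h12 h13 h23) => h hin.
have [Fh [u [v [juv yu yv]]]] := H h hin; split=> //.
have [uh vh] := joins_at juv.
have Rh : ~~ dat R0 h by apply: contraL yu => Rh; exact: up_outer Rh uh yR.
have [hE|hE] := eqVneq h (pe y).
  rewrite hE in Fh; case/orP: Fh => /eqP; first by constructor 2.
  by constructor 3.
have [th|th] := boolP (tree h); first by rewrite (up_edge th _ juv) ?hE ?orbT // (negbTE yv) in yu.
constructor 1; apply: (tree_side_cut _ juv yR yu yv (joins_ends _)).
by rewrite /ntree th.
Qed.

Lemma change (J : nat -> bool) i j : i < j -> J i != J j ->
  exists2 k, i <= k < j & J k != J k.+1.
Proof.
move=> ij; elim: j ij => // j IH ij Jij.
have [Jj|Jj] := eqVneq (J j) (J j.+1); last by exists j => //; lia.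
have [iE|iE] := eqVneq i j; first by rewrite iE Jj eqxx in Jij.
have [||k ki Jk] := IH; [by lia|by rewrite Jj|exists k => //; lia].
Qed.

Lemma no_alternation y (F : Phi) n (x : nat -> vertex G) (g : nat -> edge G) s l t p :
  F != R0 -> frame F n x g -> s < l -> l < t -> t < p -> p <= n ->
  y \in up (x s) -> y \notin up (x l) -> y \in up (x t) -> y \notin up (x p) -> False.
Proof.
move=> FR Fr sl lt tp pn Js Jl Jt Jp.
pose J i := y \in up (x i).
have [k1 k1i c1] : exists2 k, s <= k < l & J k != J k.+1 by apply: change => //; rewrite /J Js (negbTE Jl).
have [k2 k2i c2] : exists2 k, l <= k < t & J k != J k.+1 by apply: change => //; rewrite /J Jt (negbTE Jl).
have [k3 k3i c3] : exists2 k, t <= k < p & J k != J k.+1 by apply: change => //; rewrite /J Jt (negbTE Jp).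
have ne i j : i < j -> j < n -> g i != g j.
  by move=> ij jn; apply/eqP => /(frame_injg Fr (ltn_trans ij jn) jn) ijE; rewrite ijE ltnn in ij.
have tn k : k < n -> J k != J k.+1 -> dat F (g k) /\ turning y (g k).
  move=> kn; rewrite /J => c; split; first exact: frame_side Fr _ kn.
  have j := frame_joins Fr kn.
  have [a|a] := boolP (y \in up (x k)).
    by exists (x k), (x k.+1); split=> //; move: c; rewrite a; case: (_ \in _).
  exists (x k.+1), (x k); split=> //; first by rewrite joinsC.
  by move: c; rewrite (negbTE a); case: (_ \in _).
have [k12 k23 k3n] : [/\ k1 < k2, k2 < k3 & k3 < n] by clear - k1i k2i k3i pn; split; lia.
have k2n := ltn_trans k23 k3n; have k1n := ltn_trans k12 k2n.
apply: (@three_turning y F (g k1) (g k2) (g k3) FR).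
- exact: ne.
- exact: ne (ltn_trans k12 k23) k3n.
- exact: ne.
- by move=> h; rewrite !inE => /or3P[] /eqP ->; exact: tn.
Qed.

Implicit Types (F : Phi) (A : {set Phi}).

(** * Fans over the branches of the cotree *)

Definition other f e : Phi := if lf e == f then rf e else lf e.

Lemma otherP f e : dat f e -> djoins e f (other f e).
Proof.
rewrite /other /at_vertex /joins /=; have [<-|lf_] := eqVneq (lf e) f; first by rewrite !eqxx.
by move=> /eqP ->; rewrite !eqxx orbT.
Qed.

Definition side e f : {set Phi} :=
  [set h | connect (dlinked (fun c => ntree c && (c != e))) f h].

Definition branch f e : {set Phi} := if ntree e then side e (other f e) else set0.

Lemma side_refl e f : f \in side e f.
Proof. by rewrite inE connect0. Qed.

Lemma side_outer e f : f != R0 -> R0 \notin side e f.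
Proof.
move=> fR; rewrite inE (@linked_connect_sym Gd); apply/negP => /first_edge.
rewrite eq_sym => /(_ fR)[c [w [/andP[/ntree_outer nc _] j _ _]]].
by have [cR _] := joins_at j; rewrite cR in nc.
Qed.

Lemma branchP f e h : h \in branch f e -> ntree e /\ h \in side e (other f e).
Proof. by rewrite /branch; case: ifP => // _; rewrite inE. Qed.

Lemma ntree_other f e : ntree e -> dat f e -> other f e != R0.
Proof.
move=> /ntree_outer nR fe; have [_ oe] := joins_at (otherP fe).
by apply: contraNneq nR => <-.
Qed.

Lemma branch_outer f e : dat f e -> R0 \notin branch f e.
Proof.
move=> fe; apply/negP => /branchP[ne]; apply/negP.
by apply: side_outer; exact: ntree_other.
Qed.

Lemma branch_self f e : dat f e -> f \notin branch f e.
Proof.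
move=> fe; apply/negP => /branchP[ne]; rewrite inE (@linked_connect_sym Gd).
by apply/negP; apply: ntree_bridge => //; exact: otherP.
Qed.

Lemma branch_first f e h : h \in branch f e -> dat f e ->
  connect (dlinked (fun c => (ntree c && (c != e)) && ~~ dat f c)) (other f e) h.
Proof.
move=> hb fe; have [ne] := branchP hb; rewrite inE => /connectP[p pp hE].
have all_branch : forall q, path (dlinked (fun c => ntree c && (c != e))) (other f e) q ->
    {in q, forall z : Phi, z != f}.
  move=> q pq z zq; apply: contraNneq (branch_self fe) => zf.
  rewrite -{1}zf /branch ne inE.
  case/splitPr: zq pq => q1 q2; rewrite cat_path /= => /and3P[p1 l _].
  by apply/connectP; exists (rcons q1 z); rewrite ?rcons_path ?p1 ?last_rcons.
have of_ : other f e != f by rewrite eq_sym; apply: djoins_neq; exact: otherP.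
have ap0 := all_branch p pp; move: ap0 pp hE; elim: p (other f e) of_ => [|x p IH] a af ap /=.
  by move=> _ ->; exact: connect0.
move=> /andP[/linkedP[c cS j] pp] hE; have xf : x != f by apply: ap; rewrite mem_head.
apply: connect_trans (IH x xf _ pp hE); last by move=> y yp; apply: ap; rewrite in_cons yp orbT.
apply: (linked_joins _ j); rewrite cS /=; apply/negP => /(joins_cases j)[] fE.
  by rewrite fE eqxx in af.
by rewrite fE eqxx in xf.
Qed.

Lemma branch_sub_side f e c : ntree e -> dat f e -> dat f c -> c != e ->
  branch f c \subset side e f.
Proof.
move=> ne fe fc ce; apply/subsetP => h hb; have [nc _] := branchP hb.
rewrite inE; apply: (@connect_trans _ _ (other f c)).
  by apply: (linked_joins _ (otherP fc)); rewrite nc ce.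
apply: linked_sub (branch_first hb fc) => x /andP[/andP[-> _] fx] /=.
by apply: contraNneq fx => ->.
Qed.

Lemma branch_disjoint f c c' h : dat f c -> dat f c' -> c != c' ->
  h \in branch f c -> h \notin branch f c'.
Proof.
move=> fc fc' cc' hb; apply/negP => hb'; have [nc _] := branchP hb.
have [nc' hs] := branchP hb'; case/negP: (branch_self fc').
rewrite /branch nc' inE; rewrite inE in hs; apply: connect_trans hs _.
rewrite (@linked_connect_sym Gd); apply: (@connect_trans _ _ (other f c)).
  by apply: (linked_joins _ (otherP fc)); rewrite nc cc'.
apply: linked_sub (branch_first hb fc) => x /andP[/andP[-> _] fx] /=.
by apply: contraNneq fx => ->.
Qed.

Lemma cotree_side_cases e f h : h \in side e f -> h = f \/
  exists c, [/\ dat f c, c != e & h \in branch f c].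
Proof.
rewrite inE => cn; have [->|fh] := eqVneq f h; [by left|right].
have [c [w [/andP[nc ce] j wf cw]]] := first_edge cn fh; have [fc _] := joins_at j.
exists c; split => //; rewrite /branch nc inE.
rewrite (joins_eq (otherP fc) j); apply: linked_sub cw => x /andP[/andP[-> _] fx] /=.
by apply: contraNneq fx => ->.
Qed.

Lemma branch_cover f h : f != R0 -> h != R0 -> h != f ->
  exists2 c, dat f c & h \in branch f c.
Proof.
move=> fR hR hf; rewrite eq_sym in hf.
have [c [w [nc j wf cw]]] := first_edge (ntree_connected fR hR) hf; have [fc _] := joins_at j.
exists c => //; rewrite /branch nc inE.
rewrite (joins_eq (otherP fc) j); apply: linked_sub cw => x /andP[-> fx] /=.
by apply: contraNneq fx => ->.
Qed.

Definition verts (A : {set Phi}) : {set vertex G} := \bigcup_(f in A) face_verts f.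
Definition ups (A : {set Phi}) : {set vertex G} := \bigcup_(v in verts A) up v.

Lemma vertsP A v : reflect (exists2 f, f \in A & v \in face_verts f) (v \in verts A).
Proof. exact: bigcupP. Qed.

Lemma upsP A y : reflect (exists2 v, v \in verts A & y \in up v) (y \in ups A).
Proof. exact: bigcupP. Qed.

Lemma verts_ups A : verts A \subset ups A.
Proof. by apply/subsetP => v vA; apply/upsP; exists v => //; exact: up_refl. Qed.

Lemma verts_sub (A B : {set Phi}) : A \subset B -> verts A \subset verts B.
Proof.
by move=> AB; apply/subsetP => v /vertsP[f fA vf]; apply/vertsP; exists f => //; exact: (subsetP AB).
Qed.

Lemma ups_sub (A B : {set Phi}) : A \subset B -> ups A \subset ups B.
Proof.
move=> AB; apply/subsetP => y /upsP[v vA yv]; apply/upsP; exists v => //.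
exact: (subsetP (verts_sub AB)).
Qed.

Lemma separation f e u v y v2 f2 : dat f e -> joins e u v -> y \in ups (branch f e) ->
  f2 \notin branch f e -> f2 != R0 -> v2 \in face_verts f2 -> y \in up v2 ->
  y \in up u :|: up v.
Proof.
move=> fe j /upsP[v1 /vertsP[f1 f1b v1f] yv1] f2b f2R v2f yv2.
have [ne f1s] := branchP f1b; rewrite in_setU; apply/negPn/negP; rewrite negb_or => /andP[yu yv].
have f1R : f1 != R0 by apply: contraTneq f1b => ->; exact: branch_outer.
case/negP: f2b; rewrite /branch ne inE; rewrite inE in f1s.
apply: connect_trans f1s _.
exact: (faces_same_side ne j yu yv yv1 yv2 v1f v2f f1R f2R).
Qed.

Lemma frame_vertex F n (x : nat -> vertex G) (g : nat -> edge G) i : frame F n x g -> i <= n ->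
  x i \in face_verts F.
Proof.
move=> Fr; have key j : j < n -> x j \in face_verts F.
  move=> jn; apply/face_vertsP; exists (g j); last exact: frame_side Fr _ jn.
  by have [] := joins_at (frame_joins Fr jn).
rewrite leq_eqVlt => /orP[/eqP ->|]; last exact: key.
by rewrite (frame_close Fr); apply: key; exact: ltn_trans (frame_gt1 Fr).
Qed.

Definition sector F (x : nat -> vertex G) (g : nat -> edge G) t : {set vertex G} :=
  ups (branch F (g t)) :|: (up (x t) :|: up (x t.+1)).

Lemma sector_vertex F (x : nat -> vertex G) (g : nat -> edge G) t : up (x t) \subset sector F x g t.
Proof. by rewrite /sector setUCA subsetUl. Qed.

Lemma sector_vertexS F (x : nat -> vertex G) (g : nat -> edge G) t : up (x t.+1) \subset sector F x g t.
Proof. by rewrite /sector setUA subsetUr. Qed.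

Lemma sector_branch F (x : nat -> vertex G) (g : nat -> edge G) t : ups (branch F (g t)) \subset sector F x g t.
Proof. exact: subsetUl. Qed.

Lemma sector_sep F n (x : nat -> vertex G) (g : nat -> edge G) i j y : F != R0 -> frame F n x g ->
  i < n -> j < n -> i != j -> y \in sector F x g i -> y \in sector F x g j ->
  y \in up (x i) :|: up (x i.+1).
Proof.
move=> FR Fr ni nj ij; rewrite {1}/sector in_setU => /orP[yi yj|//].
have si := frame_side Fr ni; have ji := frame_joins Fr ni.
have : [|| y \in ups (branch F (g j)), y \in up (x j) | y \in up (x j.+1)].
  by move: yj; rewrite /sector !in_setU.
case/or3P => [/upsP[v /vertsP[f fb vf] yv]|yx|yx].
- have gij : g j != g i by apply: contra ij => /eqP/(frame_injg Fr nj ni) ->.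
  have fi := branch_disjoint (frame_side Fr nj) si gij fb.
  have fR : f != R0 by apply: contraTneq fb => ->; exact: branch_outer (frame_side Fr nj).
  exact: (separation si ji yi fi fR vf yv).
- exact: (separation si ji yi (branch_self si) FR (frame_vertex Fr (ltnW nj)) yx).
- exact: (separation si ji yi (branch_self si) FR (frame_vertex Fr nj) yx).
Qed.

(* A chord of F together with the paths from its ends to the outer face separates. *)
Lemma chord F n (x : nat -> vertex G) (g : nat -> edge G) i j l p y : F != R0 -> frame F n x g ->
  i < l -> l <= j -> j < p -> p <= n ->
  y \in sector F x g i -> y \in sector F x g j -> y \in up (x l) :|: up (x p).
Proof.
move=> FR Fr il lj jp pn yi yj.
have jn := leq_trans jp pn; have ij := leq_trans il lj; have ni := ltn_trans ij jn.
have nij : i != j by rewrite neq_ltn ij.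
have nji : j != i by rewrite eq_sym.
have yi' := sector_sep FR Fr ni jn nij yi yj.
have yj' := sector_sep FR Fr jn ni nji yj yi.
rewrite in_setU; apply/negPn/negP; rewrite negb_or => /andP[yl yp].
have [s sl ys] : exists2 s, s < l & y \in up (x s).
  move: yi'; rewrite in_setU => /orP[h|h]; first by exists i.
  exists i.+1 => //; rewrite ltn_neqAle il andbT.
  by apply: contraNneq yl => <-.
have [t [lt tp] yt] : exists2 t, l < t /\ t < p & y \in up (x t).
  move: yj'; rewrite in_setU => /orP[h|h].
    exists j => //; split=> //; rewrite ltn_neqAle lj andbT.
    by apply: contraNneq yl => ->.
  exists j.+1 => //; split; first by rewrite ltnS.
  by rewrite ltn_neqAle jp andbT; apply: contraNneq yp => <-.
exact: (no_alternation FR Fr sl lt tp pn ys yl yt yp).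
Qed.

Definition outer_part (A : {set Phi}) : {set vertex G} := VR :&: verts A.

Section Fan.
Variables (m : nat) (F : Phi) (n : nat) (x : nat -> vertex G) (g : nat -> edge G).
Hypotheses (FR : F != R0) (Fr : frame F n x g).

(* A partial decomposition containing a bag with the boundary of the branch extends over
   the branch. *)
Definition extends_over (e : edge G) (A : {set Phi}) := forall u v D B, joins e u v ->
  leaf_list m D -> B \in D ->
  up u :|: up v :|: outer_part A \subset B ->
  covered D :&: ups A \subset up u :|: up v :|: outer_part A ->
  exists D', [/\ leaf_list m D', {subset D <= D'}, covered D' \subset covered D :|: ups A &
    forall f, f \in A -> exists2 B', B' \in D' & face_verts f \subset B'].

Lemma fan lo hi p (L : {set vertex G}) D0 B0 :
  lo <= hi -> hi <= p -> p <= n ->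
  leaf_list m D0 -> B0 \in D0 -> up (x lo) :|: up (x p) :|: L \subset B0 ->
  (forall t, lo <= t < p -> covered D0 :&: sector F x g t \subset up (x lo) :|: up (x p) :|: L) ->
  (forall t, lo <= t < hi -> outer_part (branch F (g t)) \subset L) ->
  (forall t, lo <= t < hi -> L :&: ups (branch F (g t)) \subset
     up (x t) :|: up (x t.+1) :|: outer_part (branch F (g t))) ->
  (forall t, lo <= t < hi -> #|up (x t) :|: up (x t.+1) :|: up (x p) :|: L| <= m) ->
  (forall t, lo <= t < hi -> ntree (g t) -> extends_over (g t) (branch F (g t))) ->
  exists D, [/\ leaf_list m D, {subset D0 <= D},
    covered D \subset covered D0 :|: (up (x p) :|: L :|: \bigcup_(i < n | lo <= i < hi) sector F x g i),
    exists2 B, B \in D & up (x hi) :|: up (x p) :|: L \subset B &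
    (forall t, hi <= t < p -> covered D :&: sector F x g t \subset up (x hi) :|: up (x p) :|: L) /\
    forall t f, lo <= t < hi -> f \in branch F (g t) ->
      exists2 B', B' \in D & face_verts f \subset B'].
Proof.
move=> lohi hip pn ok0 B0D B0s inv0 Lo Ls sz IH.
elim: hi lohi hip Lo Ls sz IH => [|hi IHhi] lohi hip Lo Ls sz IH.
  have lo0 : lo = 0 by apply/eqP; rewrite -leqn0.
  exists D0; split=> //; first exact: subsetUl.
    by exists B0 => //; rewrite -lo0.
  by split=> [t|t f]; [rewrite -lo0; exact: inv0|rewrite ltn0 andbF].
move: lohi; rewrite leq_eqVlt => /orP[/eqP loE|lohi].
  exists D0; split=> //; first exact: subsetUl.
    by exists B0 => //; rewrite -loE.
  split=> [t|t f]; first by rewrite -loE; exact: inv0.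
  by rewrite -loE => /andP[a b]; have := leq_trans b a; rewrite ltnn.
rewrite ltnS in lohi.
have wk t : lo <= t < hi -> lo <= t < hi.+1.
  by move=> /andP[-> /ltnW]; rewrite ltnS.
have [||||D [ok sub cov [B BD Bs] [inv cv]]] := IHhi lohi (ltnW hip).
- by move=> t /wk; exact: Lo.
- by move=> t /wk; exact: Ls.
- by move=> t /wk; exact: sz.
- by move=> t /wk; exact: IH.
have hin : hi < n := leq_trans hip pn.
have hiw : lo <= hi < hi.+1 by rewrite lohi leqnn.
have hip' : hi <= hi < p by rewrite leqnn.
pose B1 := up (x hi) :|: up (x hi.+1) :|: up (x p) :|: L.
have B1s : B1 :&: covered D \subset B.
  apply/subsetP => y; rewrite in_setI !in_setU => /andP[yB1 yD].
  apply: (subsetP Bs); rewrite !in_setU.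
  case/orP: yB1 => [/orP[/orP[->//|yh]|->]|->]; rewrite ?orbT //.
  have : y \in covered D :&: sector F x g hi.
    by rewrite in_setI yD; exact: (subsetP (sector_vertexS F x g hi)).
  by move=> /(subsetP (inv hi hip')); rewrite !in_setU.
have ok1 : leaf_list m (B1 :: D) by apply: (leaf_cons ok BD B1s); exact: sz.
have ji := frame_joins Fr hin; have si := frame_side Fr hin.
have covA : covered (B1 :: D) :&: ups (branch F (g hi)) \subset
    up (x hi) :|: up (x hi.+1) :|: outer_part (branch F (g hi)).
  apply/subsetP => y; rewrite in_setI covered_cons => /andP[yc yA].
  have base_ : y \in up (x p) -> y \in up (x hi) :|: up (x hi.+1) :|: outer_part (branch F (g hi)).
    move=> yp; rewrite in_setU; apply/orP; left.
    exact: (separation si ji yA (branch_self si) FR (frame_vertex Fr pn) yp).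
  have load : y \in L -> y \in up (x hi) :|: up (x hi.+1) :|: outer_part (branch F (g hi)).
    by move=> yL; apply: (subsetP (Ls hi hiw)); rewrite in_setI yL.
  have xh : y \in up (x hi) -> y \in up (x hi) :|: up (x hi.+1) :|: outer_part (branch F (g hi)).
    by rewrite !in_setU => ->.
  move: yc; rewrite in_setU => /orP[|yD].
    rewrite /B1 in_setU => /orP[|]; last exact: load.
    rewrite in_setU => /orP[|]; last exact: base_.
    by rewrite in_setU => yh; rewrite in_setU in_setU yh.
  have : y \in covered D :&: sector F x g hi.
    by rewrite in_setI yD; exact: (subsetP (sector_branch F x g hi)).
  move=> /(subsetP (inv hi hip')); rewrite in_setU => /orP[|]; last exact: load.
  by rewrite in_setU => /orP[]; [exact: xh|exact: base_].
have [D2 [ok2 sub2 cov2 cv2]] : exists D', [/\ leaf_list m D', {subset B1 :: D <= D'},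
    covered D' \subset covered (B1 :: D) :|: ups (branch F (g hi)) &
    forall f, f \in branch F (g hi) -> exists2 B', B' \in D' & face_verts f \subset B'].
  have [ne|ne] := boolP (ntree (g hi)); last first.
    exists (B1 :: D); split=> //; first exact: subsetUl.
    by move=> f; rewrite /branch (negbTE ne) inE.
  apply: (IH hi hiw ne _ _ _ B1 ji ok1 (mem_head _ _) _ covA).
  apply/subsetP => y; rewrite /B1 !in_setU => /orP[->//|yo].
  by rewrite (subsetP (Lo hi hiw) y yo) orbT.
have subD : {subset D <= D2} by move=> B' B'D; apply: sub2; rewrite in_cons B'D orbT.
exists D2; split=> //.
- by move=> B' /sub/subD.
- apply: subset_trans cov2 _; rewrite covered_cons.
  apply/subsetP => y; rewrite !in_setU.
  have sec : y \in sector F x g hi -> y \in \bigcup_(i < n | lo <= i < hi.+1) sector F x g i.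
    by move=> ys; apply/bigcupP; exists (Ordinal hin).
  case/orP => [/orP[|yD]|yA].
  - rewrite /B1 ?in_setU => /orP[/orP[/orP[yh|yh]|->]|->]; rewrite ?orbT //.
      by rewrite sec ?orbT //; exact: (subsetP (sector_vertex F x g hi)).
    by rewrite sec ?orbT //; exact: (subsetP (sector_vertexS F x g hi)).
  - have := subsetP cov y yD; rewrite !in_setU => /orP[->//|/orP[->|/bigcupP[i ihi yi]]].
      by rewrite orbT.
    apply/orP; right; apply/orP; right; apply/bigcupP; exists i => //.
    by apply: wk.
  - by rewrite sec ?orbT //; exact: (subsetP (sector_branch F x g hi)).
- exists B1; first by apply: sub2; rewrite mem_head.
  by apply/subsetP => y; rewrite /B1 !in_setU => /orP[/orP[->|->]|->]; rewrite ?orbT.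
split=> [t /andP[hit tp]|t f /andP[lot thi] ft]; last first.
  move: thi; rewrite ltnS leq_eqVlt => /orP[/eqP tE|thi]; first by apply: cv2; rewrite -tE.
  by have [|B' B'D fB] := cv t f _ ft; [rewrite lot|exists B' => //; exact: subD].
have ch y : y \in sector F x g hi -> y \in sector F x g t -> y \in up (x hi.+1) :|: up (x p) :|: L.
  move=> ys yt; rewrite in_setU; apply/orP; left.
  exact: (chord FR Fr (ltnSn hi) hit tp pn ys yt).
have inb y : y \in up (x hi) :|: up (x p) :|: L -> y \in sector F x g t ->
    y \in up (x hi.+1) :|: up (x p) :|: L.
  move=> yb yt; move: yb; rewrite !in_setU => /orP[/orP[yh|->]|->]; rewrite ?orbT //.
  by have := ch y (subsetP (sector_vertex F x g hi) y yh) yt; rewrite !in_setU.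
apply/subsetP => y; rewrite in_setI => /andP[/(subsetP cov2) yc yt].
have {}yc : [|| y \in B1, y \in covered D | y \in ups (branch F (g hi))].
  by move: yc; rewrite covered_cons in_setU in_setU -orbA.
case/or3P: yc => [yB1|yD|yA].
- have : [|| y \in up (x hi), y \in up (x hi.+1) :|: up (x p) | y \in L].
    by move: yB1; rewrite /B1 !in_setU !orbA.
  case/or3P => [yh|yb|yL]; last by rewrite in_setU yL orbT.
    exact: ch _ (subsetP (sector_vertex F x g hi) y yh) yt.
  by rewrite in_setU yb.
- have htp : hi <= t < p by rewrite (ltnW hit) tp.
  have yi : y \in covered D :&: sector F x g t by rewrite in_setI yD.
  exact: inb _ (subsetP (inv t htp) y yi) yt.
- exact: ch _ (subsetP (sector_branch F x g hi) y yA) yt.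
Qed.

End Fan.

Definition arc (x : nat -> vertex G) lo hi : {set vertex G} := [set v in map x (index_iota lo hi)].

Lemma arcP (x : nat -> vertex G) lo hi v :
  reflect (exists2 t, lo <= t < hi & v = x t) (v \in arc x lo hi).
Proof.
rewrite inE; apply: (iffP mapP) => -[t ti ->]; exists t => //.
  by rewrite mem_index_iota in ti.
by rewrite mem_index_iota.
Qed.

Lemma arc_card (x : nat -> vertex G) lo hi : #|arc x lo hi| <= hi - lo.
Proof. by rewrite cardsE; apply: leq_trans (card_size _) _; rewrite size_map size_iota. Qed.

Lemma other_edge f e : dat f e -> dat (other f e) e.
Proof. by move=> /otherP/joins_at[]. Qed.

Lemma other_neq f e : dat f e -> other f e != f.
Proof. by move=> /otherP/djoins_neq; rewrite eq_sym. Qed.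

Lemma other_eq f h e : dat f e -> dat h e -> h != f -> other f e = h.
Proof. by move=> fe /(joins_cases (otherP fe))[->|->//]; rewrite eqxx. Qed.

Lemma outer_face y : y \in VR -> exists h, [/\ h != R0, y \in face_verts h &
  exists2 c, at_vertex y c & dat R0 c /\ other R0 c = h].
Proof.
move=> /face_vertsP[c yc Rc]; exists (other R0 c); split; first exact: other_neq.
  by apply/face_vertsP; exists c => //; exact: other_edge.
by exists c.
Qed.

Lemma outer_ups f e u v y : dat f e -> joins e u v -> y \in VR -> y \in ups (branch f e) ->
  y \in up u :|: up v :|: outer_part (branch f e).
Proof.
move=> fe j yR yb; rewrite in_setU; have [h [hR yh _]] := outer_face yR.
have [hb|hb] := boolP (h \in branch f e).
  by apply/orP; right; rewrite in_setI yR; apply/vertsP; exists h.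
by rewrite (separation fe j yb hb hR yh (up_refl y)).
Qed.

Lemma outer_edges : #|[set c | dat R0 c]| <= #|VR|.
Proof.
have [n [x [g [Fr _]]]] := frame_exists ReR.
rewrite -(frame_card Fr); apply: leq_trans (_ : #|[set g i | i : 'I_n]| <= _).
  apply/subset_leq_card/subsetP => c; rewrite inE => /(frame_edge Fr)[i ni <-].
  by apply/imsetP; exists (Ordinal ni).
by apply: leq_trans (leq_imset_card _ _) _; rewrite card_ord.
Qed.

(* Each vertex of Y apart from the roots of w1 and w2 is charged to an outer edge. *)
Lemma load_card (Y : {set vertex G}) (C : {set edge G}) w1 w2 : Y \subset VR ->
  (forall y c, y \in Y -> y \notin up w1 :|: up w2 -> at_vertex y c -> dat R0 c -> c \in C) ->
  #|Y| <= #|C| + 2.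
Proof.
move=> YR YC; rewrite -(cardsID (up w1 :|: up w2)) addnC leq_add //.
  have [n [x [g [Fr _]]]] := frame_exists ReR.
  pose idx y := odflt ord0 [pick i : 'I_n.+1 | (i < n) && (x i == y)].
  have idxP y : y \in VR -> idx y < n /\ x (idx y) = y.
    rewrite /idx => /(frame_vert Fr)[i ni xi]; case: pickP => [j /andP[jn /eqP]//|].
    by move=> /(_ (Ordinal (ltnW ni : i < n.+1))); rewrite /= ni xi eqxx.
  have inj : {in Y :\: (up w1 :|: up w2) &, injective (g \o idx)}.
    move=> y z /setDP[/(subsetP YR)/idxP[yn yE] _] /setDP[/(subsetP YR)/idxP[zn zE] _] /=.
    by move=> /(frame_injg Fr yn zn) E; rewrite -yE -zE E.
  rewrite -(card_in_imset inj); apply/subset_leq_card/subsetP => _ /imsetP[y yY ->] /=.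
  move: yY; rewrite in_setD => /andP[yw yY].
  have [yn yE] := idxP _ (subsetP YR y yY).
  apply: (YC y) => //; last exact: frame_side Fr _ yn.
  by rewrite -[X in at_vertex X]yE; have [] := joins_at (frame_joins Fr yn).
apply: leq_trans (_ : #|(up w1 :&: VR) :|: (up w2 :&: VR)| <= _).
  rewrite -setIUl; apply/subset_leq_card/subsetP => y; rewrite in_setI => /andP[/(subsetP YR) a b].
  by rewrite in_setI b.
rewrite !up_VR; apply: leq_trans (leq_card_setU _ _) _; by rewrite !cards1.
Qed.

Definition rim (A : {set Phi}) : {set edge G} := [set c : edge G | dat R0 c && (other R0 c \in A)].

Lemma rim_sub (A B : {set Phi}) : A \subset B -> #|rim A| <= #|rim B|.
Proof.
move=> AB; apply/subset_leq_card/subsetP => c; rewrite !inE => /andP[->] /=.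
exact: (subsetP AB).
Qed.

Lemma outer_part_card f e : dat f e -> ntree e ->
  #|outer_part (branch f e)| <= #|rim (branch f e)| + 2.
Proof.
move=> fe ne; have j := joins_ends e.
apply: (load_card (w1 := tail_end e) (w2 := head_end e)); first exact: subsetIl.
move=> y c; rewrite in_setI => /andP[yR yb] yw yc Rc; rewrite inE Rc /=.
have yh : y \in face_verts (other R0 c).
  by apply/face_vertsP; exists c => //; exact: other_edge.
apply: contraNT yw => hb.
exact: (separation fe j (subsetP (verts_ups _) y yb) hb (other_neq Rc) yh (up_refl y)).
Qed.

Definition charge F (b : edge G) : {set edge G} :=
  [set c : edge G | dat R0 c && ((c == b) || (other R0 c \in branch F b))].

Lemma charge_disjoint F b b' c : F != R0 -> dat F b -> dat F b' -> b != b' ->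
  c \in charge F b -> c \notin charge F b'.
Proof.
move=> FR Fb Fb' bb'; rewrite !inE => /andP[Rc cb]; rewrite Rc /= negb_or.
have own (a : edge G) : dat F a -> c == a -> other R0 c = F.
  by move=> Fa /eqP ca; rewrite -ca in Fa; exact: other_eq.
case/orP: cb => [cb|cb].
  by rewrite (own b Fb cb) (eqP cb) bb' branch_self.
rewrite (branch_disjoint Fb Fb' bb' cb) andbT.
by apply: contraL cb => /(own _ Fb') ->; exact: branch_self.
Qed.

Lemma charge_cover F n (x : nat -> vertex G) (g : nat -> edge G) y c : F != R0 -> frame F n x g ->
  at_vertex y c -> dat R0 c -> exists t, [/\ t < n, c \in charge F (g t) & y \in sector F x g t].
Proof.
move=> FR Fr yc Rc; have hR := other_neq Rc; have hc := other_edge Rc.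
have yh : y \in face_verts (other R0 c) by apply/face_vertsP; exists c.
have [hF|hF] := eqVneq (other R0 c) F.
  rewrite hF in hc; have [t tn gt] := frame_edge Fr hc.
  exists t; rewrite inE Rc gt eqxx; split=> //.
  have := frame_joins Fr tn; rewrite gt => j.
  case: (joins_cases j yc) => ->; first exact: (subsetP (sector_vertex _ _ _ _)) (up_refl _).
  exact: (subsetP (sector_vertexS _ _ _ _)) (up_refl _).
have [b Fb hb] := branch_cover FR hR hF; have [t tn gt] := frame_edge Fr Fb.
exists t; rewrite inE Rc gt hb orbT; split=> //.
apply: (subsetP (sector_branch _ _ _ _)); rewrite gt; apply: (subsetP (verts_ups _)).
by apply/vertsP; exists (other R0 c).
Qed.

Lemma covered_card (T : finType) (D : seq {set T}) : #|covered D| <= \sum_(B <- D) #|B|.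
Proof.
elim: D => [|B D IH]; first by rewrite /covered !big_nil cards0.
rewrite covered_cons big_cons; apply: leq_trans (leq_card_setU _ _) _.
by rewrite leq_add2l.
Qed.

Definition arc_sectors F (x : nat -> vertex G) (g : nat -> edge G) lo hi : {set vertex G} :=
  VR :&: covered [seq sector F x g t | t <- index_iota lo hi].

Lemma arc_sectorsP F (x : nat -> vertex G) (g : nat -> edge G) lo hi y :
  reflect (y \in VR /\ exists2 t, lo <= t < hi & y \in sector F x g t)
    (y \in arc_sectors F x g lo hi).
Proof.
rewrite in_setI; apply: (iffP andP) => -[yR].
  move=> /coveredP[B /mapP[t ti ->] yt]; split=> //.
  by exists t => //; rewrite mem_index_iota in ti.
move=> [t ti yt]; split=> //; apply/coveredP; exists (sector F x g t) => //.
by apply/mapP; exists t => //; rewrite mem_index_iota.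
Qed.

Lemma arc_sectors_card F n (x : nat -> vertex G) (g : nat -> edge G) lo hi : F != R0 ->
  frame F n x g -> lo <= hi -> hi <= n -> (lo == 0) || (hi == n) ->
  #|arc_sectors F x g lo hi| <= \sum_(lo <= t < hi) #|charge F (g t)| + 2.
Proof.
move=> FR Fr lohi hin ends.
apply: (@leq_trans (#|covered [seq charge F (g t) | t <- index_iota lo hi]| + 2)); last first.
  by rewrite leq_add2r; apply: leq_trans (covered_card _) _; rewrite big_map.
apply: (load_card (w1 := x lo) (w2 := x hi)); first exact: subsetIl.
move=> y c /arc_sectorsP[yR [t /andP[lot thi] yt]] yw yc Rc.
have [s [sn cs ys]] := charge_cover FR Fr yc Rc.
suff sarc : lo <= s < hi.
  by apply/coveredP; exists (charge F (g s)) => //; apply/mapP; exists s => //; rewrite mem_index_iota.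
have [slo|los] := ltnP s lo; rewrite /=.
  by case/negP: yw; exact: (chord FR Fr slo lot thi hin ys yt).
rewrite ltnNge; apply: contra yw => his.
move: ends => /orP[/eqP lo0|/eqP hiE]; last by rewrite hiE leqNgt sn in his.
have := chord FR Fr thi his sn (leqnn n) yt ys.
by rewrite (frame_close Fr) lo0 setUC.
Qed.

Lemma charge_sum F n (x : nat -> vertex G) (g : nat -> edge G) : F != R0 -> frame F n x g ->
  \sum_(0 <= t < n) #|charge F (g t)| <= #|VR|.
Proof.
move=> FR Fr; apply: leq_trans outer_edges; rewrite big_mkord.
under eq_bigr => t _ do rewrite -sum1_card big_mkcond.
rewrite exchange_big -sum1_card [X in _ <= X]big_mkcond /=; apply: leq_sum => c _.
rewrite inE; have [Rc|Rc] := boolP (dat R0 c); last first.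
  by rewrite big1 // => t _; rewrite inE (negbTE Rc).
rewrite -big_mkcond sum1_card; apply/card_le1P => s cs t.
rewrite -!topredE /= in cs *; apply/idP/eqP => [ct|->//].
apply/val_inj/eqP; apply: contraTT ct => ts.
apply: (charge_disjoint FR (frame_side Fr (ltn_ord s)) (frame_side Fr (ltn_ord t)) _ cs).
apply: contra ts => /eqP/(frame_injg Fr (ltn_ord s) (ltn_ord t)) E.
by apply/eqP; exact: esym E.
Qed.

Variables (d k m : nat).
Hypothesis up_card : forall v, #|up v| <= d.+1.
Hypothesis face_card : forall f, #|face_verts f| <= k.
Hypothesis m_fan : 3 * d + k + 6 <= m.
Hypothesis m_hub : 2 * d + 2 * k + 2 <= m.


Lemma cardU_le (T : finType) (A B : {set T}) a b : #|A| <= a -> #|B| <= b -> #|A :|: B| <= a + b.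
Proof. by move=> Aa Bb; apply: leq_trans (leq_card_setU _ _) (leq_add Aa Bb). Qed.

Lemma fan_card u v w (L : {set vertex G}) l : #|L| <= l -> l <= k + 3 ->
  #|up u :|: up v :|: up w :|: L| <= m.
Proof.
move=> Ll lk; apply: leq_trans (cardU_le (cardU_le (cardU_le (up_card u) (up_card v)) (up_card w)) Ll) _.
by move: lk m_fan; clear; lia.
Qed.

Lemma branchE f e : ntree e -> branch f e = side e (other f e).
Proof. by move=> ne; rewrite /branch ne. Qed.

Lemma branch_rim_proper f b e : ntree e -> dat f e -> dat f b -> b != e ->
  #|branch f b| < #|side e f|.
Proof.
move=> ne fe fb be; apply: proper_card; apply/properP; split; first exact: branch_sub_side.
by exists f; [exact: side_refl|exact: branch_self].
Qed.

Lemma sector_sub_ups F n (x : nat -> vertex G) (g : nat -> edge G) (A : {set Phi}) t :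
  frame F n x g -> t < n -> F \in A -> branch F (g t) \subset A -> sector F x g t \subset ups A.
Proof.
move=> Fr tn FA bA; rewrite !subUset ups_sub //=.
have up_sub i : i <= n -> up (x i) \subset ups A.
  move=> ni; apply/subsetP => y yi; apply/upsP; exists (x i) => //.
  by apply/vertsP; exists F => //; exact: frame_vertex Fr ni.
by rewrite !up_sub // ltnW.
Qed.

Lemma arc_ups_branch F n (x : nat -> vertex G) (g : nat -> edge G) (L : {set vertex G}) lo hi t :
  F != R0 -> frame F n x g -> t < n -> hi <= n.+1 -> L \subset VR ->
  (arc x lo hi :|: L) :&: ups (branch F (g t)) \subset
    up (x t) :|: up (x t.+1) :|: outer_part (branch F (g t)).
Proof.
move=> FR Fr tn hin LR; have st := frame_side Fr tn; have jt := frame_joins Fr tn.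
apply/subsetP => y; rewrite in_setI in_setU => /andP[/orP[/arcP[i /andP[_ ii] yE]|yL] yb].
  have yF : y \in face_verts F by rewrite yE; apply: (frame_vertex Fr); rewrite -ltnS (leq_trans ii).
  by rewrite in_setU (separation st jt yb (branch_self st) FR yF (up_refl y)).
exact: outer_ups st jt (subsetP LR y yL) yb.
Qed.

(* The fans over the two halves of the boundary of F hang from a bag containing all of it. *)
Lemma branch_extends f e : dat f e -> ntree e -> 2 * #|rim (branch f e)| <= k ->
  extends_over m e (branch f e).
Proof.
move: {2}#|branch f e| (leqnn #|branch f e|) => N; elim: N f e => [|N IHN] f e.
  rewrite leqn0 cards_eq0 => /eqP A0 fe ne; have := side_refl e (other f e).
  by rewrite -branchE // A0 inE.
move=> AN fe ne rimA u v D B juv okD BD Bs cD.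
have bE : branch f e = side e (other f e) by exact: branchE.
have Fe := other_edge fe; set F := other f e in bE Fe *.
have FR : F != R0 by exact: ntree_other ne fe.
set A := branch f e in AN rimA Bs cD bE *.
have FA : F \in A by rewrite bE; exact: side_refl.
have [n [x [g [Fr ge]]]] := frame_exists Fe.
have n1 := frame_gt1 Fr; set p := n.-1 in ge.
have pn : p < n by rewrite ltn_predL ltnW.
have pSn : p.+1 = n by rewrite prednK // ltnW.
have nk : n <= k by rewrite (frame_card Fr).
pose RA := outer_part A.
have RAV : RA \subset VR by exact: subsetIl.
have RAc : #|RA| <= #|rim A| + 2 by exact: outer_part_card.
have jp := frame_joins Fr pn; rewrite ge pSn (frame_close Fr) in jp.
have uvE : up u :|: up v = up (x 0) :|: up (x p).
  have [ue ve] := joins_at juv.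
  case: (joins_cases jp ue) => uE; rewrite uE in juv *; first by rewrite (joins_eq juv jp) setUC.
  by rewrite joinsC in jp; rewrite (joins_eq juv jp).
rewrite uvE -/RA in Bs cD.
have gne t : t < p -> g t != e.
  move=> tp; apply/eqP; rewrite -ge => /(frame_injg Fr (ltn_trans tp pn) pn) tE.
  by rewrite tE ltnn in tp.
have subA t : t < p -> branch F (g t) \subset A.
  move=> tp; rewrite bE.
  exact: branch_sub_side ne Fe (frame_side Fr (ltn_trans tp pn)) (gne t tp).
have secA t : t < p -> sector F x g t \subset ups A.
  by move=> tp; apply: (sector_sub_ups Fr) => //; [exact: ltn_trans tp pn|exact: subA].
have FAs : face_verts F \subset ups A.
  apply/subsetP => y yF; apply: (subsetP (verts_ups _)); apply/vertsP; by exists F.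
have xA i : i <= n -> x i \in ups A by move=> ni; apply: (subsetP FAs); exact: frame_vertex Fr ni.
have RAA : RA \subset ups A by apply: subset_trans (subsetIr _ _) (verts_ups _).
have upA i : i <= n -> up (x i) \subset ups A.
  move=> ni; apply/subsetP => y yi; apply/upsP; exists (x i) => //.
  by apply/vertsP; exists F => //; exact: frame_vertex Fr ni.
have IH t : t < p -> ntree (g t) -> extends_over m (g t) (branch F (g t)).
  move=> tp nt; have st := frame_side Fr (ltn_trans tp pn); apply: IHN => //.
    rewrite -ltnS; apply: leq_trans AN; rewrite bE.
    exact: branch_rim_proper ne Fe st (gne t tp).
  by apply: leq_trans rimA; rewrite leq_mul2l rim_sub // subA.
have outL t : t < p -> outer_part (branch F (g t)) \subset RA.
  by move=> tp; apply: setIS; apply: verts_sub; exact: subA.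
pose m0 := minn p k./2.
have m0p : m0 <= p by exact: geq_minl.
pose L1 := arc x 0 m0.+1 :|: RA; pose L2 := arc x m0 p.+1 :|: RA.
have L1c : #|L1| <= m0.+1 + (#|rim A| + 2).
  apply: leq_trans (leq_card_setU _ _) (leq_add _ RAc); rewrite -[X in _ <= X]subn0; exact: arc_card.
have L2c : #|L2| <= p.+1 - m0 + (#|rim A| + 2).
  by apply: leq_trans (leq_card_setU _ _) (leq_add (arc_card _ _ _) RAc).
have L1k : m0.+1 + (#|rim A| + 2) <= k + 3.
  by move: rimA; rewrite /m0; clear; lia.
have L2k : p.+1 - m0 + (#|rim A| + 2) <= k + 3.
  by move: rimA nk; rewrite /m0 -pSn; clear; lia.
have arcin lo hi i : lo <= i < hi -> x i \in arc x lo hi by move=> ih; apply/arcP; exists i.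
have B0c y : y \in covered D -> y \in ups A -> y \in up (x 0) :|: up (x p) :|: RA.
  by move=> yD yA; apply: (subsetP cD); rewrite in_setI yD.
pose B0 := up (x 0) :|: up (x p) :|: L1.
have ok0 : leaf_list m (B0 :: D).
  apply: (leaf_cons okD BD).
    apply/subsetP => y; rewrite in_setI => /andP[yB yD]; apply: (subsetP Bs).
    case/setUP: yB => [yx|/setUP[/arcP[i /andP[_ ii] yE]|yR]]; first by rewrite in_setU yx.
      2: by rewrite in_setU yR orbT.
    by apply: B0c => //; rewrite yE; apply: xA; move: ii m0p pn; clear; lia.
  have -> : B0 = up (x 0) :|: up (x p) :|: up (x p) :|: L1 by rewrite /B0 -[_ :|: up (x p) :|: up (x p)]setUA setUid.
  exact: fan_card L1c L1k.
have [|||||D1 [ok1 sub1 cov1 [Bm BmD Bms] [inv1 cv1]]] :=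
    @fan m F n x g FR Fr 0 m0 p L1 (B0 :: D) B0 (leq0n _) m0p (ltnW pn) ok0 (mem_head _ _) (subxx _).
- move=> t /andP[_ tp]; apply/subsetP => y; rewrite in_setI covered_cons in_setU => /andP[/orP[//|yD] yt].
  have := B0c y yD (subsetP (secA t tp) y yt); rewrite /L1 !in_setU => /orP[->//|->].
  by rewrite !orbT.
- move=> t /andP[_ tm]; apply: subset_trans (subsetUr _ _); apply: outL.
  exact: leq_trans tm m0p.
- move=> t /andP[_ tm]; rewrite /L1.
  exact: (arc_ups_branch _ FR Fr (ltn_trans (leq_trans tm m0p) pn) (leqW (leq_ltn_trans m0p pn)) RAV).
- by move=> t _; exact: fan_card L1c L1k.
- by move=> t /andP[_ tm]; apply: IH; exact: leq_trans tm m0p.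
pose Z := up (x m0) :|: up (x p) :|: (face_verts F :|: RA).
have FZ : face_verts F \subset Z by apply: subset_trans (subsetUr _ _); exact: subsetUl.
have ok2 : leaf_list m (Z :: D1).
  apply: (leaf_cons ok1 BmD).
    apply/subsetP => y; rewrite in_setI => /andP[yZ yD]; apply: (subsetP Bms).
    case/setUP: yZ => [yx|/setUP[/(frame_vert Fr)[i ni yE]|yR]]; first by rewrite in_setU yx.
      2: by rewrite /L1 !in_setU yR !orbT.
    have [im|mi] := leqP i m0; first by rewrite /L1 !in_setU -yE arcin ?orbT.
    have [ip|ip] := ltnP i p.
      apply: (subsetP (inv1 i _)); first by rewrite ltnW.
      by rewrite in_setI yD -yE; apply: (subsetP (sector_vertex _ _ _ _)); exact: up_refl.
    have -> : y = x p by rewrite -yE; congr x; move: ip ni; rewrite -pSn; clear; lia.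
    by rewrite !in_setU up_refl orbT.
  apply: leq_trans (cardU_le (cardU_le (up_card _) (up_card _)) (cardU_le (face_card F) RAc)) _.
  by move: rimA m_fan m_hub; clear; lia.
have back i t y : i < m0 -> m0 <= t < p -> y \in up (x i) -> y \in sector F x g t ->
    y \in up (x m0) :|: up (x p).
  move=> im /andP[mt tp] yi yt.
  have ys := subsetP (sector_vertex F x g i) y yi.
  exact: (chord FR Fr im mt tp (ltnW pn) ys yt).
have [||||||D2 [ok3 sub3 cov3 _ [_ cv3]]] :=
    @fan m F n x g FR Fr m0 p p L2 (Z :: D1) Z m0p (leqnn p) (ltnW pn) ok2 (mem_head _ _).
- apply: setUS; apply: setSU; apply/subsetP => y /arcP[i /andP[_ ip] ->].
  by apply: (frame_vertex Fr); move: ip pn; clear; lia.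
- move=> t tp; apply/subsetP => y; rewrite in_setI covered_cons in_setU => /andP[yc yt].
  have arc_case i : i < n -> y = x i -> y \in up (x m0) :|: up (x p) :|: L2.
    move=> ni yE; have [im|mi] := ltnP i m0.
      by rewrite in_setU (back i t y) // yE; exact: up_refl.
    by rewrite /L2 !in_setU yE arcin ?orbT // mi /=; move: ni; rewrite -pSn.
  have RA_case : y \in RA -> y \in up (x m0) :|: up (x p) :|: L2.
    by move=> yR; rewrite /L2 !in_setU yR !orbT.
  case/orP: yc => [/setUP[yx|/setUP[/(frame_vert Fr)[i ni /esym]|]]|yD].
  - by rewrite in_setU yx.
  - exact: arc_case.
  - exact: RA_case.
  have : y \in up (x m0) :|: up (x p) :|: L1 by apply: (subsetP (inv1 t tp)); rewrite in_setI yD.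
  case/setUP => [yx|/setUP[/arcP[i /andP[_ im]]|]]; last exact: RA_case.
    by rewrite in_setU yx.
  by apply: arc_case; move: im m0p pn; clear; lia.
- by move=> t /andP[_ tp]; apply: subset_trans (subsetUr _ _); exact: outL.
- by move=> t /andP[_ tp]; exact: (arc_ups_branch _ FR Fr (ltn_trans tp pn) (leqW pn) RAV).
- by move=> t _; exact: fan_card L2c L2k.
- by move=> t /andP[_ tp]; exact: IH.
have D1D2 : {subset D1 <= D2} by move=> C CD; apply: sub3; rewrite in_cons CD orbT.
exists D2; split=> //.
- by move=> C CD; apply: D1D2; apply: sub1; rewrite in_cons CD orbT.
- have arcA lo hi : hi <= n.+1 -> arc x lo hi \subset ups A.
    by move=> hn; apply/subsetP => y /arcP[i /andP[_ ih] ->]; apply: xA; rewrite -ltnS (leq_trans ih).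
  have L1A : L1 \subset ups A by rewrite subUset arcA //; move: m0p pn; clear; lia.
  have L2A : L2 \subset ups A by rewrite subUset arcA //; move: pn; clear; lia.
  have bigA lo hi : hi <= p -> \bigcup_(i < n | lo <= i < hi) sector F x g i \subset ups A.
    by move=> hp; apply/bigcupsP => i /andP[_ ih]; apply: secA; exact: leq_trans ih hp.
  have m0n : m0 <= n := ltnW (leq_ltn_trans m0p pn).
  have cD1 y : y \in covered D1 -> y \in covered D :|: ups A.
    move=> /(subsetP cov1); rewrite covered_cons in_setU [y \in _ :|: ups A]in_setU.
    case/orP => [/setUP[/setUP[/setUP[]|]|->//]|/setUP[/setUP[]|]].
    - by move=> /(subsetP (upA 0 isT)) ->; rewrite orbT.
    - by move=> /(subsetP (upA p (ltnW pn))) ->; rewrite orbT.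
    - by move=> /(subsetP L1A) ->; rewrite orbT.
    - by move=> /(subsetP (upA p (ltnW pn))) ->; rewrite orbT.
    - by move=> /(subsetP L1A) ->; rewrite orbT.
    - by move=> /(subsetP (bigA 0 m0 m0p)) ->; rewrite orbT.
  apply/subsetP => y /(subsetP cov3); rewrite covered_cons in_setU.
  case/orP => [/setUP[/setUP[/setUP[]|/setUP[]]|]|/setUP[/setUP[]|]]; last 4 first.
  - exact: cD1.
  - by move=> /(subsetP (upA p (ltnW pn))); rewrite in_setU orbC => ->.
  - by move=> /(subsetP L2A); rewrite in_setU orbC => ->.
  - by move=> /(subsetP (bigA m0 p (leqnn p))); rewrite in_setU orbC => ->.
  - by move=> /(subsetP (upA m0 m0n)); rewrite in_setU orbC => ->.
  - by move=> /(subsetP (upA p (ltnW pn))); rewrite in_setU orbC => ->.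
  - by move=> /(subsetP FAs); rewrite in_setU orbC => ->.
  - by move=> /(subsetP RAA); rewrite in_setU orbC => ->.
- move=> h hA; have : h \in side e F by rewrite -bE.
  move=> /cotree_side_cases[->|[c [Fc ce hc]]]; first by exists Z => //; apply: sub3; exact: mem_head.
  have [t tn gt] := frame_edge Fr Fc; rewrite -gt in hc.
  have tp : t < p by apply: lt_pred => //; apply: contra ce => /eqP tE; rewrite -ge -gt tE.
  have [tm|mt] := ltnP t m0; last by apply: (cv3 t) => //; rewrite mt.
  by have [|C CD hC] := cv1 t h _ hc; [exact: tm|exists C => //; exact: D1D2].
Qed.

Lemma rim_disjoint (A B : {set Phi}) : [disjoint A & B] -> #|rim A| + #|rim B| <= #|VR|.
Proof.
move=> AB; apply: leq_trans outer_edges.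
rewrite -(eqP (_ : #|rim A :|: rim B| == #|rim A| + #|rim B|)).
  by apply/subset_leq_card/subsetP => c; rewrite !inE => /orP[] /andP[].
rewrite (leq_card_setU _ _).2; apply/pred0P => c /=; rewrite !inE.
apply/negP => /andP[/andP[_ cA] /andP[_ cB]].
by have := disjointFr AB cA; rewrite cB.
Qed.

Lemma other_other f e : dat f e -> other (other f e) e = f.
Proof.
move=> fe; apply: other_eq => //; first exact: other_edge.
by rewrite eq_sym; exact: other_neq.
Qed.

Lemma centroid : exists2 F, F != R0 & forall b, dat F b -> 2 * #|rim (branch F b)| <= k.
Proof.
pose heavy (a : Phi * edge G) := dat a.1 a.2 && (k < 2 * #|rim (branch a.1 a.2)|).
have [a ha|none] := pickP heavy; last first.
  exists (other R0 eR); first exact: other_neq.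
  move=> b Fb; rewrite leqNgt; have := none (other R0 eR, b).
  by rewrite /heavy /= Fb => /negbT.
case: (arg_minnP (fun a : Phi * edge G => #|branch a.1 a.2|) ha) => -[f e] /andP[/= fe he] min.
have ne : ntree e.
  apply: contraTT he => ne; rewrite -leqNgt (_ : rim (branch f e) = set0) ?cards0 ?muln0 //.
  by apply/setP => c; rewrite !inE /branch (negbTE ne) inE andbF.
exists (other f e); first exact: ntree_other ne fe.
have Fe := other_edge fe; have bE := branchE f ne.
move=> b Fb; have [->|be] := eqVneq b e.
  have : #|rim (branch f e)| + #|rim (branch (other f e) e)| <= k.
    apply: leq_trans (face_card R0); apply: rim_disjoint; rewrite bE (branchE _ ne) other_other //.
    apply/pred0P => h /=; rewrite !inE; apply/negP => /andP[c1 c2].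
    have := ntree_bridge ne (otherP fe).
    by rewrite (@linked_connect_sym Gd) in c2; rewrite (@linked_connect_sym Gd) (connect_trans c1 c2).
  by move: he; clear; lia.
rewrite leqNgt; apply/negP => hb; have := min (other f e, b); rewrite /heavy /= Fb hb => /(_ isT).
by rewrite leqNgt bE (branch_rim_proper ne Fe Fb be).
Qed.

Lemma sum_succ lo hi (w : nat -> nat) :
  \sum_(lo <= t < hi) (w t).+1 = hi - lo + \sum_(lo <= t < hi) w t.
Proof.
by under eq_bigr do rewrite -add1n; rewrite big_split /= sum_nat_const_nat muln1.
Qed.

Lemma face_leaf_list : exists2 D, leaf_list m D &
  forall f, exists2 B, B \in D & face_verts f \subset B.
Proof.
have [F FR cF] := centroid.
have [b0 Fb0] : exists b : edge G, dat F b.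
  have [b [w [_ j _ _]]] := first_edge (dual_conn F R0) FR.
  by exists b; have [] := joins_at j.
have [n [x0 [g0 [Fr0 _]]]] := frame_exists Fb0.
have n0 : 0 < n := ltnW (frame_gt1 Fr0).
have nk : n <= k by rewrite (frame_card Fr0).
have sk : \sum_(0 <= t < n) #|charge F (g0 t)| <= k := leq_trans (charge_sum FR Fr0) (face_card R0).
have [r [j [rn jn le1 le2]]] := balanced_rotation n0 nk sk.
pose x i := x0 ((i + r) %% n); pose g i := g0 ((i + r) %% n).
have Fr : frame F n x g := frame_rot Fr0 rn.
have {}le1 : j + \sum_(0 <= t < j) #|charge F (g t)| <= k.+1.
  by have := sum_succ 0 j (fun t => #|charge F (g t)|); rewrite subn0 => <-.
have {}le2 : n - j + \sum_(j <= t < n) #|charge F (g t)| <= k.+1.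
  by rewrite -(sum_succ j n (fun t => #|charge F (g t)|)).
pose Z := up (x 0) :|: up (x j) :|: (face_verts F :|: VR).
have okZ : leaf_list m [:: Z].
  apply: leaf_one.
  apply: leq_trans (cardU_le (cardU_le (up_card _) (up_card _)) (cardU_le (face_card F) (face_card R0))) _.
  by move: m_hub; clear; lia.
have ext t : t < n -> ntree (g t) -> extends_over m (g t) (branch F (g t)).
  by move=> tn nt; have st := frame_side Fr tn; apply: branch_extends => //; exact: cF.
have arcin lo hi i : lo <= i < hi -> x i \in arc x lo hi by move=> ih; apply/arcP; exists i.
pose S lo hi := arc_sectors F x g lo hi.
pose L1 := arc x 0 j :|: S 0 j; pose L2 := arc x j n :|: S j n.
have SV lo hi : S lo hi \subset VR by exact: subsetIl.
have outS lo hi t : lo <= t < hi -> outer_part (branch F (g t)) \subset S lo hi.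
  move=> tl; apply/subsetP => y; rewrite in_setI => /andP[yR yb]; apply/arc_sectorsP; split=> //.
  exists t => //; apply: (subsetP (sector_branch F x g t)).
  exact: (subsetP (verts_ups _)).
have L1c : #|L1| <= k + 3.
  apply: leq_trans (cardU_le (arc_card _ _ _) (arc_sectors_card FR Fr (leq0n j) jn isT)) _.
  by move: le1; clear; lia.
have L2c : #|L2| <= k + 3.
  have jnE : (j == 0) || (n == n) by rewrite eqxx orbT.
  apply: leq_trans (cardU_le (arc_card _ _ _) (arc_sectors_card FR Fr jn (leqnn n) jnE)) _.
  by move: le2; clear; lia.
have xn : x n = x 0 := frame_close Fr.
have xF i : i <= n -> x i \in face_verts F by exact: frame_vertex Fr.
have xs i : x i \in sector F x g i.
  by apply: (subsetP (sector_vertex F x g i)); exact: up_refl.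
have [||||||D1 [ok1 sub1 cov1 _ [_ cv1]]] :=
    @fan m F n x g FR Fr 0 j j L1 [:: Z] Z (leq0n _) (leqnn j) jn okZ (mem_head _ _).
- apply: setUS; rewrite /L1 subUset (subset_trans (SV _ _)) ?subsetUr // andbT.
  apply: subset_trans (subsetUl _ _); apply/subsetP => y /arcP[i /andP[_ ij] ->].
  by apply: xF; exact: ltnW (leq_trans ij jn).
- move=> t /andP[_ tj]; apply/subsetP => y; rewrite in_setI => /andP[/coveredP[B]].
  rewrite mem_seq1 => /eqP -> /setUP[yx|/setUP[/(frame_vert Fr)[i ni yE]|yR]] yt.
  + by rewrite in_setU yx.
  + have [ij|ji] := ltnP i j; first by rewrite /L1 -yE !in_setU (arcin 0 j i) ?orbT.
    rewrite -yE in yt *.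
    by rewrite in_setU -xn setUC (chord FR Fr tj ji ni (leqnn n) yt (xs i)).
  + rewrite /L1 !in_setU; apply/orP; right; apply/orP; right.
    by apply/arc_sectorsP; split=> //; exists t.
- move=> t tj; apply: subset_trans (outS _ _ _ tj) (subsetUr _ _).
- move=> t /andP[_ tj]; exact: arc_ups_branch _ FR Fr (leq_trans tj jn) (leqW jn) (SV _ _).
- by move=> t _; apply: fan_card L1c (leqnn _).
- by move=> t /andP[_ tj]; apply: ext; exact: leq_trans tj jn.
have ZD1 : Z \in D1 by apply: sub1; exact: mem_head.
have [||||||D2 [ok2 sub2 _ _ [_ cv2]]] :=
    @fan m F n x g FR Fr j n n L2 D1 Z jn (leqnn n) (leqnn n) ok1 ZD1.
- rewrite xn setUC [_ :|: up (x 0)]setUC setUC; apply: setUS; rewrite /L2 subUset (subset_trans (SV _ _)) ?subsetUr // andbT.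
  apply: subset_trans (subsetUl _ _); apply/subsetP => y /arcP[i /andP[_ ij] ->].
  by apply: xF; exact: ltnW.
- move=> t /andP[jt tn]; apply/subsetP => y; rewrite in_setI => /andP[yD yt].
  have hub : y \in up (x j) :|: up (x n) -> y \in up (x j) :|: up (x n) :|: L2 by move=> h; rewrite in_setU h.
  have before i : i < j -> y \in sector F x g i -> y \in up (x j) :|: up (x n) :|: L2.
    by move=> ij yi; apply: hub; exact: (chord FR Fr ij jt tn (leqnn n) yi yt).
  have onF i : i < n -> y = x i -> y \in up (x j) :|: up (x n) :|: L2.
    move=> ni yE; have [ij|ji] := ltnP i j; first by apply: (before i) => //; rewrite yE.
    by rewrite /L2 yE !in_setU arcin ?orbT // ji.
  have onV : y \in VR -> y \in up (x j) :|: up (x n) :|: L2.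
    move=> yR; rewrite /L2 !in_setU; apply/orP; right; apply/orP; right.
    by apply/arc_sectorsP; split=> //; exists t => //; rewrite jt.
  have onj : y \in up (x j) -> y \in up (x j) :|: up (x n) :|: L2.
    by move=> yj; apply: hub; rewrite in_setU yj.
  case/setUP: (subsetP cov1 y yD) => [/coveredP[B]|/setUP[/setUP[//|/setUP[]]|]].
  + rewrite mem_seq1 => /eqP -> /setUP[/setUP[y0|]|/setUP[/(frame_vert Fr)[i ni yE]|]] //.
      by apply: hub; rewrite in_setU xn y0 orbT.
    exact: (onF i).
  + by move=> /arcP[i /andP[_ ij]]; apply: onF; exact: leq_trans ij jn.
  + by move=> /(subsetP (SV _ _)); exact: onV.
  + by move=> /bigcupP[i /andP[_ ij]]; exact: before.
- move=> t tj; apply: subset_trans (outS _ _ _ tj) (subsetUr _ _).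
- move=> t /andP[_ tn]; exact: arc_ups_branch _ FR Fr tn (leqnSn n) (SV _ _).
- by move=> t _; apply: fan_card L2c (leqnn _).
- by move=> t /andP[_ tn]; apply: ext.
exists D2 => // f; have [->|fR] := eqVneq f R0.
  by exists Z; [exact: sub2|apply: subset_trans (subsetUr _ _); exact: subsetUr].
have [->|fF] := eqVneq f F.
  by exists Z; [exact: sub2|apply: subset_trans (subsetUr _ _); exact: subsetUl].
have [b Fb fb] := branch_cover FR fR fF; have [t tn gt] := frame_edge Fr Fb; rewrite -gt in fb.
have [tj|jt] := ltnP t j; last by apply: (cv2 t) => //; rewrite jt.
by have [|B BD fB] := cv1 t f _ fb; [rewrite tj|exists B => //; exact: sub2].
Qed.

End CombinatorialDual.

Lemma bigminn_le (I : eqType) (r : seq I) (P : pred I) (f : I -> nat) N i :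
  i \in r -> P i -> \big[minn/N]_(j <- r | P j) f j <= f i.
Proof.
elim: r => // j r IH; rewrite in_cons big_cons => /orP[/eqP <- ->|/IH ir Pi].
  exact: geq_minl.
by case: ifP => _; rewrite ?ir // geq_min ir // orbT.
Qed.

Section Distances.
Variable G : multigraph.
Implicit Types (u v w : vertex G) (S : {set vertex G}).

Lemma dist_path u v : connect (adj G) u v -> (dist u v < #|vertex G|) /\ path_of_length u v (dist u v).
Proof.
move=> /connectP[p0 /shortenP[p pp up _] vE].
have pN : size p < #|vertex G| by have := max_card (mem (u :: p)); rewrite (card_uniqP up).
have h : has (path_of_length u v) (iota 0 #|vertex G|).
  apply/hasP; exists (size p); first by rewrite mem_iota.
  by apply/existsP; exists (in_tuple p); apply/and3P; split=> //; rewrite -vE.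
have := nth_find 0 h; rewrite has_find size_iota in h.
by rewrite nth_iota // add0n.
Qed.

Lemma dist_le u v n : n < #|vertex G| -> path_of_length u v n -> dist u v <= n.
Proof.
move=> nN uv; rewrite leqNgt; apply/negP => /(before_find 0).
by rewrite nth_iota // add0n uv.
Qed.

Lemma dist_to_le S u v : u \in S -> dist_to S v <= dist u v.
Proof. by move=> uS; apply: bigminn_le => //; exact: mem_index_enum. Qed.

Lemma dist_to_attained S v : dist_to S v = #|vertex G| \/ exists2 u, u \in S & dist_to S v = dist u v.
Proof.
rewrite /dist_to; elim/big_rec: _ => [|u x uS IH]; first by left.
have [_|_] := leqP (dist u v) x; first by right; exists u.
exact: IH.
Qed.

Lemma closer_neighbour S v : (forall u w, connect (adj G) u w) -> S != set0 -> v \notin S ->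
  exists e w, joins e v w /\ dist_to S w < dist_to S v.
Proof.
move=> cG /set0Pn[u0 u0S] vS.
have [vN|[u uS uE]] := dist_to_attained S v.
  by have := leq_ltn_trans (dist_to_le v u0S) (dist_path (cG u0 v)).1; rewrite vN ltnn.
have [dN /existsP[p /and3P[pp /eqP lp up]]] := dist_path (cG u v).
rewrite uE; case/lastP: {p}(tval p) (size_tuple p) pp lp up => [|q z]; first by move=> _ _ /= uv; rewrite -uv uS in vS.
rewrite size_rcons last_rcons => sz; rewrite rcons_path => /andP[pq aw] zv.
rewrite -rcons_cons rcons_uniq => /andP[_ uq]; rewrite zv in aw.
have /existsP[e je] := aw; exists e, (last u q); split; first by rewrite joinsC.
apply: leq_ltn_trans (dist_to_le _ uS) _; rewrite -sz ltnS; apply: dist_le.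
  by apply: leq_ltn_trans dN; rewrite -sz.
by apply/existsP; exists (in_tuple q); apply/and3P; split.
Qed.

End Distances.

Lemma adj_connected (G : multigraph) : two_connected G -> forall u v : vertex G, connect (adj G) u v.
Proof.
case=> [[_ cG] _ _] u v; have := cG u v; rewrite !in_setT => /(_ isT isT).
by apply: connect_sub => x y /and3P[_ _ a]; exact: connect1.
Qed.

Theorem dual_decomposition (G : multigraph) (Phi : finType) (lf rf : edge G -> Phi)
    (G_loopless : loopless G) (G_2connected : two_connected G)
    (dual_conn : forall f g : Phi, connect (@linked (dual lf rf) predT) f g)
    (duality : forall (S : pred (edge G)) e, ~~ S e ->
      connect (linked S) (tail_end e) (head_end e) =
      ~~ connect (@linked (dual lf rf) (fun x => ~~ S x && (x != e))) (lf e) (rf e))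
    (R0 : Phi) (d k : nat) :
  (exists e : edge G, @at_vertex (dual lf rf) R0 e) ->
  (forall v, dist_to (face_verts lf rf R0) v <= d) ->
  (forall f, #|face_verts lf rf f| <= k) ->
  exists TD : tree_decomposition G, width TD <= maxn (3 * d + k + 5) (2 * d + 2 * k + 1) /\
    forall f, exists x : node TD, face_verts lf rf f \subset bag x.
Proof.
move=> [eR ReR] dd kk; set VR := face_verts lf rf R0 in dd.
have VR0 : VR != set0.
  by apply/set0Pn; exists (tail_end eR); apply/face_vertsP; exists eR; rewrite // /at_vertex eqxx.
pose rk := dist_to VR.
have next v : {a : vertex G * edge G | v \notin VR -> joins a.2 v a.1 && (rk a.1 < rk v)}.
  have [vR|vR] := boolP (v \in VR); first by exists (v, eR).
  have : exists a : vertex G * edge G, joins a.2 v a.1 && (rk a.1 < rk v).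
    have [e [w [j lt]]] := closer_neighbour (adj_connected G_2connected) VR0 vR.
    by exists (w, e); rewrite /= j.
  by move=> ex; exists (xchoose ex) => _; exact: (xchooseP ex).
pose par v := if v \in VR then v else (sval (next v)).1.
pose pe v := (sval (next v)).2.
have par_root v : v \in VR -> par v = v by rewrite /par; case: ifP.
have pe_joins v : v \notin VR -> joins (pe v) v (par v).
  by move=> vR; have := svalP (next v) vR; rewrite /par ifN // => /andP[].
have rk_par v : v \notin VR -> rk (par v) < rk v.
  by move=> vR; have := svalP (next v) vR; rewrite /par ifN // => /andP[].
have up_rk v : #|up par v| <= (rk v).+1.
  elim/(forest_ind rk_par): v => v IH; have [vR|vR] := boolP (v \in VR).
    by rewrite (up_root par_root vR) cards1.
  rewrite (up_step par vR) cardsU1.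
  apply: leq_trans (leq_add (leq_b1 _) (IH vR)) _; rewrite add1n ltnS; exact: rk_par.
have up_card v : #|up par v| <= d.+1 by apply: leq_trans (up_rk v) _; rewrite ltnS dd.
pose m := (maxn (3 * d + k + 5) (2 * d + 2 * k + 1)).+1.
have m1 : 3 * d + k + 6 <= m by rewrite /m; clear; lia.
have m2 : 2 * d + 2 * k + 2 <= m by rewrite /m; clear; lia.
have [D okD cD] := face_leaf_list G_loopless G_2connected dual_conn duality par_root pe_joins
  rk_par ReR up_card kk m1 m2.
have cov v : v \in covered D.
  have [e ve] := incident_exists G_2connected v.
  have [B BD fB] := cD (lf e); apply/coveredP; exists B => //; apply: (subsetP fB).
  by apply/face_vertsP; exists e => //; rewrite /at_vertex eqxx.
have [|TD [wTD bTD]] := leaf_list_decomposition okD cov.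
  move=> e; have [B BD fB] := cD (lf e); exists B => //.
  by apply/andP; split; apply: (subsetP fB); apply/face_vertsP; exists e; rewrite // /at_vertex eqxx ?orbT.
exists TD; split; first by move: wTD; rewrite /m subn1.
by move=> f; have [B /bTD[x xB] fB] := cD f; exists x; rewrite xB.
Qed.

From mathcomp Require Import all_boot all_order all_algebra.
From mathcomp Require Import ring lra zify.
From mathcomp Require Import boolp classical_sets functions cardinality reals topology normedtype.
From mathcomp Require Import interval_inference prodnormedzmodule realfun trigo numfun.
Import Order.TTheory GRing.Theory Num.Theory numFieldNormedType.Exports.

(** * Continuous angles in the plane *)

Section Directions.
Local Open Scope classical_set_scope.
Local Open Scope ring_scope.
Context {R : realType}.
Notation pl := (plane R).
Implicit Types a b c w : pl.

Definition cmul a b : pl := (a.1 * b.1 - a.2 * b.2, a.1 * b.2 + a.2 * b.1).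
Definition cconj a : pl := (a.1, - a.2).
Definition cexp (t : R) : pl := (cos t, sin t).

(* t is an argument of w. *)
Definition dir w (t : R) := exists2 r : R, 0 < r & w = (r * cos t, r * sin t).

Lemma dir_cmul a b s t : dir a s -> dir b t -> dir (cmul a b) (s + t).
Proof.
move=> [r r0 ->] [q q0 ->]; exists (r * q); first exact: mulr_gt0.
by rewrite /cmul /= cosD sinD; congr pair; ring.
Qed.

Lemma dir_cconj a t : dir a t -> dir (cconj a) (- t).
Proof. by move=> [r r0 ->]; exists r => //; rewrite cosN sinN /cconj /= mulrN. Qed.

Lemma dir_cexp t : dir (cexp t) t.
Proof. by exists 1 => //; rewrite !mul1r. Qed.

Lemma dir_scale (r : R) a t : 0 < r -> dir a t -> dir (r * a.1, r * a.2) t.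
Proof. by move=> r0 [q q0 ->]; exists (r * q); [exact: mulr_gt0|rewrite /= !mulrA]. Qed.

Lemma dir_opp a t : dir a t -> dir (- a) (t + pi).
Proof.
move=> [r r0 ->]; exists r => //; rewrite cosDpi sinDpi !mulrN.
by [].
Qed.

Lemma cos1_2pi (t : R) : cos t = 1 -> exists n : int, t = n%:~R * (pi *+ 2).
Proof.
move=> ct; pose p : R := pi *+ 2.
have p0 : 0 < p by rewrite /p mulr2n addr_gt0 ?pi_gt0.
have cp n u : cos (u + n%:~R * p) = cos u :> R.
  case: n => n; first by rewrite -pmulrn mulr_natl (periodicn (@cosD2pi R)).
  rewrite NegzE mulrNz mulNr -[in RHS](subrK (n.+1%:~R * p) u).
  by rewrite -pmulrn mulr_natl (periodicn (@cosD2pi R)).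
pose m := Num.floor (t / p + 2^-1).
pose u := t - m%:~R * p.
have cu : cos u = 1 by rewrite -ct -[in RHS](subrK (m%:~R * p) t) cp.
have /andP[lo hi] : - pi <= u <= pi.
  have /andP[m1 m2] := mem_rg1_floor (t / p + 2^-1).
  rewrite -/m in m1 m2.
  have pE : pi = p / 2 :> R by rewrite /p mulr2n; field.
  have tE : t = t / p * p by rewrite divfK // gt_eqF.
  rewrite /u pE tE; set y := t / p in m1 m2 *.
  apply/andP; split; rewrite -subr_ge0.
    have -> : y * p - m%:~R * p - - (p / 2) = (y + 2^-1 - m%:~R) * p by field.
    by rewrite mulr_ge0 ?(ltW p0) // subr_ge0.
  have -> : p / 2 - (y * p - m%:~R * p) = (m%:~R + 1 - (y + 2^-1)) * p by field.
  by rewrite mulr_ge0 ?(ltW p0) // subr_ge0 ltW.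
have u0 : u = 0.
  have pi0 := @pi_ge0 R.
  case: (leP 0 u) => u0.
    apply: cos_inj; rewrite ?in_itv /= ?lexx ?u0 ?hi ?pi0 //.
    by rewrite cos0.
  apply/oppr_inj; rewrite oppr0.
  apply: cos_inj; rewrite ?in_itv /= ?lexx ?pi0 //.
    by rewrite oppr_ge0 ltW //= lerNl.
  by rewrite cosN cos0.
by exists m; apply/eqP; rewrite -subr_eq0 -/u u0.
Qed.

Lemma dir_unique w s t : dir w s -> dir w t ->
  exists n : int, s - t = n%:~R * (pi *+ 2).
Proof.
move=> [r r0 ->] [q q0 [e1 e2]]; apply: cos1_2pi.
have rq : r = q.
  have: r ^+ 2 = q ^+ 2.
    rewrite -[LHS]mulr1 -[RHS]mulr1 -{1}(cos2Dsin2 s) -(cos2Dsin2 t).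
    by rewrite !mulrDr -!exprMn e1 e2.
  by move=> /eqP; rewrite eqrXn2 ?ltW // => /eqP.
have r0' : r != 0 by rewrite gt_eqF.
move: e1 e2; rewrite -rq => /(mulfI r0') c /(mulfI r0') d.
by rewrite cosB c d -!expr2 cos2Dsin2.
Qed.

Lemma dir_shift w s (n : int) : dir w s -> dir w (s + n%:~R * (pi *+ 2)).
Proof.
move=> [r r0 ->]; exists r => //.
suff [-> ->] : cos (s + n%:~R * (pi *+ 2)) = cos s /\
  sin (s + n%:~R * (pi *+ 2)) = sin s by [].
case: n => n.
  by rewrite -pmulrn mulr_natl; split; [exact: (periodicn (@cosD2pi R))|exact: (periodicn (@sinD2pi R))].
rewrite NegzE mulrNz mulNr -pmulrn mulr_natl; set q := _ *+ n.+1.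
split; apply/esym; rewrite -[in LHS](subrK q s).
  exact: (periodicn (@cosD2pi R)).
exact: (periodicn (@sinD2pi R)).
Qed.

Definition arg w : R := atan (w.2 / w.1).

Lemma dir_arg w : 0 < w.1 -> dir w (arg w).
Proof.
move=> w0; exists (w.1 / cos (arg w)).
  rewrite divr_gt0 // cos_gt0_pihalf // /arg.
  by rewrite atan_gtNpi2 atan_ltpi2.
have c0 : cos (arg w) != 0.
  by rewrite gt_eqF // cos_gt0_pihalf // /arg atan_gtNpi2 atan_ltpi2.
have : tan (arg w) = w.2 / w.1 by rewrite /arg atanK.
rewrite /tan => e; rewrite mulfVK //.
case: w w0 c0 e => x y /= x0 c0 e; congr pair.
by rewrite -mulrA [_ ^-1 * _]mulrC e mulrC divfK // gt_eqF.
Qed.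

Lemma dir_exists w : w != 0 -> exists t, dir w t.
Proof.
move=> w0; have [p|n|z] := ltgtP 0 w.1.
- by exists (arg w); exact: dir_arg.
- exists (arg (- w) + pi); rewrite -[w]opprK; apply: dir_opp.
  by rewrite opprK; apply: dir_arg; rewrite /= oppr_gt0.
- have [p|n|z2] := ltgtP 0 w.2.
  + exists (pi / 2), w.2 => //; rewrite cos_pihalf sin_pihalf mulr0 mulr1 z.
    by case: w {w0 p z}.
  + exists (pi / 2 + pi), (- w.2); rewrite ?oppr_gt0 //.
    rewrite cosDpi sinDpi cos_pihalf sin_pihalf oppr0 mulr0 mulrNN mulr1 z.
    by case: w {w0 n z}.
  + by move: w0; rewrite (surjective_pairing w) -z -z2 eqxx.
Qed.

Lemma dir_neq0 w t : dir w t -> w != 0.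
Proof.
move=> [r r0 ->]; apply/eqP => -[/eqP + /eqP].
rewrite !mulf_eq0 !(gt_eqF r0) /= => /eqP c /eqP s.
by have := cos2Dsin2 t; rewrite c s expr0n addr0 => /esym/eqP; rewrite oner_eq0.
Qed.

(* The m-th power of w up to a positive factor: conjugation replaces inversion. *)
Definition cpow w (m : int) : pl :=
  match m with
  | Posz n => iter n (cmul w) (1, 0)
  | Negz n => iter n.+1 (cmul (cconj w)) (1, 0)
  end.

Lemma dir_cpow w t m : dir w t -> dir (cpow w m) (m%:~R * t).
Proof.
have dn v s n : dir v s -> dir (iter n (cmul v) (1, 0)) (n%:R * s).
  move=> d; elim: n => [|n IH]; last by rewrite -natr1 addrC mulrDl mul1r; exact: dir_cmul.
  by rewrite mul0r; exists 1; rewrite // cos0 sin0 mulr0 mulr1.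
move=> d; case: m => n; first exact: dn.
by rewrite /cpow NegzE mulrNz mulNr -mulrN; apply: dn; exact: dir_cconj.
Qed.

Section Cvg.
Context {T : Type} {F : set_system T} {FF : Filter F}.

Lemma cvg_fst_of (f : T -> pl) a : f @ F --> a -> (fun x => (f x).1) @ F --> a.1.
Proof. by move=> fa; apply: (cvg_comp f fst fa); exact: cvg_fst. Qed.

Lemma cvg_snd_of (f : T -> pl) a : f @ F --> a -> (fun x => (f x).2) @ F --> a.2.
Proof. by move=> fa; apply: (cvg_comp f snd fa); exact: cvg_snd. Qed.

Lemma cvg_plane (f g : T -> R) a : f @ F --> a.1 -> g @ F --> a.2 ->
  (fun x => (f x, g x) : pl) @ F --> a.
Proof. by case: a => a1 a2 /= fa ga; exact: (@cvg_pair _ _ _ F (nbhs a1) (nbhs a2)). Qed.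

Lemma cvg_cmul (f g : T -> pl) a b : f @ F --> a -> g @ F --> b ->
  (fun x => cmul (f x) (g x)) @ F --> cmul a b.
Proof.
move=> fa gb; have f1 := cvg_fst_of fa; have f2 := cvg_snd_of fa.
have g1 := cvg_fst_of gb; have g2 := cvg_snd_of gb.
apply: cvg_plane => /=.
  by apply: cvgB; [exact: (cvgM f1 g1)|exact: (cvgM f2 g2)].
by apply: cvgD; [exact: (cvgM f1 g2)|exact: (cvgM f2 g1)].
Qed.

Lemma cvg_cconj (f : T -> pl) a : f @ F --> a ->
  (fun x => cconj (f x)) @ F --> cconj a.
Proof.
move=> fa; apply: cvg_plane => /=; first exact: (cvg_fst_of fa).
by apply: cvgN; exact: (cvg_snd_of fa).
Qed.

Lemma cvg_cexp (f : T -> R) t : f @ F --> t ->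
  (fun x => cexp (f x)) @ F --> cexp t.
Proof.
move=> ft; apply: cvg_plane.
  by apply: (cvg_comp f (@cos R) ft); exact: continuous_cos.
by apply: (cvg_comp f (@sin R) ft); exact: continuous_sin.
Qed.

Lemma cvg_cpow (f : T -> pl) a m : f @ F --> a ->
  (fun x => cpow (f x) m) @ F --> cpow a m.
Proof.
have dn (g : T -> pl) b n : g @ F --> b ->
    (fun x => iter n (cmul (g x)) (1, 0)) @ F --> iter n (cmul b) (1, 0).
  by move=> gb; elim: n => [|n IH]; [exact: cvg_cst|exact: cvg_cmul].
by move=> fa; case: m => n; [exact: dn|exact: (dn _ _ _ (cvg_cconj fa))].
Qed.

Lemma cvg_arg (f : T -> pl) a : 0 < a.1 -> f @ F --> a ->
  (fun x => arg (f x)) @ F --> arg a.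
Proof.
move=> a0 fa.
apply: (cvg_comp (fun x => (f x).2 / (f x).1) (@atan R)); last exact: continuous_atan.
apply: cvgM; first exact: cvg_snd_of.
by apply: cvgV; [rewrite gt_eqF|exact: cvg_fst_of].
Qed.

End Cvg.
End Directions.

Section Lifting.
Local Open Scope classical_set_scope.
Local Open Scope ring_scope.
Context {R : realType}.
Notation pl := (plane R).

Lemma within_cvgP (T U : topologicalType) (A : set T) (f : T -> U) :
  {within A, continuous f} <->
  (forall x, A x -> f @ within A (nbhs x) --> f x).
Proof. exact: subspace_continuousP. Qed.

Lemma within_nbhsP (T U : topologicalType) (A : set T) (f : T -> U) :
  {within A, continuous f} <->
  (forall x P, A x -> nbhs (f x) P -> nbhs x (fun y => A y -> P (f y))).
Proof.
rewrite within_cvgP; split=> [h x P Ax nP|h x Ax P nP]; first exact: (h x Ax P nP).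
exact: (h x P Ax nP).
Qed.

Lemma within_comp (T U V : topologicalType) (A : set T) (B : set U)
    (f : T -> U) (g : U -> V) :
  {within A, continuous f} -> {within B, continuous g} ->
  (forall x, A x -> B (f x)) -> {within A, continuous (g \o f)}.
Proof.
move=> /within_nbhsP cf /within_nbhsP cg AB; apply/within_nbhsP => x P Ax nP.
have := cf _ _ Ax (cg _ _ (AB _ Ax) nP); apply: filterS => y h Ay.
by apply: h => //; exact: AB.
Qed.

Lemma dir_div (a b : pl) s t : dir (cmul a (cconj b)) s -> dir b t -> dir a (s + t).
Proof.
move=> [r r0 [e1 e2]] [q q0 be]; subst b; exists (r / q); first exact: divr_gt0.
have q0' : q != 0 by rewrite gt_eqF.
have cs := cos2Dsin2 t; rewrite /= in e1 e2.
have s1 : q * a.1 = r * cos (s + t).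
  rewrite cosD mulrBr !mulrA -e1 -e2 -[LHS]mulr1 -cs; ring.
have s2 : q * a.2 = r * sin (s + t).
  rewrite sinD mulrDr !mulrA -e1 -e2 -[LHS]mulr1 -cs; ring.
rewrite [a]surjective_pairing; congr pair; apply: (mulfI q0').
  by rewrite s1; field.
by rewrite s2; field.
Qed.

Lemma normsq_gt0 (w : pl) : w != 0 -> 0 < (cmul w (cconj w)).1.
Proof.
move=> w0; rewrite /= mulrN opprK -!expr2.
rewrite lt0r addr_ge0 ?sqr_ge0 // andbT paddr_eq0 ?sqr_ge0 // !sqrf_eq0.
by apply: contra w0 => /andP[/eqP a /eqP b]; rewrite [w]surjective_pairing a b.
Qed.

Lemma half_plane_nbhs (w : pl) : w != 0 ->
  exists2 B, nbhs w B & forall a b, B a -> B b -> 0 < (cmul a (cconj b)).1.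
Proof.
move=> w0.
have c : (fun p : pl * pl => (cmul p.1 (cconj p.2)).1) @ nbhs (w, w) -->
    (cmul w (cconj w)).1.
  apply: cvg_fst_of; apply: cvg_cmul; first exact: cvg_fst.
  by apply: cvg_cconj; exact: cvg_snd.
have [[B C] /= [nB nC] BC] := cvgr_gt _ c _ (normsq_gt0 w0).
exists (B `&` C); first exact: filterI.
by move=> a b [Ba _] [_ Cb]; exact: (BC (a, b)).
Qed.


Lemma star_uniform (V : normedModType R) (K : set V) (f : V -> pl) :
  compact K -> (forall z (s : R), K z -> 0 <= s <= 1 -> K (s *: z)) ->
  {within K, continuous f} -> (forall z, K z -> f z != 0) ->
  exists N : nat, forall z (j : nat), K z -> (j < N.+1)%N ->
    0 < (cmul (f ((j.+1%:R / N.+1%:R) *: z)) (cconj (f ((j%:R / N.+1%:R) *: z)))).1.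
Proof.
move=> cK sK cf f0.
have I01 (x : R) : `[0, 1]%classic x = (0 <= x <= 1) by rewrite /= in_itv.
pose A := K `*` (`[0, 1] : set R).
pose g (x : V * R) := f (x.2 *: x.1).
have cA : compact A by apply: compact_setX => //; exact: segment_compact.
have cg : {within A, continuous g}.
  apply: (@within_comp _ _ _ A K (fun x : V * R => x.2 *: x.1) f) => //.
    apply: continuous_subspaceT => x; apply: cvgZ; first exact: cvg_snd.
    exact: cvg_fst.
  by move=> [z s] [/= Kz]; rewrite in_itv /= => s01; exact: sK.
pose P (n : nat) (x : V * R) := A x -> forall s', 0 <= s' <= 1 ->
  `|x.2 - s'| <= n.+1%:R^-1 -> 0 < (cmul (g (x.1, s')) (cconj (g x))).1.
have : \forall n \near \oo, A `<=` P n.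
  have /compact_near_coveringP := cA; apply => -[z0 s0] Ax0.
  have w0 : g (z0, s0) != 0.
    by case: Ax0 => /= Kz; rewrite in_itv /= => s01; apply/f0/sK.
  have [B nB BP] := half_plane_nbhs w0.
  have /within_nbhsP/(_ _ _ Ax0 nB) := cg.
  rewrite nbhs_ballP => -[e /= e0 eB].
  have e20 : 0 < e / 2 by rewrite divr_gt0.
  have nn : \forall n \near \oo, n.+1%:R^-1 < e / 2.
    exact: (near_infty_natSinv_lt (PosNum e20)).
  exists (ball (z0, s0) (e / 2), [set n : nat | n.+1%:R^-1 < e / 2]).
    by split => //=; exact: nbhsx_ballx.
  move=> [[z s] n] /= [[bz bs] ne] Ax s' s'01 ss'.
  rewrite /= in ss' *.
  have [Kz s01] := Ax.
  apply: BP; apply: eB => //=.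
    split => /=; first by apply: le_ball bz; rewrite ler_piMr ?ltW // invf_lt1 // ltr1n.
    rewrite /ball /= in bs *.
    apply: (le_lt_trans (ler_distD s _ _)).
    rewrite [e in ltRHS](splitr e); apply: ltrD => //.
    by apply: le_lt_trans ne.
  split => /=; first by apply: le_ball bz; rewrite ler_piMr ?ltW // invf_lt1 // ltr1n.
  by apply: le_ball bs; rewrite ler_piMr ?ltW // invf_lt1 // ltr1n.
case=> N _ /(_ N (leqnn N)) AP; exists N => z j Kz jN.
have N0 : (0 : R) < N.+1%:R by rewrite ltr0n.
have fr i : (i <= N.+1)%N -> 0 <= (i%:R / N.+1%:R : R) <= 1.
  by move=> iN; apply/andP; split; [rewrite divr_ge0 ?ler0n|rewrite ler_pdivrMr // mul1r ler_nat].
have Ax : A (z, j%:R / N.+1%:R) by split => //=; rewrite in_itv /= fr // ltnW.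
have := AP _ Ax Ax (j.+1%:R / N.+1%:R) (fr _ jN); apply => /=.
by rewrite -mulrBl -natr1 opprD addNKr mulN1r normrN ger0_norm // invr_ge0 ler0n.
Qed.

Lemma lift_star (V : normedModType R) (K : set V) (f : V -> pl) :
  compact K -> (forall z (s : R), K z -> 0 <= s <= 1 -> K (s *: z)) ->
  {within K, continuous f} -> (forall z, K z -> f z != 0) ->
  exists theta : V -> R, {within K, continuous theta} /\
    forall z, K z -> dir (f z) (theta z).
Proof.
move=> cK sK cf f0.
have [[z0 Kz0]|K0] := pselect (K !=set0); last first.
  exists (fun=> 0); split; first by apply: continuous_subspaceT => x; exact: cvg_cst.
  by move=> z Kz; case: K0; exists z.
have K0 : K 0 by rewrite -(scale0r z0); apply: sK => //; rewrite lexx ler01.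
have [t0 t0P] := dir_exists (f0 _ K0).
have [N NP] := star_uniform cK sK cf f0.
have N0 : (0 : R) < N.+1%:R by rewrite ltr0n.
have fr i : (i <= N.+1)%N -> 0 <= (i%:R / N.+1%:R : R) <= 1.
  by move=> iN; apply/andP; split; [rewrite divr_ge0 ?ler0n|rewrite ler_pdivrMr // mul1r ler_nat].
suff: forall j, (j <= N.+1)%N -> exists theta : V -> R,
    {within K, continuous theta} /\
    forall z, K z -> dir (f ((j%:R / N.+1%:R) *: z)) (theta z).
  move=> /(_ N.+1 (leqnn _)) [th [cth thP]]; exists th; split=> // z Kz.
  by have := thP z Kz; rewrite divff ?gt_eqF // scale1r.
elim=> [_|j IH jN].
  exists (fun=> t0); split; first by apply: continuous_subspaceT => x; exact: cvg_cst.
  by move=> z Kz; rewrite mul0r scale0r.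
have [th [cth thP]] := IH (ltnW jN).
pose h i z := f ((i%:R / N.+1%:R) *: z).
exists (fun z => arg (cmul (h j.+1 z) (cconj (h j z))) + th z); split; last first.
  move=> z Kz; apply: (dir_div (b := h j z)); last exact: thP.
  by apply: dir_arg; exact: NP.
have ch i : (i <= N.+1)%N -> {within K, continuous (h i)}.
  move=> iN; apply: (@within_comp _ _ _ K K (fun z => (i%:R / N.+1%:R) *: z) f) => //.
    by apply: continuous_subspaceT => x; apply: cvgZ; [exact: cvg_cst|exact: cvg_id].
  by move=> z Kz; apply: sK => //; exact: fr.
apply/within_cvgP => z Kz; apply: cvgD; last by move/within_cvgP : cth; exact.
apply: cvg_arg; first exact: NP.
apply: cvg_cmul; first by move/within_cvgP: (ch _ jN); exact.
by apply: cvg_cconj; move/within_cvgP: (ch _ (ltnW jN)); exact.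
Qed.

End Lifting.

Section NoLog.
Local Open Scope classical_set_scope.
Local Open Scope ring_scope.
Context {R : realType}.
Notation pl := (plane R).

Lemma turns_constant (T : topologicalType) (A : set T) (h : T -> R) :
  connected A -> {within A, continuous h} ->
  (forall x, A x -> exists n : int, h x = n%:~R * (pi *+ 2)) ->
  forall x y, A x -> A y -> h x = h y.
Proof.
move=> cA ch hn.
have p0 : 0 < pi *+ 2 :> R by rewrite mulr2n addr_gt0 ?pi_gt0.
have iv : is_interval (h @` A).
  by apply/connected_intervalP/connected_continuous_connected.
suff le x y : A x -> A y -> h x < h y -> False.
  move=> x y Ax Ay; apply/eqP; case: (ltgtP (h x) (h y)) => // l.
    by case: (le _ _ Ax Ay l).
  by case: (le _ _ Ay Ax l).
move=> Ax Ay hxy; have [n nE] := hn _ Ax; have [k kE] := hn _ Ay.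
have nk : (n + 1 <= k) by move: hxy; rewrite nE kE ltr_pM2r // ltr_int lezD1.
have [z Az zE] : (h @` A) (h x + pi).
  apply: (iv (h x) (h y)); [by exists x|by exists y|].
  rewrite lerDl pi_ge0 /= nE kE.
  have : (n%:~R + 1) * (pi *+ 2) <= k%:~R * (pi *+ 2) :> R.
    by rewrite ler_pM2r // -[1](mulr1z 1) -intrD ler_int.
  by rewrite mulrDl mul1r; apply: le_trans; rewrite lerD2l mulr2n lerDl pi_ge0.
have [q qE] := hn _ Az.
have : (n%:~R + n%:~R + 1) * pi = (q%:~R + q%:~R) * pi :> R.
  have : h z = h x + pi by rewrite zE.
  rewrite qE nE mulr2n; lra.
have pn : pi != 0 :> R by rewrite gt_eqF // pi_gt0.
move/(mulIf pn)/eqP; rewrite -[1](mulr1z 1) -!intrD eqr_int => /eqP.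
by lia.
Qed.

Definition cunit (w : pl) : pl :=
  let r := (Num.sqrt (w.1 ^+ 2 + w.2 ^+ 2))^-1 in (r * w.1, r * w.2).

Lemma cunitE w t : dir w t -> cunit w = cexp t.
Proof.
move=> [r r0 ->]; rewrite /cunit /=.
rewrite !exprMn -mulrDr cos2Dsin2 mulr1 sqrtr_sqr ger0_norm ?ltW //.
by rewrite !mulrA mulVf ?gt_eqF // !mul1r.
Qed.

Lemma cvg_cunit (T : Type) (F : set_system T) {FF : Filter F} (f : T -> pl) (a : pl) :
  a != 0 -> f @ F --> a -> (fun x => cunit (f x)) @ F --> cunit a.
Proof.
move=> a0 fa; have f1 := cvg_fst_of fa; have f2 := cvg_snd_of fa.
have s0 : 0 < a.1 ^+ 2 + a.2 ^+ 2.
  by have := normsq_gt0 a0; rewrite /= mulrN opprK -!expr2.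
have cr : (fun x => (Num.sqrt ((f x).1 ^+ 2 + (f x).2 ^+ 2))^-1) @ F -->
   (Num.sqrt (a.1 ^+ 2 + a.2 ^+ 2))^-1.
  apply: cvgV; first by rewrite gt_eqF // sqrtr_gt0.
  apply: (cvg_comp (fun x => (f x).1 ^+ 2 + (f x).2 ^+ 2) (@Num.sqrt R)).
    by apply: cvgD; [exact: (cvgM f1 f1)|exact: (cvgM f2 f2)].
  exact: sqrt_continuous.
by apply: cvg_plane => /=; [exact: (cvgM cr f1)|exact: (cvgM cr f2)].
Qed.

Lemma square_star (r : R) : 0 < r ->
  let K := `[- r, r]%classic `*` `[- r, r]%classic : set pl in
  compact K /\ forall (z : pl) (s : R), K z -> 0 <= s <= 1 -> K (s *: z).
Proof.
move=> r0 K; split; first by apply: compact_setX; exact: segment_compact.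
move=> [x y] s [/= + +] /andP[s0 s1]; rewrite !in_itv /= => /andP[x1 x2] /andP[y1 y2].
have key (u : R) : - r <= u -> u <= r -> - r <= s * u <= r.
  move=> u1 u2; rewrite -ler_norml normrM ger0_norm //.
  apply: (@le_trans _ _ (1 * `|u|)); first by rewrite ler_wpM2r.
  by rewrite mul1r ler_norml u1.
by split; rewrite /= in_itv /=; exact: key.
Qed.

Lemma cpow_neq0 (w : pl) m : w != 0 -> cpow w m != 0.
Proof. by case/dir_exists => t /(dir_cpow m)/dir_neq0. Qed.

Lemma circle_angle (p : pl) (r : R) : p.1 ^+ 2 + p.2 ^+ 2 < r ^+ 2 -> 0 < r ->
  exists eta : R -> R, [/\ continuous eta, eta (pi *+ 2) = eta 0 &
    forall t, dir ((r * cos t, r * sin t) - p) (eta t + t)].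
Proof.
move=> pr r0; pose z t : pl := (r * cos t, r * sin t).
have re t : 0 < (cmul (z t - p) (cconj (z t))).1.
  rewrite /= mulrN opprK.
  have e : r ^+ 2 = (r * cos t) ^+ 2 + (r * sin t) ^+ 2.
    by rewrite !exprMn -mulrDr cos2Dsin2 mulr1.
  set x := r * cos t in e *; set y := r * sin t in e *.
  have := sqr_ge0 (x - p.1); have := sqr_ge0 (y - p.2).
  rewrite !expr2 in e pr *; nra.
exists (fun t => arg (cmul (z t - p) (cconj (z t)))); split.
- move=> t.
  have cz : z @ nbhs t --> z t.
    apply: cvg_plane; apply: cvgM; [exact: cvg_cst| |exact: cvg_cst|].
      exact: continuous_cos.
    exact: continuous_sin.
  apply: cvg_arg; first exact: re.
  apply: cvg_cmul; last exact: cvg_cconj.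
  by apply: cvgB => //; exact: cvg_cst.
- by rewrite /z cos2pi sin2pi cos0 sin0.
- move=> t; apply: (dir_div (b := z t)); first by apply: dir_arg; exact: re.
  by exists r.
Qed.

(* If the angle of (z - p)^m g(z) were continuous on the frontier of U, it would
   extend by Tietze to U, and (z - p)^m would extend from outside U to a nonvanishing
   map of the whole disc, although it turns m times along the circle. *)
Lemma no_angle (X U : set pl) (p : pl) (g : pl -> pl) (m : int) (r : R)
    (theta : pl -> R) :
  compact X -> open U -> closure U `<=` U `|` X -> U p ->
  0 < r -> p.1 ^+ 2 + p.2 ^+ 2 < r ^+ 2 ->
  (forall t, ~ U (r * cos t, r * sin t)) ->
  {within closure U, continuous g} -> (forall z, closure U z -> g z != 0) ->
  {within X, continuous theta} ->
  (forall z, X z -> closure U z -> dir (cmul (cpow (z - p) m) (g z)) (theta z)) ->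
  m = 0.
Proof.
move=> cX oU clU Up r0 pr Ur cg g0 cth thP.
have [M M0 thM] : exists2 M, 0 < M & forall z, X z -> `|theta z| <= M.
  have /compact_bounded[M [_ MP]] := continuous_compact cth cX.
  exists (`|M| + 1); first by rewrite ltr_wpDl.
  move=> z Xz; apply: MP; last by exists z.
  by rewrite (le_lt_trans (ler_norm M)) // ltrDl.
have clX : closed X by apply: compact_closed => //; exact: norm_hausdorff.
have [Th [thE cTh _]] := @continuous_bounded_extension pl R pseudometric_normal X clX theta M M0 cth thM.
have cexpB (u v : R) : cmul (cexp u) (cconj (cexp v)) = cexp (u - v).
  by rewrite /cmul /= mulrN opprK mulrN addrC [RHS]/cexp cosB sinB; congr pair; ring.
have cexp_shift (u v : R) (n : int) : u - v = n%:~R * (pi *+ 2) -> cexp u = cexp v.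
  move=> e; have := cunitE (dir_shift n (dir_cexp v)).
  by rewrite (cunitE (dir_cexp v)) -e addrC subrK => <-.
pose H1 z := cmul (cexp (Th z)) (cconj (cunit (g z))).
pose H2 z := cunit (cpow (z - p) m).
pose H z := if `[< U z >] then H1 z else H2 z.
have HH1 z : closure U z -> H z = H1 z.
  rewrite /H; case: asboolP => // nU cz.
  have Xz : X z by case: (clU _ cz).
  have zp : z - p != 0 by rewrite subr_eq0; apply/eqP => zp; apply: nU; rewrite zp.
  have [s sP] := dir_exists (cpow_neq0 m zp); have [t tP] := dir_exists (g0 _ cz).
  have [n nE] := dir_unique (thP _ Xz cz) (dir_cmul sP tP).
  rewrite /H1 /H2 (cunitE sP) (cunitE tP) cexpB -thE ?inE //.
  apply/esym/(cexp_shift _ _ n); rewrite -nE; ring.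
have cg' : {within closure U, continuous H1}.
  apply/within_cvgP => z cz; apply: cvg_cmul.
    apply: cvg_cexp; apply: cvg_within_filter; exact: cTh.
  apply: cvg_cconj; apply: cvg_cunit; first exact: g0.
  by move/within_cvgP : cg; exact.
have cH : continuous H.
  have cl2 : closed (~` U) by exact: open_closedC.
  suff : {within closure U `|` ~` U, continuous H}.
    have -> : closure U `|` ~` U = setT.
      rewrite -subTset => z _; have [Uz|] := pselect (U z); [left|by right].
      exact: subset_closure.
    by move=> cH z; have := cH z; rewrite /continuous_at nbhs_subspaceT.
  apply: withinU_continuous => //; first exact: closed_closure.
    apply/within_cvgP => z cz; rewrite HH1 //.
    apply: cvg_trans; last by move/within_cvgP : cg'; apply.
    by apply: fmap_within_eq => y; rewrite inE => /HH1 ->.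
  apply/within_cvgP => z nUz.
  have -> : H z = H2 z by rewrite /H; case: asboolP.
  have zp : z - p != 0 by rewrite subr_eq0; apply/eqP => zp; apply: nUz; rewrite zp.
  apply: (@cvg_trans _ (H2 @ within (~` U) (nbhs z))).
    by apply: fmap_within_eq => y; rewrite inE /H /= => nUy; case: asboolP.
  apply: cvg_within_filter; apply: cvg_cunit; first exact: cpow_neq0.
  by apply: cvg_cpow; apply: cvgB; [exact: cvg_id|exact: cvg_cst].
have H0 z : H z != 0.
  rewrite /H; case: asboolP => Uz.
    have [t tP] := dir_exists (g0 _ (subset_closure Uz)).
    by rewrite /H1 (cunitE tP) cexpB; exact: (dir_neq0 (dir_cexp _)).
  have zp : z - p != 0 by rewrite subr_eq0; apply/eqP => zp; apply: Uz; rewrite zp.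
  have [t tP] := dir_exists (cpow_neq0 m zp).
  by rewrite /H2 (cunitE tP); exact: (dir_neq0 (dir_cexp _)).
have [cK sK] := square_star r0.
have [Th2 [cTh2 Th2P]] := lift_star cK sK (continuous_subspaceT cH) (fun z _ => H0 z).
have [eta [ceta eta0 etaP]] := circle_angle pr r0.
pose zt (t : R) : pl := (r * cos t, r * sin t).
have Kzt t : (`[- r, r]%classic `*` `[- r, r]%classic) (zt t).
  have key (u : R) : `|u| <= 1 -> - r <= r * u <= r.
    by move=> u1; rewrite -ler_norml normrM gtr0_norm // -[leRHS]mulr1 ler_wpM2l // ltW.
  by split; rewrite /= in_itv /=; apply: key; [exact: cos_max|exact: sin_max].
pose h t := Th2 (zt t) - m%:~R * (eta t + t).
have ch : {within setT, continuous h}.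
  apply/within_cvgP => t _; apply: cvgB.
    have : {within setT, continuous (Th2 \o zt)}.
      apply: (within_comp (B := `[- r, r]%classic `*` `[- r, r]%classic)) => //.
      apply: continuous_subspaceT => x; apply: cvg_plane; apply: cvgM; [exact: cvg_cst| |exact: cvg_cst|].
        exact: continuous_cos.
      exact: continuous_sin.
    by move/within_cvgP; exact.
  apply: cvg_within_filter; apply: cvgM; first exact: cvg_cst.
  by apply: cvgD; [exact: ceta|exact: cvg_id].
have hn t : setT t -> exists n : int, h t = n%:~R * (pi *+ 2).
  move=> _; apply: dir_unique (Th2P _ (Kzt t)) _.
  have d := dir_cpow m (etaP t).
  have -> : H (zt t) = cexp (m%:~R * (eta t + t)).
    by rewrite /H; case: asboolP => [/Ur//|_]; exact: cunitE d.
  exact: dir_cexp.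
have cT : connected (setT : set R).
  by apply/connected_intervalP => x y _ _ z _.
have := turns_constant cT ch hn (x := 0) (y := pi *+ 2) I I.
rewrite /h /zt cos2pi sin2pi cos0 sin0 eta0 => /eqP.
rewrite -subr_eq0 => /eqP e.
have : m%:~R * (pi *+ 2) = 0 :> R by rewrite -e; ring.
move/eqP; rewrite mulf_eq0 (gt_eqF (_ : 0 < pi *+ 2)); last by rewrite mulr2n addr_gt0 ?pi_gt0.
by rewrite orbF intr_eq0 => /eqP.
Qed.

End NoLog.

Section Eilenberg.
Local Open Scope classical_set_scope.
Local Open Scope ring_scope.
Context {R : realType}.
Notation pl := (plane R).

Lemma dir_congr (w w' : pl) s t : dir w s -> dir w t -> dir w' s -> dir w' t.
Proof.
move=> ws wt w's; have [n e] := dir_unique wt ws.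
by rewrite -(subrK s t) e addrC; exact: dir_shift.
Qed.

Lemma locally_constant_prop (T : topologicalType) (C : set T) (P : T -> Prop) :
  connected C ->
  (forall x, C x -> exists2 N, nbhs x N & forall y, N y -> C y -> (P x <-> P y)) ->
  forall x y, C x -> C y -> P x -> P y.
Proof.
move=> cC loc x y Cx Cy Px.
have op (Q : T -> Prop) : (forall x, C x -> exists2 N, nbhs x N &
    forall y, N y -> C y -> (Q x <-> Q y)) ->
    exists2 D, open D & C `&` Q = C `&` D.
  move=> h; exists (interior [set z | C z -> Q z]); first exact: open_interior.
  apply/seteqP; split=> z [Cz].
    move=> Qz; split=> //; have [N nN NP] := h z Cz.
    by apply: filterS nN => u Nu Cu; apply/(NP u Nu Cu).
  by move=> /interior_subset /= /(_ Cz).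
have [D oD CD] := op P loc.
have [E oE CE] : exists2 D, open D & C `&` (fun z => ~ P z) = C `&` D.
  apply: op => z Cz; have [N nN NP] := loc z Cz; exists N => // u Nu Cu.
  by rewrite (NP u Nu Cu).
suff e : C `&` P = C by have : C y := Cy; rewrite -e => -[].
apply: cC; first by exists x.
  by exists D.
exists (~` E); first exact: open_closedC.
apply/seteqP; split=> z [Cz].
  move=> Pz; split=> // Ez; suff: (C `&` (fun z => ~ P z)) z by case.
  by rewrite CE.
move=> nEz; split=> //; apply: contrapT => nP; apply: nEz.
suff: (C `&` E) z by case.
by rewrite -CE.
Qed.

Lemma segment_connected_plane (z w : pl) :
  connected ((fun s : R => z + s *: (w - z)) @` `[0, 1]%classic).
Proof.
apply: connected_continuous_connected; first exact: segment_connected.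
apply: continuous_subspaceT => s; apply: cvgD; first exact: cvg_cst.
by apply: cvgZ; [exact: cvg_id|exact: cvg_cst].
Qed.

Lemma ball_connected (z : pl) (e : R) : 0 < e -> connected (ball z e).
Proof.
move=> e0.
have -> : ball z e = \bigcup_(w in ball z e)
    ((fun s : R => z + s *: (w - z)) @` `[0, 1]%classic).
  apply/seteqP; split=> [w bw|_ [w bw [s /= + <-]]].
    exists w => //; exists 1; first by rewrite /= in_itv /= ler01 lexx.
    by rewrite scale1r addrC subrK.
  rewrite in_itv /= => /andP[s0 s1].
  rewrite -ball_normE /= in bw *; rewrite opprD addNKr normrN normrZ ger0_norm //.
  rewrite distrC in bw; apply: le_lt_trans bw.
  by rewrite ler_piMl.
apply: bigcup_connected => [|w _]; last exact: segment_connected_plane.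
exists z => w bw; exists 0; first by rewrite /= in_itv /= ler01 lexx.
by rewrite scale0r addr0.
Qed.

Lemma component_open (A : set pl) x : open A -> open (connected_component A x).
Proof.
move=> oA; rewrite openE => z Az.
have Az' : A z := connected_component_sub Az.
have : nbhs z A by apply: open_nbhs_nbhs.
move=> /nbhs_ballP[e /= e0 eA]; apply/nbhs_ballP; exists e => //= w bw.
apply: (connected_component_trans Az); exists (ball z e) => //.
by split => //; [exact: ballxx|exact: ball_connected].
Qed.

Lemma closure_component (X : set pl) p : closed X ->
  closure (connected_component (~` X) p) `<=` connected_component (~` X) p `|` X.
Proof.
move=> clX z cz; have [Xz|nXz] := pselect (X z); [by right|left].
have oz : nbhs z (connected_component (~` X) z).
  apply: open_nbhs_nbhs; split; last exact: connected_component_refl.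
  by apply: component_open; exact: closed_openC.
have [w [pw zw]] := cz _ oz.
exact: connected_component_trans pw (connected_component_sym zw).
Qed.

Lemma avoiding_circle (X : set pl) (ps : seq pl) : compact X ->
  exists r : R, [/\ 0 < r, forall t, ~ X (r * cos t, r * sin t) &
    forall p, p \in ps -> p.1 ^+ 2 + p.2 ^+ 2 < r ^+ 2].
Proof.
move=> /compact_bounded[M [_ MP]].
pose f (p : pl) := p.1 ^+ 2 + p.2 ^+ 2.
pose S := \sum_(p <- ps) f p.
pose r := `|M| + `|M| + 3 + S.
have f0 p : 0 <= f p by rewrite addr_ge0 ?sqr_ge0.
have S0 : 0 <= S by rewrite sumr_ge0.
have r1 : 1 < r by rewrite /r; have := normr_ge0 M; lra.
have r0 : 0 < r by rewrite (lt_trans _ r1).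
exists r; split => //.
- move=> t Xt; have M1 : M < `|M| + 1 by rewrite (le_lt_trans (ler_norm M)) // ltrDl.
  have : `|(r * cos t, r * sin t) : pl| <= `|M| + 1 := MP _ M1 _ Xt.
  rewrite prod_normE ge_max /= !normrM (gtr0_norm r0) => /andP[a b].
  have : r * (`|cos t| ^+ 2 + `|sin t| ^+ 2) <= r * (`|cos t| + `|sin t|).
    rewrite ler_wpM2l ?(ltW r0) //; apply: lerD; rewrite expr2 ler_piMr //.
      exact: cos_max.
    exact: sin_max.
  rewrite !real_normK ?num_real // cos2Dsin2 mulr1 mulrDr => h.
  have := le_trans h (lerD a b); rewrite /r; lra.
- move=> p pin; apply: (@le_lt_trans _ _ S).
    by rewrite /S (big_rem p) //= lerDl sumr_ge0.
  apply: (@lt_trans _ _ r); first by rewrite /r; have := normr_ge0 M; lra.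
  by rewrite expr2 ltr_pMr.
Qed.

Lemma circle_connected (r : R) : connected (range (fun t : R => (r * cos t, r * sin t) : pl)).
Proof.
apply: connected_continuous_connected.
  by apply/connected_intervalP => x y _ _ z _.
apply: continuous_subspaceT => t; apply: cvg_plane; apply: cvgM; [exact: cvg_cst| |exact: cvg_cst|].
  exact: continuous_cos.
exact: continuous_sin.
Qed.

End Eilenberg.

Section Eilenberg2.
Local Open Scope classical_set_scope.
Local Open Scope ring_scope.
Context {R : realType}.
Notation pl := (plane R).

Definition has_angle (X : set pl) (f : pl -> pl) :=
  exists theta : pl -> R, {within X, continuous theta} /\
    forall z, X z -> dir (f z) (theta z).

(* It has the same argument as (z - p) / (z - q). *)
Definition cratio (p q z : pl) := cmul (z - p) (cconj (z - q)).

Lemma cvg_subr (T : Type) (F : set_system T) {FF : Filter F} (f : T -> pl) (a p : pl) :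
  f @ F --> a -> (fun x => f x - p) @ F --> a - p.
Proof. by move=> fa; apply: cvgB => //; exact: cvg_cst. Qed.

Lemma no_angle_component (X : set pl) (p : pl) (g : pl -> pl) (m : int) (r : R)
    (theta : pl -> R) :
  compact X -> ~ X p ->
  0 < r -> p.1 ^+ 2 + p.2 ^+ 2 < r ^+ 2 ->
  (forall t, ~ connected_component (~` X) p (r * cos t, r * sin t)) ->
  continuous g ->
  (forall z, (connected_component (~` X) p `|` X) z -> g z != 0) ->
  {within X, continuous theta} ->
  (forall z, X z -> dir (cmul (cpow (z - p) m) (g z)) (theta z)) ->
  m = 0.
Proof.
move=> cX Xp r0 pr Ur cg g0 cth thP.
have clX : closed X by apply: compact_closed => //; exact: norm_hausdorff.
apply: (@no_angle R X (connected_component (~` X) p) p g m r theta) => //.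
- by apply: component_open; exact: closed_openC.
- exact: closure_component.
- exact: connected_component_refl.
- exact: continuous_subspaceT.
- by move=> z /(closure_component clX)/g0.
- by move=> z Xz _; exact: thP.
Qed.

Lemma circle_misses (X : set pl) (p q : pl) (r : R) :
  (forall t, ~ X (r * cos t, r * sin t)) ->
  ~ connected_component (~` X) p q ->
  (forall t, ~ connected_component (~` X) p (r * cos t, r * sin t)) \/
  (forall t, ~ connected_component (~` X) q (r * cos t, r * sin t)).
Proof.
move=> Xr pq; pose zt t : pl := (r * cos t, r * sin t).
have same s t : connected_component (~` X) (zt s) (zt t).
  exists (range zt); last by exists t.
  by split; [exists s|move=> _ [u _ <-]; exact: Xr|exact: circle_connected].
have [[s ps]|np] := pselect (exists s, connected_component (~` X) p (zt s)); last first.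
  by left=> t h; apply: np; exists t.
right=> t qt; apply: pq; apply: (connected_component_trans ps).
exact: connected_component_trans (same s t) (connected_component_sym qt).
Qed.

Lemma angle_same_component (X : set pl) (p q : pl) : compact X -> ~ X p -> ~ X q ->
  has_angle X (cratio p q) -> connected_component (~` X) p q.
Proof.
move=> cX Xp Xq [th [cth thP]]; apply: contrapT => pq.
have [r [r0 Xr pin]] := avoiding_circle [:: p; q] cX.
have sub0 (u z : pl) : z <> u -> z - u != 0 by move/eqP; rewrite subr_eq0.
have Xn z u : X z -> ~ X u -> z - u != 0 by move=> Xz Xu; apply: sub0 => e; apply: Xu; rewrite -e.
have cmp u v z : ~ connected_component (~` X) u v -> ~ X v ->
  (connected_component (~` X) u `|` X) z -> z - v != 0.
  by move=> uv Xv zU; apply: sub0 => e; rewrite e in zU; case: zU.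
have p_in : p \in [:: p; q] by rewrite inE eqxx.
have q_in : q \in [:: p; q] by rewrite !inE eqxx orbT.
have [mp|mq] := circle_misses Xr pq.
  have // : (1 : int) = 0.
  apply: (no_angle_component (g := fun z => cconj (z - q)) cX Xp r0 (pin p p_in) mp _ _ cth).
  - by move=> z; apply: cvg_cconj; apply: cvg_subr; exact: cvg_id.
  - move=> z /(cmp p q z pq Xq) /dir_exists[t /dir_cconj]; exact: dir_neq0.
  - move=> z Xz; have [a aP] := dir_exists (Xn _ _ Xz Xp).
    have [b bP] := dir_exists (Xn _ _ Xz Xq).
    apply: (dir_congr (dir_cmul aP (dir_cconj bP)) (thP z Xz)).
    have := dir_cmul (dir_cpow 1 aP) (dir_cconj bP).
    by rewrite mul1r.
have // : (-1 : int) = 0.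
have qp : ~ connected_component (~` X) q p by move=> /connected_component_sym.
apply: (no_angle_component (g := fun z => z - p) cX Xq r0 (pin q q_in) mq _ _ cth).
- by move=> z; apply: cvg_subr; exact: cvg_id.
- by move=> z /(cmp q p z qp Xp).
- move=> z Xz; have [a aP] := dir_exists (Xn _ _ Xz Xp).
  have [b bP] := dir_exists (Xn _ _ Xz Xq).
  apply: (dir_congr (dir_cmul aP (dir_cconj bP)) (thP z Xz)).
  have := dir_cmul (dir_cpow (-1) bP) aP.
  by have -> : (-1)%:~R * b + a = a - b by rewrite mulrNz mulNr mulr1z mul1r addrC.
Qed.

Lemma angle_three_components (X : set pl) (p1 p2 p3 : pl) (m1 m2 : int) :
  compact X -> ~ X p1 -> ~ X p2 -> ~ X p3 ->
  ~ connected_component (~` X) p1 p2 -> ~ connected_component (~` X) p1 p3 ->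
  ~ connected_component (~` X) p2 p3 -> m1 != 0 -> m2 != 0 ->
  ~ has_angle X (fun z => cmul (cpow (cratio p1 p3 z) m1) (cpow (cratio p2 p3 z) m2)).
Proof.
wlog : p1 p2 m1 m2 / exists r, [/\ 0 < r, p1.1 ^+ 2 + p1.2 ^+ 2 < r ^+ 2 &
  (forall t, ~ connected_component (~` X) p1 (r * cos t, r * sin t))].
  move=> W cX X1 X2 X3 p12 p13 p23 m10 m20 h.
  have [r [r0 Xr pin]] := avoiding_circle [:: p1; p2] cX.
  have [mp|mq] := circle_misses Xr p12.
    by apply: (W p1 p2 m1 m2) => //; exists r; split => //; apply: pin; rewrite inE eqxx.
  apply: (W p2 p1 m2 m1) => //.
  - by exists r; split => //; apply: pin; rewrite !inE eqxx orbT.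
  - by move=> /connected_component_sym.
  case: h => th [cth thP]; exists th; split=> // z Xz; have := thP z Xz.
  by congr dir; rewrite /cmul; congr pair; ring.
move=> [r [r0 pr mr]] cX X1 X2 X3 p12 p13 p23 m10 m20 [th [cth thP]].
have sub0 (u z : pl) : z <> u -> z - u != 0 by move/eqP; rewrite subr_eq0.
have Xn z u : X z -> ~ X u -> z - u != 0 by move=> Xz Xu; apply: sub0 => e; apply: Xu; rewrite -e.
have cmp u v z : ~ connected_component (~` X) u v -> ~ X v ->
  (connected_component (~` X) u `|` X) z -> z - v != 0.
  by move=> uv Xv zU; apply: sub0 => e; rewrite e in zU; case: zU.
move/eqP : m10; apply.
apply: (no_angle_component (g := fun z =>
  cmul (cpow (cconj (z - p3)) m1) (cpow (cratio p2 p3 z) m2)) cX X1 r0 pr mr _ _ cth).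
- move=> z; apply: cvg_cmul; apply: cvg_cpow.
    by apply: cvg_cconj; apply: cvg_subr; exact: cvg_id.
  apply: cvg_cmul; first by apply: cvg_subr; exact: cvg_id.
  by apply: cvg_cconj; apply: cvg_subr; exact: cvg_id.
- move=> z zU; have [a aP] := dir_exists (cmp _ _ _ p13 X3 zU).
  have [b bP] := dir_exists (cmp _ _ _ p12 X2 zU).
  apply: dir_neq0; apply: dir_cmul; apply: dir_cpow; first exact: dir_cconj aP.
  by apply: dir_cmul; [exact: bP|exact: dir_cconj aP].
- move=> z Xz; have [a aP] := dir_exists (Xn _ _ Xz X1).
  have [b bP] := dir_exists (Xn _ _ Xz X2); have [c cP] := dir_exists (Xn _ _ Xz X3).
  have d := dir_cmul (dir_cpow m1 (dir_cmul aP (dir_cconj cP)))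
    (dir_cpow m2 (dir_cmul bP (dir_cconj cP))).
  apply: (dir_congr d (thP z Xz)).
  have := dir_cmul (dir_cpow m1 aP) (dir_cmul (dir_cpow m1 (dir_cconj cP))
    (dir_cpow m2 (dir_cmul bP (dir_cconj cP)))).
  by rewrite addrA -mulrDr.
Qed.

Lemma cratio_refl (X : set pl) p : ~ X p -> has_angle X (cratio p p).
Proof.
move=> Xp; exists (fun=> 0); split.
  by apply: continuous_subspaceT => x; exact: cvg_cst.
move=> z Xz; have : z - p != 0 by rewrite subr_eq0; apply/eqP => e; apply: Xp; rewrite -e.
by move=> /dir_exists[a aP]; have := dir_cmul aP (dir_cconj aP); rewrite subrr.
Qed.

Lemma cratio_sym (X : set pl) p q : has_angle X (cratio p q) -> has_angle X (cratio q p).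
Proof.
move=> [th [cth thP]]; exists (fun z => - th z); split.
  by apply/within_cvgP => z Xz; apply: cvgN; move/within_cvgP : cth; exact.
move=> z Xz; have := dir_cconj (thP z Xz); congr dir.
by rewrite /cratio /cconj /cmul /=; congr pair; ring.
Qed.

Lemma cratio_trans (X : set pl) p q s : ~ X q ->
  has_angle X (cratio p q) -> has_angle X (cratio q s) -> has_angle X (cratio p s).
Proof.
move=> Xq [th [cth thP]] [et [cet etP]]; exists (fun z => th z + et z); split.
  apply/within_cvgP => z Xz; apply: cvgD; first by move/within_cvgP : cth; exact.
  by move/within_cvgP : cet; exact.
move=> z Xz; have := dir_cmul (thP z Xz) (etP z Xz).
have q0 : z - q != 0 by rewrite subr_eq0; apply/eqP => e; apply: Xq; rewrite -e.
have n0 := normsq_gt0 q0.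
have n1 : 0 < (cmul (z - q) (cconj (z - q))).1^-1 by rewrite invr_gt0.
move=> /(dir_scale n1); congr dir.
move: (gt_eqF n0); rewrite /cratio /cmul /cconj /=.
set a := (z - q).1; set b := (z - q).2; move=> /negbT nz.
by congr pair; field.
Qed.

Lemma cratio_pos (X : set pl) p : closed X -> ~ X p ->
  exists2 N, nbhs p N & forall q z, N q -> X z -> 0 < (cratio p q z).1.
Proof.
move=> clX Xp.
have : nbhs p (~` X) by apply: open_nbhs_nbhs; split => //; exact: closed_openC.
move=> /nbhs_ballP[e /= e0 eX]; exists (ball p (e / 4)).
  by apply: nbhsx_ballx; rewrite divr_gt0.
move=> q z [/= q1 q2] Xz.
  have : ~ ball p e z by move=> /eX.
  move=> /not_andP nb; rewrite /cratio /= mulrN opprK.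
  rewrite /ball /= in q1 q2 nb.
  have {}nb : e <= `|z.1 - p.1| \/ e <= `|z.2 - p.2|.
    by case: nb => nb; [left|right]; rewrite distrC leNgt; apply/negP.
  move: q1 q2 nb; have -> : z.1 - q.1 = (z.1 - p.1) + (p.1 - q.1) by ring.
  have -> : z.2 - q.2 = (z.2 - p.2) + (p.2 - q.2) by ring.
  move: (z.1 - p.1) (z.2 - p.2) (p.1 - q.1) (p.2 - q.2) => a b u v.
  rewrite !ltr_norml => /andP[u1 u2] /andP[v1 v2].
  wlog a0 : a u u1 u2 / 0 <= a.
    move=> W; case: (leP 0 a) => a0; first exact: W.
    have := W (- a) (- u); rewrite -opprD mulrNN normrN; apply.
    - by rewrite ltrNl opprK.
    - by rewrite ltrNl.
    - by rewrite oppr_ge0 ltW.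
  wlog b0 : b v v1 v2 / 0 <= b.
    move=> W; case: (leP 0 b) => b0; first exact: W.
    have := W (- b) (- v); rewrite -opprD mulrNN normrN; apply.
    - by rewrite ltrNl opprK.
    - by rewrite ltrNl.
    - by rewrite oppr_ge0 ltW.
  rewrite !ger0_norm // => h.
  have ha : a * (a - e / 4) <= a * (a + u) by rewrite ler_wpM2l // lerD2l ltW // -mulNr mulNr.
  have hb : b * (b - e / 4) <= b * (b + v) by rewrite ler_wpM2l // lerD2l ltW // -mulNr mulNr.
  apply: (lt_le_trans _ (lerD ha hb)).
  wlog {}h : a b a0 b0 {u1 u2 v1 v2 ha hb h} / e <= a.
    by move=> W; case: h => h; [exact: W|rewrite addrC; exact: W].
  have s1 : 0 <= (a - e) * (a + 3 / 4 * e) by rewrite mulr_ge0; lra.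
  have s2 := sqr_ge0 (b - e / 8).
  have s3 : 0 < e * e by rewrite mulr_gt0.
  rewrite expr2 in s2; lra.
Qed.

Lemma cratio_local (X : set pl) p : closed X -> ~ X p ->
  exists2 N, nbhs p N & forall q, N q -> has_angle X (cratio p q).
Proof.
move=> clX Xp; have [N nN NP] := cratio_pos clX Xp; exists N => // q Nq.
have re z := NP q z Nq.
exists (fun z => arg (cratio p q z)); split; last by move=> z /re; exact: dir_arg.
apply/within_cvgP => z Xz; apply: cvg_arg; first exact: re.
apply: cvg_within_filter; apply: cvg_cmul; first by apply: cvg_subr; exact: cvg_id.
by apply: cvg_cconj; apply: cvg_subr; exact: cvg_id.
Qed.

Lemma same_component_angle (X : set pl) p q : closed X ->
  connected_component (~` X) p q -> has_angle X (cratio p q).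
Proof.
move=> clX pq.
have Xp : ~ X p.
  by have /connected_component_sub := connected_component_sym pq.
apply: (@locally_constant_prop _ (connected_component (~` X) p)
  (fun q => has_angle X (cratio p q)) _ _ p q) => //.
- exact: component_connected.
- move=> u pu; have Xu : ~ X u by have /connected_component_sub := pu.
  have [N nN NP] := cratio_local clX Xu; exists N => // v Nv pv.
  have Xv : ~ X v by have /connected_component_sub := pv.
  split=> h; first exact: cratio_trans h (NP v Nv).
  by apply: cratio_trans h _ => //; apply/cratio_sym/NP.
- exact: connected_component_refl.
- exact: cratio_refl.
Qed.

End Eilenberg2.

Section Arcs.
Local Open Scope classical_set_scope.
Local Open Scope ring_scope.
Context {R : realType}.
Notation pl := (plane R).
Notation I01 := (`[0, 1]%classic : set R).

Lemma quotient_continuous (T : topologicalType) (K : set T) (gam : T -> pl)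
    (theta : pl -> R) : compact K -> {within K, continuous gam} ->
  {within K, continuous (theta \o gam)} -> {within gam @` K, continuous theta}.
Proof.
move=> cK cg ct; apply/continuous_closedP => C clC.
have /closed_subspaceP[V clV VE] : closed ((theta \o gam) @^-1` C : set (subspace K)).
  by move/continuous_closedP : ct; apply.
have VE' t : (V t /\ K t) = (C (theta (gam t)) /\ K t) := congr1 (fun S : T -> Prop => S t) VE.
apply/closed_subspaceP; exists (gam @` (K `&` V)).
  apply: compact_closed; first exact: norm_hausdorff.
  apply: continuous_compact; last exact: compact_closedI.
  by apply: continuous_subspaceW cg => x [].
apply/seteqP; split=> z.
  move=> [[t [Kt Vt] <-] _]; split; last by exists t.
  by have : V t /\ K t by []; rewrite VE' => -[].
move=> [Cz [t Kt tE]]; split; last by exists t.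
exists t => //; split=> //.
have : C (theta (gam t)) /\ K t by rewrite tE.
by rewrite -VE' => -[].
Qed.

Lemma function_extend (K : set R) (Y : set pl) (gam : R -> pl) (th0 : pl -> R) (phi : R -> R) :
  compact K -> closed Y -> {within Y, continuous th0} ->
  {within K, continuous gam} -> {within K, continuous phi} ->
  (forall t, K t -> Y (gam t) -> phi t = th0 (gam t)) ->
  (forall s t, K s -> K t -> gam s = gam t -> phi s = phi t) ->
  exists theta : pl -> R, [/\ {within Y `|` gam @` K, continuous theta},
    forall z, Y z -> theta z = th0 z & forall t, K t -> theta (gam t) = phi t].
Proof.
move=> cK clY cth0 cgam cphi comp cons.
pose theta z := if pselect (Y z) is left _ then th0 z else
  if pselect (exists2 t, K t & gam t = z) is left h then phi (projT1 (cid2 h)) else 0.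
have thY z : Y z -> theta z = th0 z by rewrite /theta; case: pselect.
have thK t : K t -> theta (gam t) = phi t.
  move=> Kt; rewrite /theta; case: pselect => [Yt|nY]; first by rewrite comp.
  case: pselect => [h|]; last by case; exists t.
  by case: cid2 => s Ks sE /=; exact: cons.
exists theta; split => //; apply: withinU_continuous => //.
- apply: compact_closed; first exact: norm_hausdorff.
  exact: continuous_compact.
- apply/within_cvgP => z Yz; rewrite thY //.
  apply: cvg_trans; last by move/within_cvgP : cth0; apply.
  by apply: fmap_within_eq => y; rewrite inE => /thY ->.
- apply: quotient_continuous => //; apply/within_cvgP => t Kt /=; rewrite thK //.
  apply: cvg_trans; last by move/within_cvgP : cphi; apply.
  by apply: fmap_within_eq => y; rewrite inE => Ky; rewrite /= thK.
Qed.

Lemma arc_lift (f : R -> pl) : {within I01, continuous f} ->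
  (forall t, I01 t -> f t != 0) ->
  exists phi : R -> R, {within I01, continuous phi} /\ forall t, I01 t -> dir (f t) (phi t).
Proof.
move=> cf f0; apply: (@lift_star R R^o I01 f) => //; first exact: segment_compact.
move=> z s /=; rewrite !in_itv /= => /andP[z0 z1] /andP[s0 s1].
by apply/andP; split; [exact: mulr_ge0|rewrite mulr_ile1].
Qed.

Lemma lift_unique (f : R -> pl) (phi psi : R -> R) :
  {within I01, continuous phi} -> {within I01, continuous psi} ->
  (forall t, I01 t -> dir (f t) (phi t)) -> (forall t, I01 t -> dir (f t) (psi t)) ->
  forall s t, I01 s -> I01 t -> phi t - phi s = psi t - psi s.
Proof.
move=> cphi cpsi dphi dpsi s t Is It.
have ch : {within I01, continuous (fun t => phi t - psi t)}.
  apply/within_cvgP => u Iu; apply: cvgB; first by move/within_cvgP : cphi; exact.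
  by move/within_cvgP : cpsi; exact.
have := turns_constant (@segment_connected R 0 1) ch _ Is It.
move=> /(_ _)/= h; have {}h : phi s - psi s = phi t - psi t.
  by apply: h => u Iu; exact: dir_unique (dphi u Iu) (dpsi u Iu).
lra.
Qed.

Lemma I0 : I01 0. Proof. by rewrite /= in_itv /= lexx ler01. Qed.
Lemma I1 : I01 1. Proof. by rewrite /= in_itv /= lexx ler01. Qed.

(* The change of the angle at which the point of the arc is seen from z. *)
Lemma alpha_exists (gam : R -> pl) : {within I01, continuous gam} ->
  exists alpha : pl -> R, forall z, ~ (gam @` I01) z ->
    {for z, continuous alpha} /\
    forall phi : R -> R, {within I01, continuous phi} ->
      (forall t, I01 t -> dir (gam t - z) (phi t)) -> alpha z = phi 1 - phi 0.
Proof.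
move=> cg; have cK := @segment_compact R 0 1.
have clA : closed (gam @` I01).
  apply: compact_closed; first exact: norm_hausdorff.
  exact: continuous_compact.
have lift z : ~ (gam @` I01) z -> exists phi : R -> R, {within I01, continuous phi} /\
    forall t, I01 t -> dir (gam t - z) (phi t).
  move=> nz; apply: arc_lift => //.
    apply/within_cvgP => t It; apply: cvg_subr; move/within_cvgP : cg; exact.
  by move=> t It; rewrite subr_eq0; apply/eqP => e; apply: nz; exists t.
have /choice[alpha alphaP] : forall z, exists a : R, ~ (gam @` I01) z -> forall phi : R -> R,
    {within I01, continuous phi} -> (forall t, I01 t -> dir (gam t - z) (phi t)) ->
    a = phi 1 - phi 0.
  move=> z; have [az|nz] := pselect ((gam @` I01) z); first by exists 0.
  have [phi [cphi dphi]] := lift z nz; exists (phi 1 - phi 0) => _ psi cpsi dpsi.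
  by apply: (lift_unique cphi cpsi dphi dpsi); [exact: I0|exact: I1].
exists alpha => z nz; split; last exact: alphaP.
have [N nN NP] := cratio_pos clA nz.
have [phi [cphi dphi]] := lift z nz.
have AE w : N w -> alpha w = phi 1 - arg (cratio z w (gam 1)) - (phi 0 - arg (cratio z w (gam 0))).
  move=> Nw.
  have nw : ~ (gam @` I01) w.
    move=> Aw; have := NP w w Nw Aw; rewrite /cratio subrr /= oppr0 !mulr0 subr0.
    by rewrite ltxx.
  apply: (alphaP w nw (fun t => phi t - arg (cratio z w (gam t)))).
    apply/within_cvgP => t It.
    have cgt : gam @ within I01 (nbhs t) --> gam t by move/within_cvgP : cg; exact.
    apply: cvgB; first by move/within_cvgP : cphi; exact.
    apply: cvg_arg; first by apply: NP => //; exists t.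
    by apply: cvg_cmul; [exact: cvg_subr|apply: cvg_cconj; exact: cvg_subr].
  move=> t It; have At : (gam @` I01) (gam t) by exists t.
  have w0 : gam t - w != 0 by rewrite subr_eq0; apply/eqP => e; apply: nw; exists t.
  have [b bP] := dir_exists w0.
  have [n nE] := dir_unique (dir_cmul (dphi t It) (dir_cconj bP)) (dir_arg (NP w _ Nw At)).
  have -> : phi t - arg (cratio z w (gam t)) = b + n%:~R * (pi *+ 2).
    by rewrite -nE /cratio; ring.
  exact: dir_shift.
apply: (@cvg_trans _ ((fun w => phi 1 - arg (cratio z w (gam 1)) -
    (phi 0 - arg (cratio z w (gam 0)))) @ nbhs z)).
  by apply: near_eq_cvg; apply: filterS nN => w /AE.
rewrite AE; last exact: nbhs_singleton.
have ca t : I01 t -> (fun w => arg (cratio z w (gam t))) @ nbhs z --> arg (cratio z z (gam t)).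
  move=> It; apply: cvg_arg; first by apply: NP; [exact: nbhs_singleton|exists t].
  apply: cvg_cmul; first exact: cvg_cst.
  by apply: cvg_cconj; apply: cvgB; [exact: cvg_cst|exact: cvg_id].
apply: cvgB; apply: cvgB; [exact: cvg_cst| |exact: cvg_cst|]; apply: ca; [exact: I1|exact: I0].
Qed.

End Arcs.

Section Gluing.
Local Open Scope classical_set_scope.
Local Open Scope ring_scope.
Context {R : realType}.
Notation pl := (plane R).
Notation I01 := (`[0, 1]%classic : set R).

Lemma alpha_turn (gam : R -> pl) (alpha : pl -> R) z a :
  {within I01, continuous gam} -> ~ (gam @` I01) z ->
  (forall phi : R -> R, {within I01, continuous phi} ->
      (forall t, I01 t -> dir (gam t - z) (phi t)) -> alpha z = phi 1 - phi 0) ->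
  (dir (gam 0 - z) a -> dir (gam 1 - z) (a + alpha z)) /\
  (dir (gam 1 - z) a -> dir (gam 0 - z) (a - alpha z)).
Proof.
move=> cg nz aP.
have [phi [cphi dphi]] : exists phi : R -> R, {within I01, continuous phi} /\
    forall t, I01 t -> dir (gam t - z) (phi t).
  apply: arc_lift => //.
    apply/within_cvgP => t It; apply: cvg_subr; move/within_cvgP : cg; exact.
  by move=> t It; rewrite subr_eq0; apply/eqP => e; apply: nz; exists t.
rewrite (aP phi cphi dphi); split=> da.
  have [n nE] := dir_unique da (dphi _ I0).
  have -> : a + (phi 1 - phi 0) = phi 1 + n%:~R * (pi *+ 2) by rewrite -nE; ring.
  by apply: dir_shift; apply: dphi; exact: I1.
have [n nE] := dir_unique da (dphi _ I1).
have -> : a - (phi 1 - phi 0) = phi 0 + n%:~R * (pi *+ 2) by rewrite -nE; ring.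
by apply: dir_shift; apply: dphi; exact: I0.
Qed.

(* Glued along V, alpha and beta would give a continuous angle between the two ends
   of the arc, seen from any other point of the plane. On a small circle around one end
   this angle makes a full turn. *)
Lemma no_gluing (gam : R -> pl) (V : set pl) (alpha beta : pl -> R) :
  {within I01, continuous gam} -> gam 0 <> gam 1 -> open V ->
  (forall t, 0 < t < 1 -> V (gam t)) -> ~ V (gam 0) -> ~ V (gam 1) ->
  (forall z, ~ (gam @` I01) z -> {for z, continuous alpha} /\
    forall phi : R -> R, {within I01, continuous phi} ->
      (forall t, I01 t -> dir (gam t - z) (phi t)) -> alpha z = phi 1 - phi 0) ->
  (forall z, V z -> {for z, continuous beta} /\
    forall a, dir (gam 0 - z) a -> dir (gam 1 - z) (a + beta z)) ->
  (forall z, V z -> ~ (gam @` I01) z -> alpha z = beta z) -> False.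
Proof.
move=> cg g01 oV Vg V0 V1 alP beP ab.
have clA : closed (gam @` I01).
  apply: compact_closed; first exact: norm_hausdorff.
  by apply: continuous_compact => //; exact: segment_compact.
pose A z := if pselect (V z) is left _ then beta z else alpha z.
have AV z : V z -> A z = beta z by rewrite /A; case: pselect.
have Aal z : ~ (gam @` I01) z -> A z = alpha z.
  by move=> nz; rewrite /A; case: pselect => // Vz; rewrite ab.
have cases z : z <> gam 0 -> z <> gam 1 -> V z \/ ~ (gam @` I01) z.
  move=> z0 z1; have [|nz] := pselect (V z); [by left|right=> -[t + tz]].
  rewrite /= in_itv /= => /andP[t0 t1]; apply: nz; rewrite -tz; apply: Vg.
  rewrite !lt_neqAle t0 t1 !andbT; apply/andP; split; apply/eqP => e.
    by apply: z0; rewrite -tz -e.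
  by apply: z1; rewrite -tz e.
have AP z : z <> gam 0 -> z <> gam 1 -> {for z, continuous A} /\
    forall a, dir (gam 0 - z) a -> dir (gam 1 - z) (a + A z).
  move=> z0 z1; case: (cases z z0 z1) => h.
    have [cb db] := beP z h; rewrite AV //; split=> //.
    rewrite /prop_for /continuous_at AV //.
    apply: (@cvg_trans _ (beta @ nbhs z)) => //.
    by apply: near_eq_cvg; apply: filterS (open_nbhs_nbhs (conj oV h)) => w /AV.
  have [ca da] := alP z h; rewrite Aal //; split.
    rewrite /prop_for /continuous_at Aal //.
    apply: (@cvg_trans _ (alpha @ nbhs z)) => //.
    apply: near_eq_cvg; apply: filterS (open_nbhs_nbhs (conj (closed_openC clA) h)) => w /=.
    by move/Aal.
  by move=> a; have [+ _] := alpha_turn a cg h da; apply.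
pose c := gam 1 - gam 0.
have c0 : c != 0 by rewrite subr_eq0; apply/eqP => e; apply: g01.
pose nc := c.1 ^+ 2 + c.2 ^+ 2.
have nc0 : 0 < nc by have := normsq_gt0 c0; rewrite /= mulrN opprK -!expr2.
pose r := nc / (2 * (`|c.1| + `|c.2| + 1)).
have d0 : 0 < `|c.1| + `|c.2| + 1 by rewrite ltr_wpDl // addr_ge0.
have r0 : 0 < r by rewrite /r divr_gt0 // mulr_gt0.
pose ct (t : R) : pl := (r * cos t, r * sin t).
pose z t : pl := gam 0 + ct t.
have czt t : ct @ nbhs t --> ct t.
  apply: cvg_plane; apply: cvgM; [exact: cvg_cst| |exact: cvg_cst|].
    exact: continuous_cos.
  exact: continuous_sin.
have re t : 0 < (cmul (gam 1 - z t) (cconj c)).1.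
  have -> : gam 1 - z t = c - ct t by rewrite /z /c opprD addrA.
  have k1 : r * cos t * c.1 <= r * `|c.1|.
    rewrite -mulrA ler_wpM2l ?(ltW r0) //.
    rewrite (le_trans (ler_norm _)) // normrM ler_piMl //; exact: cos_max.
  have k2 : r * sin t * c.2 <= r * `|c.2|.
    rewrite -mulrA ler_wpM2l ?(ltW r0) //.
    rewrite (le_trans (ler_norm _)) // normrM ler_piMl //; exact: sin_max.
  have k3 : r * (`|c.1| + `|c.2| + 1) = nc / 2.
    by rewrite /r; field; rewrite gt_eqF.
  have -> : (cmul (c - ct t) (cconj c)).1 = nc - (r * cos t * c.1 + r * sin t * c.2).
    by rewrite /nc /cmul /=; ring.
  clear -k1 k2 k3 nc0 r0; rewrite !mulrDr in k3.
  move: k1 k2 k3 nc0 r0; move: (r * cos t * c.1) (r * sin t * c.2) (r * `|c.1|) (r * `|c.2|).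
  by move: nc r => n q x y x' y'; lra.
have zg0 t : z t <> gam 0.
  move=> e; have := dir_neq0 (ex_intro2 _ _ r r0 (erefl (ct t)) : dir (ct t) t).
  by rewrite -(addKr (gam 0) (ct t)) -/(z t) e addNr eqxx.
have zg1 t : z t <> gam 1.
  by move=> e; have := re t; rewrite e subrr /= !mul0r subr0 ltxx.
have [u uP] := dir_exists c0.
pose eta t := arg (cmul (gam 1 - z t) (cconj c)) + u.
have etaP t : dir (gam 1 - z t) (eta t).
  by apply: dir_div uP; apply: dir_arg; exact: re.
pose h t := A (z t) - eta t + (t + pi).
have ch : {within setT, continuous h}.
  apply: continuous_subspaceT => t.
  have cz : z @ nbhs t --> z t by apply: cvgD; [exact: cvg_cst|exact: czt].
  apply: cvgD; last by apply: cvgD; [exact: cvg_id|exact: cvg_cst].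
  apply: cvgB.
    by apply: (cvg_comp z A cz); have [] := AP (z t) (zg0 t) (zg1 t).
  apply: cvgD; last exact: cvg_cst.
  apply: cvg_arg; first exact: re.
  apply: cvg_cmul; last exact: cvg_cst.
  by apply: cvgB => //; exact: cvg_cst.
have hn t : setT t -> exists n : int, h t = n%:~R * (pi *+ 2).
  move=> _; have d : dir (gam 0 - z t) (t + pi).
    have -> : gam 0 - z t = - ct t by rewrite /z opprD addrA subrr sub0r.
    by apply: dir_opp; exists r.
  have [_ /(_ _ d) d1] := AP (z t) (zg0 t) (zg1 t).
  have [n nE] := dir_unique d1 (etaP t); exists n; rewrite -nE /h; ring.
have cT : connected (setT : set R).
  by apply/connected_intervalP => x y _ _ w _.
have := turns_constant cT ch hn (x := 0) (y := pi *+ 2) I I.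
rewrite /h /eta /z /ct cos2pi sin2pi cos0 sin0 mulr2n => e.
have := @pi_gt0 R; lra.
Qed.

End Gluing.

(** * Duality in a plane drawing *)

Section PlaneGraph.
Local Open Scope classical_set_scope.
Local Open Scope ring_scope.
Context {R : realType} (G : plane_multigraph R).
Notation pl := (plane R).
Notation I01 := (`[0, 1]%classic : set R).
Notation vp := (@vpoint R G).
Hypothesis G_loopless : loopless G.
Implicit Types (S : pred (edge G)) (e f : edge G) (t : R).

Definition curve e : set pl := @edge_arc R G e @` I01.

Definition subdrawing S : set pl :=
  range (@vpoint R G) `|` \bigcup_(e in [set e | S e]) curve e.

Lemma I01P t : I01 t <-> 0 <= t <= 1.
Proof. by rewrite /= in_itv. Qed.

Lemma I01_cases t : I01 t -> [\/ t = 0, t = 1 | 0 < t < 1].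
Proof.
move=> /I01P/andP[]; rewrite !le_eqVlt => /orP[/eqP<-|t0]; first by constructor 1.
by move=> /orP[/eqP->|t1]; [constructor 2|constructor 3; rewrite t0].
Qed.

Lemma open_unit t : 0 < t < 1 -> t \in `]0, 1[.
Proof. by rewrite in_itv. Qed.

Lemma drawingE : drawing G = subdrawing predT.
Proof. by congr (_ `|` _); apply: eq_bigcupl; split. Qed.

Lemma arc_compact e : compact (curve e).
Proof.
by apply: continuous_compact; [exact: arc_continuous|exact: segment_compact].
Qed.

Lemma compact_finite_bigcup (T : topologicalType) (I : finType) (P : pred I) (F : I -> set T) :
  (forall i, P i -> compact (F i)) -> compact (\bigcup_(i in [set i | P i]) F i).
Proof.
move=> cF.
have -> : \bigcup_(i in [set i | P i]) F i = \big[setU/set0]_(i <- enum P) F i.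
  rewrite -bigcup_seq; apply: eq_bigcupl; split=> i /=; rewrite mem_enum //.
rewrite big_seq; elim/big_ind: _ => [|A B cA cB|i]; [exact: compact0|exact: compactU|].
by rewrite mem_enum => /cF.
Qed.

Lemma subdrawing_compact S : compact (subdrawing S).
Proof.
apply: compactU; last by apply: compact_finite_bigcup => e _; exact: arc_compact.
by apply: finite_compact; apply: finite_image; exact: finite_finset.
Qed.

Lemma compact_closed_plane (A : set pl) : compact A -> closed A.
Proof. by apply: compact_closed; exact: norm_hausdorff. Qed.

Lemma subdrawing_closed S : closed (subdrawing S).
Proof. by apply: compact_closed_plane; exact: subdrawing_compact. Qed.

Lemma subdrawing_sub S S' : (forall e, S e -> S' e) -> subdrawing S `<=` subdrawing S'.
Proof. by move=> SS z [vz|[e Se ez]]; [left|right; exists e => //; exact: SS]. Qed.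

Lemma arc_injective e s t : I01 s -> I01 t -> edge_arc e s = edge_arc e t -> s = t.
Proof.
have ne : vp (tail_end e) <> vp (head_end e).
  by move=> /point_inj h; have := G_loopless e; rewrite h eqxx.
have a0 : edge_arc e 0 = vp (tail_end e) := arc_tail e.
have a1 : edge_arc e 1 = vp (head_end e) := arc_head e.
move=> /I01_cases[->|->|s01] /I01_cases[->|->|t01] //.
- by rewrite a0 a1 => /ne.
- by rewrite a0 => /esym/(arc_avoids_point (open_unit t01)).
- by rewrite a0 a1 => /esym/ne.
- by rewrite a1 => /esym/(arc_avoids_point (open_unit t01)).
- by rewrite a0 => /(arc_avoids_point (open_unit s01)).
- by rewrite a1 => /(arc_avoids_point (open_unit s01)).
- by apply: arc_inj; exact: open_unit.
Qed.

Lemma arc_vpoint e t v : 0 < t < 1 -> edge_arc e t <> vp v.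
Proof. by move=> t01; exact: (arc_avoids_point (open_unit t01)). Qed.

Lemma arc_ends e z : curve e z ->
  [\/ z = vp (tail_end e), z = vp (head_end e) |
    exists2 t, 0 < t < 1 & z = edge_arc e t].
Proof.
move=> [t It <-]; case: (I01_cases It) => [->|->|t01].
- by constructor 1; rewrite arc_tail.
- by constructor 2; rewrite arc_head.
- by constructor 3; exists t.
Qed.

Lemma arc_mem e t : 0 <= t <= 1 -> curve e (edge_arc e t).
Proof. by move=> t01; exists t => //; apply/I01P. Qed.

Lemma arc_off S e t : ~~ S e -> 0 < t < 1 -> ~ subdrawing S (edge_arc e t).
Proof.
move=> Se t01 [[v _ /esym]|[f Sf /arc_ends[/arc_vpoint|/arc_vpoint|[s s01 /esym]]]]; try by apply.
  exact: arc_vpoint.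
apply: (arc_disjoint _ (open_unit s01) (open_unit t01)) => fe.
by have : S f := Sf; rewrite fe (negbTE Se).
Qed.

Lemma subdrawing_vpoint S v : subdrawing S (vp v).
Proof. by left; exists v. Qed.

Lemma arc_subdrawing S e : S e -> curve e `<=` subdrawing S.
Proof. by move=> Se z ez; right; exists e. Qed.

Lemma subdrawing_add S e : subdrawing (fun f => S f || (f == e)) = subdrawing S `|` curve e.
Proof.
apply/seteqP; split=> z.
  move=> [vz|[f /= /orP[Sf|/eqP->] fz]]; [by left; left| |by right].
  by left; right; exists f.
by move=> [[vz|[f Sf fz]]|ez]; [left|right; exists f => //=; rewrite Sf|right; exists e => //=; rewrite eqxx orbT].
Qed.

Lemma drawing_split e : subdrawing predT = subdrawing (predC1 e) `|` curve e.
Proof.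
rewrite -subdrawing_add; congr (_ `|` _); apply: eq_bigcupl; split=> f //= _.
by rewrite orNb.
Qed.

Lemma angle_extend_edge S e (f : pl -> pl) (theta : pl -> R) (phi : R -> R) : ~~ S e ->
  {within subdrawing S, continuous theta} ->
  (forall z, subdrawing S z -> dir (f z) (theta z)) ->
  {within I01, continuous phi} -> (forall t, I01 t -> dir (f (edge_arc e t)) (phi t)) ->
  phi 0 = theta (vp (tail_end e)) -> phi 1 = theta (vp (head_end e)) ->
  has_angle (subdrawing (fun f => S f || (f == e))) f.
Proof.
move=> Se cth dth cphi dphi e0 e1.
have [|||||||th' [cth' th1 th2]] := @function_extend R I01 (subdrawing S) (edge_arc e) theta phi.
- exact: segment_compact.
- exact: subdrawing_closed.
- exact: cth.
- exact: arc_continuous.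
- exact: cphi.
- move=> t /I01_cases[->|->|t01]; rewrite ?arc_tail ?arc_head // => St.
  by have := arc_off Se t01.
- by move=> s t Is It /(arc_injective Is It) ->.
exists th'; rewrite subdrawing_add; split=> // z [Sz|[t It <-]].
  by rewrite th1 //; exact: dth.
by rewrite th2 //; exact: dphi.
Qed.

Lemma angle_mismatch S e p q : ~~ S e -> ~ curve e p -> ~ curve e q ->
  has_angle (subdrawing S) (cratio p q) ->
  exists (theta : pl -> R) (phi : R -> R) (n : int), [/\ {within subdrawing S, continuous theta},
    forall z, subdrawing S z -> dir (cratio p q z) (theta z),
    {within I01, continuous phi}, forall t, I01 t -> dir (cratio p q (edge_arc e t)) (phi t) &
    phi 0 = theta (vp (tail_end e)) /\
    phi 1 = theta (vp (head_end e)) + n%:~R * (pi *+ 2)].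
Proof.
move=> Se ep eq [th [cth dth]].
have [phi [cphi dphi]] : exists phi : R -> R, {within I01, continuous phi} /\
    forall t, I01 t -> dir (cratio p q (edge_arc e t)) (phi t).
  apply: (@arc_lift R (fun t => cratio p q (edge_arc e t))).
    apply/within_cvgP => t It.
    have ce : edge_arc e @ within I01 (nbhs t) --> edge_arc e t.
      by have /within_cvgP := (@arc_continuous R G e); apply.
    by apply: cvg_cmul; [exact: cvg_subr|apply: cvg_cconj; exact: cvg_subr].
  move=> t It; have At : curve e (edge_arc e t) by exists t.
  have ne (u : pl) : ~ curve e u -> edge_arc e t - u != 0.
    by move=> nu; rewrite subr_eq0; apply/eqP => h; apply: nu; rewrite -h.
  have [a aP] := dir_exists (ne _ ep); have [b bP] := dir_exists (ne _ eq).
  exact: dir_neq0 (dir_cmul aP (dir_cconj bP)).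
have d0 := dphi _ I0; rewrite arc_tail in d0.
have d1 := dphi _ I1; rewrite arc_head in d1.
have [m mE] := dir_unique (dth _ (subdrawing_vpoint S (tail_end e))) d0.
have [n nE] := dir_unique d1 (dth _ (subdrawing_vpoint S (head_end e))).
exists th, (fun t => phi t + m%:~R * (pi *+ 2)), (n + m); split => //.
- apply/within_cvgP => t It; apply: cvgD; last exact: cvg_cst.
  by move/within_cvgP : cphi; exact.
- by move=> t It; apply: dir_shift; exact: dphi.
- split; first by rewrite -mE; ring.
  by rewrite intrD mulrDl -nE; ring.
Qed.

(* The face into which e and the faces on its two sides merge when e is deleted. *)
Definition region e := connected_component (~` subdrawing (predC1 e)) (edge_arc e 2^-1).

Lemma half01 : 0 < (2^-1 : R) < 1.
Proof. by rewrite invr_gt0 ltr0n invf_lt1 ?ltr1n ?ltr0n. Qed.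

Lemma region_arc e t : 0 < t < 1 -> region e (edge_arc e t).
Proof.
move=> t01; exists (edge_arc e @` [set t | 0 < t < 1]); last by exists t.
split; first by exists 2^-1 => //; exact: half01.
  by move=> _ [s s01 <-]; apply: arc_off => //=; rewrite eqxx.
apply: connected_continuous_connected.
  apply/connected_intervalP => x y /= /andP[x0 x1] /andP[y0 y1] z /andP[xz zy].
  by rewrite /= (lt_le_trans x0 xz) (le_lt_trans zy y1).
apply: continuous_subspaceW (@arc_continuous R G e).
by move=> s /= /andP[s0 s1]; rewrite in_itv /= !ltW.
Qed.

Lemma region_open e : open (region e).
Proof. by apply: component_open; exact/closed_openC/subdrawing_closed. Qed.

Lemma region_off e z : region e z -> ~ curve e z -> ~ subdrawing predT z.
Proof. by move=> /connected_component_sub nz ez; rewrite (drawing_split e) => -[]. Qed.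

Lemma region_arcE e z : region e z -> curve e z -> exists2 t, 0 < t < 1 & z = edge_arc e t.
Proof.
move=> /connected_component_sub nz /arc_ends[h|h|//].
  by case: nz; rewrite h; exact: subdrawing_vpoint.
by case: nz; rewrite h; exact: subdrawing_vpoint.
Qed.

Lemma region_same S e p q : ~~ S e -> region e p -> region e q ->
  connected_component (~` subdrawing S) p q.
Proof.
move=> Se rp rq; exists (region e) => //; split => //; last exact: component_connected.
move=> z /connected_component_sub nz Sz; apply: nz; apply: subdrawing_sub Sz => f Sf /=.
by apply: contraNneq Se => <-.
Qed.

Lemma region_angle S e p q : ~~ S e -> region e p -> region e q ->
  has_angle (subdrawing S) (cratio p q).
Proof.
move=> Se rp rq; apply: same_component_angle; first exact: subdrawing_closed.
exact: region_same Se rp rq.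
Qed.

Notation same_face := (connected_component (~` subdrawing predT)).

Lemma at_most_two_sides e p1 p2 p3 :
  region e p1 -> region e p2 -> region e p3 -> ~ curve e p1 -> ~ curve e p2 -> ~ curve e p3 ->
  [\/ same_face p1 p2, same_face p1 p3 | same_face p2 p3].
Proof.
move=> r1 r2 r3 e1 e2 e3.
have n1 := region_off r1 e1; have n2 := region_off r2 e2; have n3 := region_off r3 e3.
apply: contrapT => nh.
have [h12 h13 h23] : [/\ ~ same_face p1 p2, ~ same_face p1 p3 & ~ same_face p2 p3].
  by split=> h; apply: nh; [constructor 1|constructor 2|constructor 3].
have Se : ~~ predC1 e e by rewrite /= eqxx.
have [th1 [ph1 [k1 [ct1 dt1 cp1 dp1 [s1 t1]]]]] := angle_mismatch Se e1 e3 (region_angle Se r1 r3).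
have [th2 [ph2 [k2 [ct2 dt2 cp2 dp2 [s2 t2]]]]] := angle_mismatch Se e2 e3 (region_angle Se r2 r3).
have XE : subdrawing predT = subdrawing (fun f => predC1 e f || (f == e)).
  by rewrite (drawing_split e) subdrawing_add.
have cX : compact (subdrawing predT) by exact: subdrawing_compact.
case: (eqVneq k1 0) => k10.
  apply: h13; apply: angle_same_component => //; rewrite XE.
  by apply: (angle_extend_edge Se ct1 dt1 cp1 dp1 s1); rewrite t1 k10 mul0r addr0.
case: (eqVneq k2 0) => k20.
  apply: h23; apply: angle_same_component => //; rewrite XE.
  by apply: (angle_extend_edge Se ct2 dt2 cp2 dp2 s2); rewrite t2 k20 mul0r addr0.
apply: (@angle_three_components R (subdrawing predT) p1 p2 p3 k2 (- k1)) => //.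
  by rewrite oppr_eq0.
rewrite XE; apply: (@angle_extend_edge _ e _ (fun z => k2%:~R * th1 z + (- k1)%:~R * th2 z)
  (fun t => k2%:~R * ph1 t + (- k1)%:~R * ph2 t)) => //.
- apply/within_cvgP => z Sz; apply: cvgD; apply: cvgM; [exact: cvg_cst| |exact: cvg_cst|].
    by move/within_cvgP : ct1; exact.
  by move/within_cvgP : ct2; exact.
- by move=> z Sz; apply: dir_cmul; apply: dir_cpow; [exact: dt1|exact: dt2].
- apply/within_cvgP => z Sz; apply: cvgD; apply: cvgM; [exact: cvg_cst| |exact: cvg_cst|].
    by move/within_cvgP : cp1; exact.
  by move/within_cvgP : cp2; exact.
- by move=> z Sz; apply: dir_cmul; apply: dir_cpow; [exact: dp1|exact: dp2].
- by rewrite s1 s2.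
- by rewrite t1 t2 mulrNz; ring.
Qed.

End PlaneGraph.

Section Pendant.
Local Open Scope classical_set_scope.
Local Open Scope ring_scope.
Context {R : realType}.
Notation pl := (plane R).

Lemma cratio_continuous (p q : pl) : continuous (cratio p q).
Proof.
move=> z; apply: cvg_cmul; first by apply: cvg_subr; exact: cvg_id.
by apply: cvg_cconj; apply: cvg_subr; exact: cvg_id.
Qed.

Lemma cratio_neq0 (p q z : pl) : z <> p -> z <> q -> cratio p q z != 0.
Proof.
move=> zp zq; have sub0 (u : pl) : z <> u -> z - u != 0 by move/eqP; rewrite subr_eq0.
have [a aP] := dir_exists (sub0 _ zp); have [b bP] := dir_exists (sub0 _ zq).
exact: dir_neq0 (dir_cmul aP (dir_cconj bP)).
Qed.

Lemma angle_extend_pendant (Y : set pl) (gam : R -> pl) (s : R) (p q : pl) :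
  closed Y -> has_angle Y (cratio p q) -> 0 <= s ->
  {within `[0, s]%classic, continuous gam} ->
  (forall u v, 0 <= u <= s -> 0 <= v <= s -> gam u = gam v -> u = v) ->
  Y (gam 0) -> (forall t, 0 < t <= s -> ~ Y (gam t)) ->
  (forall t, 0 <= t <= s -> gam t <> p /\ gam t <> q) ->
  has_angle (Y `|` gam @` `[0, s]%classic) (cratio p q).
Proof.
move=> clY [th [cth dth]] s0 cg ig Y0 Yt pq.
have KP t : `[0, s]%classic t = (0 <= t <= s) by rewrite /= in_itv.
have [phi [cphi dphi]] : exists phi : R -> R, {within `[0, s]%classic, continuous phi} /\
    forall t, `[0, s]%classic t -> dir (cratio p q (gam t)) (phi t).
  apply: (@lift_star R R^o `[0, s]%classic (cratio p q \o gam)).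
  - exact: segment_compact.
  - move=> z u; rewrite !KP => /andP[z0 z1] /andP[u0 u1].
    apply/andP; split; first exact: mulr_ge0.
    by apply: le_trans z1; rewrite /GRing.scale /= ler_piMl.
  - apply: (within_comp (B := setT) cg) => //.
    by apply: continuous_subspaceT; exact: cratio_continuous.
  - by move=> t; rewrite KP => /pq[tp tq]; exact: cratio_neq0.
have K0 : `[0, s]%classic 0 by rewrite KP lexx.
have [n nE] := dir_unique (dth _ Y0) (dphi _ K0).
have dphi' t : `[0, s]%classic t -> dir (cratio p q (gam t)) (phi t + n%:~R * (pi *+ 2)).
  by move=> /dphi; exact: dir_shift.
have [|||||||th' [cth' th1 th2]] := @function_extend R `[0, s]%classic Y gam th
    (fun t => phi t + n%:~R * (pi *+ 2)).
- exact: segment_compact.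
- exact: clY.
- exact: cth.
- exact: cg.
- apply/within_cvgP => t It; apply: cvgD; last exact: cvg_cst.
  by move/within_cvgP : cphi; exact.
- move=> t; rewrite KP => /andP[t0 ts] Ygt.
  have [t0'|t0'] := ltP 0 t; first by case: (Yt t); rewrite ?t0'.
  have -> : t = 0 by apply: le_anti; rewrite t0 t0'.
  by rewrite -nE addrC subrK.
- by move=> u v; rewrite !KP => Ku Kv /(ig _ _ Ku Kv) ->.
exists th'; split=> // z [Yz|[t Kt <-]]; first by rewrite th1 //; exact: dth.
by rewrite th2 //; exact: dphi'.
Qed.

Lemma angle_extend_point (Y : set pl) (v p q : pl) : closed Y -> ~ Y v -> v <> p -> v <> q ->
  has_angle Y (cratio p q) -> has_angle (Y `|` [set v]) (cratio p q).
Proof.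
move=> clY Yv vp vq [th [cth dth]].
have [a aP] := dir_exists (cratio_neq0 vp vq).
have cY : {within Y, continuous (fun z => if z == v then a else th z)}.
  apply/within_cvgP => z Yz; have zv : z == v = false by apply/eqP => e; apply: Yv; rewrite -e.
  rewrite zv; apply: cvg_trans; last by move/within_cvgP : cth; apply.
  apply: fmap_within_eq => y; rewrite inE => Yy.
  by have -> : y == v = false by apply/eqP => e; apply: Yv; rewrite -e.
exists (fun z => if z == v then a else th z); split.
  apply: withinU_continuous => //.
    by apply: compact_closed; [exact: norm_hausdorff|exact: compact_set1].
  apply/within_nbhsP => z P -> nP; apply: filterE => y -> ; exact: nbhs_singleton nP.
move=> z [Yz|->]; last by rewrite eqxx.
by have -> : z == v = false; [apply/eqP => e; apply: Yv; rewrite -e|exact: dth].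
Qed.

End Pendant.

Section Sides.
Local Open Scope classical_set_scope.
Local Open Scope ring_scope.
Context {R : realType} (G : plane_multigraph R).
Notation I01 := (`[0, 1]%classic : set R).
Notation vp := (@vpoint R G).
Hypothesis G_loopless : loopless G.
Implicit Types (S : pred (edge G)) (e f : edge G) (t : R).
Notation curve := (@curve R G).
Notation subdrawing := (@subdrawing R G).
Notation region := (@region R G).
Notation same_face := (connected_component (~` subdrawing predT)).

Lemma subdrawing_pointed_closed (A : set (vertex G)) (S : pred (edge G)) :
  closed (vp @` A `|` \bigcup_(e in [set e | S e]) curve e).
Proof.
apply: compact_closed; first exact: norm_hausdorff.
apply: compactU; last by apply: compact_finite_bigcup => e _; exact: arc_compact.
by apply: finite_compact; apply: finite_image; exact: finite_finset.
Qed.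

(* Deleting from the arc a piece on which it is not in the closure of the face leaves two
   pendant arcs, which separate nothing. *)
Lemma side_closure e p t0 : region e p -> ~ curve e p -> 0 < t0 < 1 ->
  closure (same_face p) (edge_arc e t0).
Proof.
move=> rp ep t001; apply: contrapT => ncl.
have [N [oN Nq NP]] : exists N, [/\ open N, N (edge_arc e t0) & forall z, N z -> ~ same_face p z].
  apply: contrapT => h; apply: ncl => B nB; apply: contrapT => h2; apply: h.
  exists (interior B); split; [exact: open_interior|exact: nB|].
  by move=> z /interior_subset Bz sz; apply: h2; exists z.
have nN : nbhs (edge_arc e t0) N by exact: open_nbhs_nbhs.
have /andP[t00 t01] := t001.
have I0t : I01 t0 by apply/I01P; rewrite !ltW.
have /within_nbhsP/(_ t0 N I0t nN)/nbhs_ballP[ep0 /= ep00 epN] := @arc_continuous R G e.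
have [dl [dl0 dle dlt dl1]] : exists dl : R, [/\ 0 < dl, dl < ep0, dl < t0 & t0 + dl < 1].
  set dl := Num.min (ep0 / 2) (Num.min (t0 / 2) ((1 - t0) / 2)).
  have d1 : dl <= ep0 / 2 by rewrite ge_min lexx.
  have d2 : dl <= t0 / 2 by rewrite !ge_min lexx orbT.
  have d3 : dl <= (1 - t0) / 2 by rewrite !ge_min lexx !orbT.
  have dl0 : 0 < dl by rewrite !lt_min !divr_gt0 // subr_gt0.
  by exists dl; split=> //; clear - d1 d2 d3 dl0 ep00 t00 t01; move: dl d1 d2 d3 dl0 => dl; lra.
have Nt t : t0 - dl <= t -> t <= t0 + dl -> N (edge_arc e t).
  move=> a b; apply: epN; last by apply/I01P; lra.
  by rewrite /ball /= ltr_norml; lra.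
pose q := edge_arc e t0.
have rq : region e q by exact: region_arc.
have Se : ~~ predC1 e e by rewrite /= eqxx.
have h0 := region_angle Se rp rq.
have cg (a b : R) : 0 <= a -> b <= 1 -> {within `[a, b]%classic, continuous (edge_arc e)}.
  move=> a0 b1; apply: continuous_subspaceW (@arc_continuous R G e) => u.
  by rewrite /= !in_itv /=; lra.
have inj u v : 0 <= u <= 1 -> 0 <= v <= 1 -> edge_arc e u = edge_arc e v -> u = v.
  by move=> /I01P Iu /I01P Iv; exact: (arc_injective G_loopless).
have q1 t : 0 <= t <= 1 -> edge_arc e t = q -> t = t0.
  by move=> tI /(inj t t0 tI); apply; rewrite !ltW.
pose X1 := subdrawing (predC1 e) `|` edge_arc e @` `[0, t0 - dl]%classic.
have h1 : has_angle X1 (cratio p q).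
  apply: angle_extend_pendant => //.
  - exact: subdrawing_closed.
  - lra.
  - by apply: cg; lra.
  - by move=> u v u1 v1; apply: inj; lra.
  - by rewrite arc_tail; exact: subdrawing_vpoint.
  - by move=> t t1; apply: arc_off => //; lra.
  - move=> t t1; split=> [h|/q1]; last by lra.
    by apply: ep; rewrite -h; apply: arc_mem; lra.
have clX1 : closed X1.
  apply: closedU; first exact: subdrawing_closed.
  apply: compact_closed; first exact: norm_hausdorff.
  by apply: continuous_compact; [apply: cg; lra|exact: segment_compact].
pose gam' t := edge_arc e (1 - t).
have cg' : {within `[0, 1 - (t0 + dl)]%classic, continuous gam'}.
  apply: (@within_comp _ _ _ _ I01 (fun t : R => 1 - t) (edge_arc e)).
  - by apply: continuous_subspaceT => t; apply: cvgB; [exact: cvg_cst|exact: cvg_id].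
  - exact: arc_continuous.
  - by move=> t; rewrite /= !in_itv /=; lra.
pose X2 := X1 `|` gam' @` `[0, 1 - (t0 + dl)]%classic.
have h2 : has_angle X2 (cratio p q).
  apply: angle_extend_pendant => //.
  - lra.
  - by move=> u v u1 v1 /inj h; have : 1 - u = 1 - v by [apply: h; lra]; lra.
  - by rewrite /gam' subr0 arc_head; left; exact: subdrawing_vpoint.
  - move=> t t1; rewrite /gam' => -[|[u]]; first by apply: arc_off => //; lra.
    by rewrite /= in_itv /= => u1 /inj h; have : u = 1 - t by [apply: h; lra]; lra.
  - move=> t t1; split=> [h|/q1 h]; last by have : 1 - t = t0 by [apply: h; lra]; lra.
    by apply: ep; rewrite -h; apply: arc_mem; lra.
have cX2 : compact X2.
  apply: compactU; last by apply: continuous_compact => //; exact: segment_compact.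
  apply: compactU; first exact: subdrawing_compact.
  by apply: continuous_compact; [apply: cg; lra|exact: segment_compact].
have X2sub : X2 `<=` subdrawing predT.
  move=> z; rewrite (drawing_split e) => -[[|[t + <-]]|[t + <-]]; first by left.
    by rewrite /= in_itv /= => t1; right; apply: arc_mem; lra.
  by rewrite /= in_itv /= => t1; right; apply: arc_mem; lra.
have X2cover z : subdrawing predT z -> ~ N z -> X2 z.
  rewrite (drawing_split e) => -[|[t /I01P t1 <-]] nz; first by left; left.
  case: (leP t (t0 - dl)) => a; first by left; right; exists t => //; rewrite /= in_itv /=; lra.
  case: (leP (t0 + dl) t) => b; last by case: nz; apply: Nt; exact: ltW.
  by right; exists (1 - t); [rewrite /= in_itv /=; lra|rewrite /gam' subKr].
have p0 : ~ subdrawing predT p by exact: region_off rp ep.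
have q2 : ~ X2 q.
  move=> [[|[t + /q1]]|[t + /q1]]; first exact: arc_off.
    by rewrite /= in_itv /= => a h; have : t = t0 by [apply: h; lra]; lra.
  by rewrite /= in_itv /= => a h; have : 1 - t = t0 by [apply: h; lra]; lra.
have pq := angle_same_component cX2 (fun h => p0 (X2sub _ h)) q2 h2.
apply: (NP q Nq).
have X2p : (~` X2) p by move=> /X2sub.
apply: (@locally_constant_prop _ (connected_component (~` X2) p) (same_face p)
  (@component_connected _ _ _) _ p q (connected_component_refl X2p) pq) => //; last exact: connected_component_refl.
move=> z /connected_component_sub nz.
have [Nz|nNz] := pselect (N z).
  exists N; first exact: open_nbhs_nbhs.
  by move=> w Nw _; split=> sz; [case: (NP z)|case: (NP w)].
have Xz : ~ subdrawing predT z by move=> /X2cover/(_ nNz).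
exists (same_face z).
  apply: open_nbhs_nbhs; split; last exact: connected_component_refl.
  by apply: component_open; exact/closed_openC/subdrawing_closed.
move=> w zw _; split=> h; first exact: connected_component_trans h zw.
exact: connected_component_trans h (connected_component_sym zw).
Qed.

End Sides.

Section Duality.
Local Open Scope classical_set_scope.
Local Open Scope ring_scope.
Context {R : realType} (G : plane_multigraph R).
Notation pl := (plane R).
Notation vp := (@vpoint R G).
Hypothesis G_loopless : loopless G.
Implicit Types (S : pred (edge G)) (e f : edge G) (t : R).
Notation subdrawing := (@subdrawing R G).
Notation region := (@region R G).
Notation curve := (@curve R G).
Notation same_face := (connected_component (~` subdrawing predT)).

Lemma path_turn S u v : connect (linked S) u v ->
  exists beta : pl -> R, forall z, ~ subdrawing S z -> {for z, continuous beta} /\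
    forall a, dir (vp u - z) a -> dir (vp v - z) (a + beta z).
Proof.
move=> /connectP[p pp ->]; elim: p u pp => [|w p IH] u /=.
  move=> _; exists (fun=> 0) => z _; split; first exact: cvg_cst.
  by move=> a; rewrite addr0.
move=> /andP[/existsP[e /andP[Se j]] /IH[be bP]].
have [al aP] := alpha_exists (@arc_continuous R G e).
have nc z : ~ subdrawing S z -> ~ curve e z by move=> nz ez; apply: nz; exact: arc_subdrawing ez.
have /orP[/andP[/eqP eu /eqP ew]|/andP[/eqP ew /eqP eu]] := j.
  exists (fun z => al z + be z) => z nz.
  have [ca da] := aP z (nc z nz); have [cb db] := bP z nz; split; first exact: cvgD.
  move=> a; have [+ _] := alpha_turn a (@arc_continuous R G e) (nc z nz) da.
  by rewrite arc_tail arc_head eu ew addrA => h /h; exact: db.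
exists (fun z => - al z + be z) => z nz.
have [ca da] := aP z (nc z nz); have [cb db] := bP z nz; split.
  by apply: cvgD => //; exact: cvgN.
move=> a; have [_ +] := alpha_turn a (@arc_continuous R G e) (nc z nz) da.
by rewrite arc_tail arc_head eu ew addrA => h /h; exact: db.
Qed.

Lemma winding_function S e : ~~ S e -> connect (linked S) (tail_end e) (head_end e) ->
  exists w : pl -> R,
    (forall z, ~ subdrawing (fun f => S f || (f == e)) z ->
      {for z, continuous w} /\ exists n : int, w z = n%:~R * (pi *+ 2)) /\
    forall n : int, ~ forall z, region e z -> ~ curve e z -> w z = n%:~R * (pi *+ 2).
Proof.
move=> Se /path_turn[be bP].
have [al aP] := alpha_exists (@arc_continuous R G e).
exists (fun z => al z - be z); split=> [z|n h].
  rewrite subdrawing_add => nz.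
  have nS : ~ subdrawing S z by move=> h; apply: nz; left.
  have ne : ~ curve e z by move=> h; apply: nz; right.
  have [ca da] := aP z ne; have [cb db] := bP z nS; split; first exact: cvgB.
  have v0 : vp (tail_end e) - z != 0.
    by rewrite subr_eq0; apply/eqP => h; apply: nS; rewrite -h; exact: subdrawing_vpoint.
  have [a da'] := dir_exists v0.
  have [+ _] := alpha_turn a (@arc_continuous R G e) ne da.
  rewrite arc_tail arc_head => /(_ da') d1.
  have [n nE] := dir_unique d1 (db _ da'); exists n; rewrite -nE; ring.
have ends t : t = 0 \/ t = 1 -> ~ region e (edge_arc e t).
  move=> t01 /connected_component_sub; apply.
  by case: t01 => ->; rewrite ?arc_tail ?arc_head; exact: subdrawing_vpoint.
apply: (@no_gluing R (edge_arc e) (region e) al (fun z => be z + n%:~R * (pi *+ 2))).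
- exact: arc_continuous.
- rewrite arc_tail arc_head => /point_inj h01.
  by have := G_loopless e; rewrite h01 eqxx.
- exact: region_open.
- by move=> t; exact: region_arc.
- by apply: ends; left.
- by apply: ends; right.
- exact: aP.
- move=> z rz; have nS : ~ subdrawing S z.
    have /connected_component_sub nz := rz.
    move=> Sz; apply: nz; apply: subdrawing_sub Sz => f Sf /=.
    by apply: contraNneq Se => <-.
  have [cb db] := bP z nS; split; first by apply: cvgD => //; exact: cvg_cst.
  by move=> a; rewrite arc_tail arc_head addrA => /db; exact: dir_shift.
- by move=> z rz ez; rewrite -(h z rz ez); ring.
Qed.

Lemma winding_component (w : pl -> R) (A : set pl) x p q :
  (forall z, A z -> {for z, continuous w} /\ exists n : int, w z = n%:~R * (pi *+ 2)) ->
  connected_component A x p -> connected_component A x q -> w p = w q.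
Proof.
move=> wP; apply: turns_constant; first exact: component_connected.
  apply/within_cvgP => z /connected_component_sub /wP[cw _].
  by apply: cvg_within_filter; exact: cw.
by move=> z /connected_component_sub /wP[].
Qed.

Lemma two_sides e : connect (linked (predC1 e)) (tail_end e) (head_end e) ->
  exists p q, [/\ region e p, ~ curve e p, region e q, ~ curve e q & ~ same_face p q].
Proof.
move=> ce; apply: contrapT => nh.
have same p q : region e p -> ~ curve e p -> region e q -> ~ curve e q -> same_face p q.
  by move=> rp ep rq eq; apply: contrapT => nf; apply: nh; exists p, q.
have [|w [wP wn]] := winding_function _ ce; first by rewrite /= eqxx.
have [[p [rp ep]]|np] := pselect (exists p, region e p /\ ~ curve e p); last first.
  by apply: (wn 0) => z rz ez; case: np; exists z.
have sub z : (~` subdrawing predT) z -> ~ subdrawing (fun f => predC1 e f || (f == e)) z.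
  by move=> nz h; apply: nz; apply: subdrawing_sub h.
have wP' z (nz : (~` subdrawing predT) z) := wP z (sub z nz).
have [_ [n nE]] := wP' p (region_off rp ep).
apply: (wn n) => z rz ez; rewrite -nE.
apply: (winding_component wP' (x := p)); first exact: same.
by apply: connected_component_refl; exact: (region_off rp ep).
Qed.

Hypothesis bridgeless : forall e, connect (linked (predC1 e)) (tail_end e) (head_end e).

Lemma sides_choice : exists lp rp : edge G -> pl, forall e,
  [/\ region e (lp e), ~ curve e (lp e), region e (rp e), ~ curve e (rp e) &
      ~ same_face (lp e) (rp e)].
Proof.
have /choice[s sP] : forall e, exists pq : pl * pl,
    [/\ region e pq.1, ~ curve e pq.1, region e pq.2, ~ curve e pq.2 & ~ same_face pq.1 pq.2].
  by move=> e; have [p [q h]] := two_sides (bridgeless e); exists (p, q).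
by exists (fun e => (s e).1), (fun e => (s e).2).
Qed.

Section Chosen.
Variables lp rp : edge G -> pl.
Hypothesis sidesP : forall e,
  [/\ region e (lp e), ~ curve e (lp e), region e (rp e), ~ curve e (rp e) &
      ~ same_face (lp e) (rp e)].

Lemma side_cases e z : region e z -> ~ curve e z -> same_face z (lp e) \/ same_face z (rp e).
Proof.
move=> rz ez; have [r1 e1 r2 e2 n] := sidesP e.
by case: (at_most_two_sides G_loopless rz r1 r2 ez e1 e2) => h; [left|right|].
Qed.

Lemma off_open S z : ~ subdrawing S z -> nbhs z (connected_component (~` subdrawing S) z).
Proof.
move=> nz; apply: open_nbhs_nbhs; split; last exact: connected_component_refl.
by apply: component_open; exact/closed_openC/subdrawing_closed.
Qed.

Lemma crossing S (P : pl -> Prop) p q :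
  (forall z w, same_face z w -> P z -> P w) ->
  (forall e, ~~ S e -> (P (lp e) <-> P (rp e))) ->
  ~ subdrawing predT p -> ~ subdrawing predT q ->
  connected_component (~` subdrawing S) p q -> P p -> P q.
Proof.
move=> Pf Pe Xp Xq pq Pp.
pose P' z := exists2 z', P z' /\ ~ subdrawing predT z' & closure (same_face z') z.
have P'off z : ~ subdrawing predT z -> (P' z <-> P z).
  move=> nz; split=> [[z' [Pz' nz']]|Pz].
    by move=> /(closure_component (@subdrawing_closed R G predT))[/Pf|//]; apply.
  by exists z => //; apply: subset_closure; exact: connected_component_refl.
have P'arc e t : ~~ S e -> 0 < t < 1 -> (P' (edge_arc e t) <-> P (lp e)).
  move=> Se t01; have [r1 e1 r2 e2 n] := sidesP e; split=> [[z' [Pz' nz']]|Pl].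
    have nb : nbhs (edge_arc e t) (region e).
      by apply: open_nbhs_nbhs; split; [exact: region_open|exact: region_arc].
    move=> /(_ _ nb)[w [sw rw]].
    have nw : ~ curve e w.
      have /connected_component_sub nw := sw.
      by move=> ew; apply: nw; exact: arc_subdrawing ew.
    have Pw : P w := Pf _ _ sw Pz'.
    by case: (side_cases rw nw) => /Pf h; [exact: h|apply/(Pe e Se); exact: h].
  by exists (lp e); [split=> //; exact: (region_off r1 e1)|exact: (side_closure G_loopless r1 e1 t01)].
apply/(P'off q Xq).
have Sp : ~ subdrawing S p by move=> h; apply: Xp; apply: subdrawing_sub h.
apply: (@locally_constant_prop _ (connected_component (~` subdrawing S) p) P'
  (@component_connected _ _ _) _ p q (connected_component_refl Sp) pq); last exact/P'off.
move=> z /connected_component_sub nz.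
have [Xz|Xz] := pselect (subdrawing predT z); last first.
  exists (same_face z); first exact: off_open.
  move=> w zw _; have Xw : ~ subdrawing predT w by have /connected_component_sub := zw.
  rewrite (P'off z Xz) (P'off w Xw); split; apply: Pf => //.
  exact: connected_component_sym.
have [e Se [t t01 zE]] : exists2 e, ~~ S e & exists2 t, 0 < t < 1 & z = edge_arc e t.
  case: Xz => [[v _ vz]|[e _ ez]]; first by case: nz; rewrite -vz; exact: subdrawing_vpoint.
  exists e; first by apply/negP => Se; apply: nz; exact: arc_subdrawing ez.
  by case: (arc_ends ez) => [h|h|//]; case: nz; rewrite h; exact: subdrawing_vpoint.
exists (region e).
  by apply: open_nbhs_nbhs; split; [exact: region_open|rewrite zE; exact: region_arc].
move=> w rw _; rewrite zE (P'arc e t Se t01).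
have [ew|ew] := pselect (curve e w).
  by have [s s01 ->] := region_arcE rw ew; rewrite (P'arc e s Se s01).
rewrite (P'off w (region_off rw ew)).
case: (side_cases rw ew) => h; split=> h'.
- exact: Pf (connected_component_sym h) h'.
- exact: Pf h h'.
- by apply: (Pf _ _ (connected_component_sym h)); apply/(Pe e Se).
- by apply/(Pe e Se); exact: Pf h h'.
Qed.

End Chosen.
End Duality.

Section Faces.
Local Open Scope classical_set_scope.
Local Open Scope ring_scope.
Context {R : realType} (G : plane_multigraph R).
Notation pl := (plane R).
Notation vp := (@vpoint R G).
Hypothesis G_loopless : loopless G.
Implicit Types (S : pred (edge G)) (e : edge G) (t : R).
Notation subdrawing := (@subdrawing R G).
Notation region := (@region R G).
Notation curve := (@curve R G).
Notation same_face := (connected_component (~` subdrawing predT)).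

Lemma vertices_dont_separate p q : ~ subdrawing predT p -> ~ subdrawing predT q ->
  connected_component (~` subdrawing pred0) p q.
Proof.
move=> Xp Xq.
have sub z : subdrawing pred0 z -> subdrawing predT z by apply: subdrawing_sub.
apply: angle_same_component; [exact: subdrawing_compact|by move=> /sub|by move=> /sub|].
have /choice[th thP] : forall z, exists a, subdrawing pred0 z -> dir (cratio p q z) a.
  move=> z; have [Sz|] := pselect (subdrawing pred0 z); last by exists 0.
  have [a aP] : exists a, dir (cratio p q z) a.
    by apply/dir_exists/cratio_neq0 => h; [apply: Xp|apply: Xq]; rewrite -h; exact: sub.
  by exists a.
exists th; split=> //; apply/within_nbhsP => z P Sz nP.
have clA := @subdrawing_pointed_closed R G [set v | vp v <> z] pred0.
apply: filterS (open_nbhs_nbhs (conj (closed_openC clA) _)).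
  move=> y /= ny Sy; have -> : y = z; last exact: nbhs_singleton.
  apply: contrapT => yz; apply: ny; case: Sy => [[v _ vy]|[e]//].
  by left; exists v => //=; rewrite vy.
by move=> [[v /= h /h]|[e]].
Qed.

Lemma bridge_angle S e p q : ~~ S e -> ~~ connect (linked S) (tail_end e) (head_end e) ->
  region e p -> region e q -> ~ curve e p -> ~ curve e q ->
  has_angle (subdrawing (fun f => S f || (f == e))) (cratio p q).
Proof.
move=> Se nc rp rq ep eq.
have [th [ph [n [cth dth cph dph [h0 h1]]]]] := angle_mismatch Se ep eq (region_angle Se rp rq).
pose K v := connect (linked S) (tail_end e) v.
pose A (b : bool) := vp @` [set v | K v == b] `|`
  \bigcup_(x in [set x | S x && (K (tail_end x) == b)]) curve x.
have clA b : closed (A b) by exact: subdrawing_pointed_closed.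
have SE : subdrawing S = A true `|` A false.
  apply/seteqP; split=> z.
    move=> [[v _ vz]|[x Sx xz]].
      by case Kv : (K v); [left|right]; left; exists v => //=; rewrite Kv.
    by case Kx : (K (tail_end x)); [left|right]; right; exists x => //=; apply/andP; rewrite Kx.
  have AS b : A b `<=` subdrawing S.
    by move=> y [[v _ vy]|[x /= /andP[Sx _] xy]]; [left; exists v|right; exists x].
  by case=> /AS.
have Khd x : S x -> K (head_end x) = K (tail_end x).
  move=> Sx; rewrite /K; apply/idP/idP => h; apply: connect_trans h (connect1 _).
    by rewrite linked_sym; exact: linked_edge.
  exact: linked_edge.
have onarc (x : edge G) t (v : vertex G) : 0 < t < 1 -> edge_arc x t <> vp v by exact: arc_vpoint.
have KA b v : A b (vp v) -> K v == b.
  move=> [[u /= ub /point_inj<-//]|[x /= /andP[Sx Kx]]].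
  move=> /arc_ends[/point_inj->//|/point_inj->|[t t01 /esym/(onarc _ _ _ t01)//]].
  by rewrite Khd.
have dis z : A true z -> A false z -> False.
  move=> At; case=> [[u /= ub uz]|[x /= /andP[Sx /eqP Kx]]].
    by move: At; rewrite -uz => /KA; rewrite (eqP ub).
  move=> /arc_ends[zE|zE|[t t01 zE]].
  - by move: At; rewrite zE => /KA; rewrite Kx.
  - by move: At; rewrite zE => /KA; rewrite Khd // Kx.
  case: At => [[u _]|[y /= /andP[Sy /eqP Ky]]]; first by rewrite zE => /esym/(onarc _ _ _ t01).
  rewrite zE => /arc_ends[/(onarc _ _ _ t01)//|/(onarc _ _ _ t01)//|[s s01]].
  apply: (arc_disjoint _ (open_unit t01) (open_unit s01)) => xy.
  by move: Ky; rewrite -xy Kx.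
pose th' z := if `[< A false z >] then th z + n%:~R * (pi *+ 2) else th z.
have cc b : {within A b, continuous th'}.
  have cb : {within A b, continuous th}.
    by apply: continuous_subspaceW cth; rewrite SE; case: b => z; [left|right].
  apply/within_cvgP => z Az; case: b cb Az => cb Az.
    have e1 y : A true y -> th' y = th y.
      by move=> Ay; rewrite /th'; case: asboolP => // /(dis y Ay).
    rewrite e1 //; apply: cvg_trans; last by move/within_cvgP : cb; apply.
    by apply: fmap_within_eq => y; rewrite inE => /e1.
  have e1 y : A false y -> th' y = th y + n%:~R * (pi *+ 2).
    by move=> Ay; rewrite /th'; case: asboolP.
  rewrite e1 //; apply: (@cvg_trans _ ((fun y => th y + n%:~R * (pi *+ 2)) @ within (A false) (nbhs z))).
    by apply: fmap_within_eq => y; rewrite inE => /e1.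
  by apply: cvgD; [move/within_cvgP : cb; exact|exact: cvg_cst].
apply: (@angle_extend_edge R G G_loopless S e (cratio p q) th' ph) => //.
- by rewrite SE; apply: withinU_continuous.
- by move=> z Sz; rewrite /th'; case: asboolP => _; [apply: dir_shift|]; exact: dth.
- by rewrite h0 /th'; case: asboolP => // /KA; rewrite /K connect0.
- rewrite h1 /th'; case: asboolP => // nA; case: nA; left; exists (head_end e) => //=.
  by rewrite /K (negbTE nc).
Qed.

Lemma arc_closure (C : set pl) e : closed C -> (forall t, 0 < t < 1 -> C (edge_arc e t)) ->
  curve e `<=` C.
Proof.
move=> clC Ct z [t0 It0 <-]; apply: contrapT => nC.
have nb : nbhs (edge_arc e t0) (~` C) by apply: open_nbhs_nbhs; split=> //; exact: closed_openC.
have /within_nbhsP/(_ t0 _ It0 nb)/nbhs_ballP[ep /= ep0 epN] := @arc_continuous R G e.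
have /I01P/andP[a b] := It0.
have [t [t01 bt]] : exists t : R, 0 < t < 1 /\ `|t0 - t| < ep.
  have m0 : 0 < Num.min ep 1 / 2 by rewrite divr_gt0 // lt_min ep0 ltr01.
  have m1 : Num.min ep 1 <= ep by rewrite ge_min lexx.
  have m2 : Num.min ep 1 <= 1 by rewrite ge_min lexx orbT.
  move: (Num.min ep 1) m0 m1 m2 => m m0 m1 m2.
  case: (leP t0 2^-1) => h.
    by exists (t0 + m / 3); split; [|rewrite ltr_norml]; lra.
  by exists (t0 - m / 3); split; [|rewrite ltr_norml]; lra.
by apply: (epN t bt) (Ct t t01); apply/I01P; lra.
Qed.

Hypothesis bridgeless : forall e, connect (linked (predC1 e)) (tail_end e) (head_end e).
Hypothesis no_isolated : forall v : vertex G, exists e, (tail_end e == v) || (head_end e == v).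

Section Chosen.
Variables lp rp : edge G -> pl.
Hypothesis sidesP : forall e,
  [/\ region e (lp e), ~ curve e (lp e), region e (rp e), ~ curve e (rp e) &
      ~ same_face (lp e) (rp e)].

Lemma frontier_edge p v : ~ subdrawing predT p -> closure (same_face p) (vp v) ->
  exists2 e, at_vertex v e & same_face p (lp e) \/ same_face p (rp e).
Proof.
move=> Xp cl; apply: contrapT => nh.
pose Y := vp @` [set u | u <> v] `|` \bigcup_(x in [set x | ~~ at_vertex v x]) curve x.
have clY : closed Y by exact: subdrawing_pointed_closed.
have nY : ~ Y (vp v).
  move=> [[u /= uv /point_inj//]|[x /= nx /arc_ends[/point_inj h|/point_inj h|[t t01]]]].
  - by move: nx; rewrite /at_vertex h eqxx.
  - by move: nx; rewrite /at_vertex h eqxx orbT.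
  - by move=> /esym/(arc_vpoint t01).
have YS : subdrawing (fun x => ~~ at_vertex v x) = Y `|` [set vp v].
  apply/seteqP; split=> z.
    move=> [[u _ uz]|xz]; last by left; right.
    by have [uv|uv] := pselect (u = v); [right; rewrite -uz uv|left; left; exists u].
  by move=> [[[u _ uz]|xz]|->]; [left; exists u|right|exact: subdrawing_vpoint].
have nb : nbhs (vp v) (~` Y) by apply: open_nbhs_nbhs; split=> //; exact: closed_openC.
have /nbhs_ballP[ep /= ep0 epY] := nb.
have [z [pz bz]] := cl _ (nbhsx_ballx (vp v) ep ep0).
have [e0 ev] := no_isolated v.
have [t t01 bt] : exists2 t, 0 < t < 1 & ball (vp v) ep (edge_arc e0 t).
  apply: contrapT => h.
  have cb : closed (~` ball (vp v) ep) by apply: open_closedC; exact: ball_open.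
  have /(_ (vp v)) : curve e0 `<=` ~` ball (vp v) ep.
    by apply: arc_closure => // t t01 bt; apply: h; exists t.
  apply; last exact: ballxx.
  case/orP : ev => /eqP <-; first by exists 0; [exact: I0|exact: arc_tail].
  by exists 1; [exact: I1|exact: arc_head].
set q := edge_arc e0 t in bt.
have zq : connected_component (~` Y) z q.
  by exists (ball (vp v) ep) => //; split=> //; exact: ball_connected.
have Xz : ~ subdrawing predT z by have /connected_component_sub := pz.
have e0S : ~~ (fun x => ~~ at_vertex v x) e0 by rewrite /= negbK.
have Sq : ~ subdrawing (fun x => ~~ at_vertex v x) q by exact: arc_off.
have Sz : ~ subdrawing (fun x => ~~ at_vertex v x) z by move=> h; apply: Xz; apply: subdrawing_sub h.
have zq' : connected_component (~` subdrawing (fun x => ~~ at_vertex v x)) z q.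
  apply: angle_same_component => //; first exact: subdrawing_compact.
  rewrite YS; apply: angle_extend_point => //.
  - by move=> h; apply: Xz; rewrite -h; exact: subdrawing_vpoint.
  - by move/esym; exact: arc_vpoint.
  - exact: same_component_angle.
have [r1 e1 r2 e2 n12] := sidesP e0.
have zl := connected_component_trans zq' (region_same e0S (region_arc e0 t01) r1).
have nP e : at_vertex v e -> ~ same_face p (lp e) /\ ~ same_face p (rp e).
  by move=> eS; split=> h; apply: nh; exists e => //; [left|right].
apply: nh; exists e0 => //; left.
apply: (crossing G_loopless sidesP (P := same_face p) _ _ Xz (region_off r1 e1) zl pz).
  by move=> u w uw pu; exact: connected_component_trans pu uw.
by move=> e /negPn/nP[a b].
Qed.

Definition rep (x : edge G * bool) : pl := if x.2 then rp x.1 else lp x.1.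
Definition canon (x : edge G * bool) : edge G * bool :=
  odflt x [pick y | `[< same_face (rep x) (rep y) >]].

Lemma rep_off x : ~ subdrawing predT (rep x).
Proof.
by case: x => e []; have [r1 e1 r2 e2 n12] := sidesP e; [exact: (region_off r2 e2)|exact: (region_off r1 e1)].
Qed.

Lemma canonP x : same_face (rep x) (rep (canon x)).
Proof.
rewrite /canon; case: pickP => [y /asboolP//|/(_ x)/asboolP[]].
by apply: connected_component_refl; exact: rep_off.
Qed.

Lemma canon_eq x y : same_face (rep x) (rep y) -> canon x = canon y.
Proof.
move=> xy; have E z : `[< same_face (rep x) (rep z) >] = `[< same_face (rep y) (rep z) >].
  by apply/asboolP/asboolP => h; apply: connected_component_trans h => //; exact: connected_component_sym.
rewrite /canon (eq_pick E); case: pickP => // /(_ y)/asboolP[].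
by apply: connected_component_refl; exact: rep_off.
Qed.

Lemma canon_idem x : canon (canon x) == canon x.
Proof. by apply/eqP/esym/canon_eq/canonP. Qed.

(* A face is represented by a canonical edge and side among those bordering it. *)
Definition face_type := {x : edge G * bool | canon x == x}.
Definition lface e : face_type := exist (fun x => canon x == x) _ (canon_idem (e, false)).
Definition rface e : face_type := exist (fun x => canon x == x) _ (canon_idem (e, true)).
Definition fpt (f : face_type) : pl := rep (val f).

Lemma fpt_inj f g : same_face (fpt f) (fpt g) -> f = g.
Proof.
by move=> /canon_eq e; apply: val_inj; rewrite /= -(eqP (valP f)) -(eqP (valP g)).
Qed.

Lemma lfaceP e : same_face (lp e) (fpt (lface e)). Proof. exact: (canonP (e, false)). Qed.
Lemma rfaceP e : same_face (rp e) (fpt (rface e)). Proof. exact: (canonP (e, true)). Qed.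

Lemma fpt_cover p : ~ subdrawing predT p -> forall e : edge G, exists f, same_face p (fpt f).
Proof.
move=> Xp e0; have [r1 e1 r2 e2 n12] := sidesP e0.
have X1 := region_off r1 e1.
apply: (crossing G_loopless sidesP (S := pred0) (P := fun z => exists f, same_face z (fpt f))
  _ _ X1 Xp (vertices_dont_separate X1 Xp)); last by exists (lface e0); exact: lfaceP.
  move=> z w zw [f zf]; exists f.
  exact: connected_component_trans (connected_component_sym zw) zf.
by move=> e _; split=> _; [exists (rface e); exact: rfaceP|exists (lface e); exact: lfaceP].
Qed.

Notation dual_linked := (@linked (@dual G face_type lface rface)).

Lemma dual_crossing S (f0 : face_type) p q :
  ~ subdrawing predT p -> ~ subdrawing predT q ->
  connected_component (~` subdrawing S) p q ->
  (exists2 f, same_face p (fpt f) & connect (dual_linked (fun x => ~~ S x)) f0 f) ->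
  exists2 f, same_face q (fpt f) & connect (dual_linked (fun x => ~~ S x)) f0 f.
Proof.
move=> Xp Xq pq.
apply: (crossing G_loopless sidesP (P := fun z => exists2 f, same_face z (fpt f) &
  connect (dual_linked (fun x => ~~ S x)) f0 f) _ _ Xp Xq pq).
  move=> z w zw [f zf cf]; exists f => //.
  exact: connected_component_trans (connected_component_sym zw) zf.
move=> e Se; have lk : dual_linked (fun x => ~~ S x) (lface e) (rface e).
  exact: (@linked_edge (dual lface rface) (fun x => ~~ S x) e).
split=> -[f pf cf].
  have fE : f = lface e.
    by apply: fpt_inj; exact: connected_component_trans (connected_component_sym pf) (lfaceP e).
  exists (rface e); first exact: rfaceP.
  by apply: connect_trans (connect1 lk); rewrite -fE.
have fE : f = rface e.
  by apply: fpt_inj; exact: connected_component_trans (connected_component_sym pf) (rfaceP e).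
exists (lface e); first exact: lfaceP.
rewrite linked_sym in lk.
by apply: connect_trans (connect1 lk); rewrite -fE.
Qed.

Lemma dual_connected (f g : face_type) : connect (dual_linked predT) f g.
Proof.
have Xf := @rep_off (val f); have Xg := @rep_off (val g).
have [] := @dual_crossing pred0 f (fpt f) (fpt g) Xf Xg (vertices_dont_separate Xf Xg).
  by exists f => //; apply: connected_component_refl.
move=> h /fpt_inj <-; exact: linked_sub.
Qed.

Lemma matroid_duality S e : ~~ S e ->
  connect (linked S) (tail_end e) (head_end e) =
  ~~ connect (dual_linked (fun x => ~~ S x && (x != e))) (lface e) (rface e).
Proof.
move=> Se; have [r1 e1 r2 e2 n12] := sidesP e.
have dS : (fun x => ~~ S x && (x != e)) =1 (fun x => ~~ (S x || (x == e))).
  by move=> x; rewrite negb_or.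
apply/idP/idP => [cn|]; last first.
  apply: contraNT => nc.
  have cX : compact (subdrawing (fun x => S x || (x == e))) by exact: subdrawing_compact.
  have cs := fun h1 h2 => angle_same_component cX h1 h2 (bridge_angle Se nc r1 r2 e1 e2).
  have X1 := region_off r1 e1; have X2 := region_off r2 e2.
  have [||f h] := @dual_crossing (fun x => S x || (x == e)) (lface e) (lp e) (rp e) X1 X2.
  - by apply: cs => h; [apply: X1|apply: X2]; apply: subdrawing_sub h.
  - by exists (lface e); [exact: lfaceP|exact: connect0].
  have -> : f = rface e.
    by apply: fpt_inj; exact: connected_component_trans (connected_component_sym h) (rfaceP e).
  by apply: linked_sub => x; rewrite dS.
apply/negP => cd.
have [w [wP wn]] := winding_function G_loopless Se cn.
have wS z z' : same_face z z' -> w z = w z'.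
  move=> zz'; have Xz : ~ subdrawing predT z.
    by have /connected_component_sub := connected_component_sym zz'.
  apply: (winding_component (A := ~` subdrawing predT) (x := z)) => //.
    by move=> y ny; apply: wP => h; apply: ny; apply: subdrawing_sub h.
  exact: connected_component_refl.
have wE f : connect (dual_linked (fun x => ~~ S x && (x != e))) (lface e) f ->
    w (lp e) = w (fpt f).
  rewrite (wS _ _ (lfaceP e)) => /connectP[p pp ->].
  elim: p (lface e) pp => //= g p IH f0 /andP[/existsP[x /andP[xS j]] /IH <-].
  have [s1 c1 s2 c2 m12] := sidesP x.
  have xS' : ~~ (fun x => S x || (x == e)) x by rewrite /= -dS.
  have lr : w (fpt (lface x)) = w (fpt (rface x)).
    rewrite -(wS _ _ (lfaceP x)) -(wS _ _ (rfaceP x)).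
    apply: (winding_component wP (x := lp x)); last exact: (region_same xS' s1 s2).
    exact: (region_same xS' s1 s1).
  by case/orP : j => /andP[/eqP <- /eqP <-].
have ce : w (lp e) = w (rp e) by rewrite (wE _ cd) (wS _ _ (rfaceP e)).
have [_ [n nE]] : {for lp e, continuous w} /\ exists n : int, w (lp e) = n%:~R * (pi *+ 2).
  by apply: wP => h; apply: (region_off r1 e1); apply: subdrawing_sub h.
apply: (wn n) => z rz ez; rewrite -nE.
by case: (side_cases G_loopless sidesP rz ez) => /wS ->.
Qed.

Lemma frontier_face (f : face_type) v :
  frontier (same_face (fpt f)) (vp v) <->
  exists2 e, at_vertex v e & (lface e == f) || (rface e == f).
Proof.
split=> [[cl _]|[e ev ef]].
  have [e ev h] := frontier_edge (@rep_off (val f)) cl; exists e => //.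
  case: h => h; apply/orP; [left|right]; apply/eqP/esym/fpt_inj.
    exact: connected_component_trans h (lfaceP e).
  exact: connected_component_trans h (rfaceP e).
split; last first.
  by move=> /interior_subset/connected_component_sub; apply; exact: subdrawing_vpoint.
have [r1 e1 r2 e2 n12] := sidesP e.
have ct t : 0 < t < 1 -> closure (same_face (fpt f)) (edge_arc e t).
  move=> t01; case/orP : ef => /eqP <-.
    rewrite -(same_connected_component (lfaceP e)); exact: side_closure.
  rewrite -(same_connected_component (rfaceP e)); exact: side_closure.
apply: (arc_closure (@closed_closure _ _) ct).
case/orP : ev => /eqP <-; first by exists 0; [exact: I0|exact: arc_tail].
by exists 1; [exact: I1|exact: arc_head].
Qed.

End Chosen.

Theorem plane_dual (e0 : edge G) :
  exists (Phi : finType) (lf rf : edge G -> Phi) (F_ : Phi -> set pl), [/\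
    forall F, face G F <-> exists f, F = F_ f,
    forall f v, frontier (F_ f) (vp v) <->
      exists2 e, at_vertex v e & (lf e == f) || (rf e == f),
    forall f g, connect (@linked (dual lf rf) predT) f g &
    forall S e, ~~ S e -> connect (linked S) (tail_end e) (head_end e) =
      ~~ connect (@linked (dual lf rf) (fun x => ~~ S x && (x != e))) (lf e) (rf e)].
Proof.
have [lp [rp sidesP]] := sides_choice G_loopless bridgeless.
exists (face_type lp rp), (lface sidesP), (rface sidesP), (fun f => same_face (fpt f)); split.
- move=> F; rewrite /face drawingE; split=> [[p Xp ->]|[f ->]].
    have [f pf] := fpt_cover sidesP Xp e0; exists f.
    exact: same_connected_component.
  by exists (fpt f) => //; exact: rep_off.
- exact: frontier_face.
- exact: dual_connected.
- exact: matroid_duality.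
Qed.

End Faces.

Theorem theorem3 (R : realType) (G : plane_multigraph R)
    (G_loopless : loopless G) (G_2connected : two_connected G)
    (F0 : set (plane R)) (F0_face : face G F0)
    (d : nat) (d_def : d = max_dist_to (face_vertices G F0))
    (k : nat) (k_def : k = max_face_size G) :
  exists D : tree_decomposition G,
    width D <= maxn (3 * d + k + 5) (2 * d + 2 * k + 1) /\
    forall F : set (plane R), face G F ->
      exists x : node D, face_vertices G F \subset bag x.
Proof.
have bridgeless e := bridgeless_joins G_loopless G_2connected (joins_ends e).
have no_isolated := incident_exists G_2connected.
have [v0 _] : exists v : vertex G, v \in predT.
  by apply/card_gt0P; case: G_2connected => _ /ltnW/ltnW.
have [e0 _] := no_isolated v0.
have [Phi [lf [rf [F_ [facesE frontE dconn dualP]]]]] :=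
  plane_dual G_loopless bridgeless no_isolated e0.
have vertsE f : face_vertices G (F_ f) = face_verts lf rf f.
  apply/finset.setP => v; rewrite finset.in_set; apply/asboolP/face_vertsP.
    by move=> /frontE.
  by move=> e_at; apply/frontE.
have [R0 F0E] := (facesE F0).1 F0_face.
have [c Rc] : exists e : edge G, @at_vertex (dual lf rf) R0 e.
  have lr := dneq G_loopless G_2connected dualP e0.
  have [f fR] : exists f, R0 != f.
    have [le|] := eqVneq R0 (lf e0); last by exists (lf e0).
    by exists (rf e0); rewrite le.
  have [e [w [_ j _ _]]] := first_edge (dconn R0 f) fR.
  by exists e; have [] := joins_at j.
have dd v : dist_to (face_verts lf rf R0) v <= d.
  rewrite d_def F0E vertsE /max_dist_to; exact: (leq_bigmax v).
have kk f : #|face_verts lf rf f| <= k.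
  rewrite k_def -vertsE /max_face_size.
  apply: (@leq_bigmax_cond _ _ (fun S : {set vertex G} => #|S|)).
  by apply/asboolP; exists (F_ f) => //; apply/facesE; exists f.
have [D [wD bD]] := dual_decomposition G_loopless G_2connected dconn dualP (ex_intro _ c Rc) dd kk.
exists D; split=> // F /facesE[f ->]; have [x fx] := bD f.
by exists x; rewrite vertsE.
Qed.
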